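(* Let $k\ge0$ and $0<\alpha\le1$. Given $R>0$ and $\epsilon>0$, let $x=(x_1,x_2)\in C(\pi\alpha/2)$ satisfy $R^{-1}\le|x|\le R$ and $\mathrm{Re}\,(x_1+ix_2)^{1/\alpha}\ge\epsilon$. Then, as $\tau\to\infty$, $$E^k_\alpha(x;\tau)=\frac1\alpha e^{\tau^{1/\alpha}(x_1+ix_2)^{1/\alpha}}\left\{1+O\left(\frac1{\tau^{1/\alpha}}\right)\right\}$$ and, for $j=1,2$, $$\frac{\partial}{\partial x_j}E^k_\alpha(x;\tau)=\frac{\partial}{\partial x_j}\left\{\frac1\alpha e^{\tau^{1/\alpha}(x_1+ix_2)^{1/\alpha}}\right\}\left\{1+O\left(\frac1{\tau^{1/\alpha}}\right)\right\},$$ where the $O$-terms are uniform in all such $x$ (for fixed $R,\epsilon,\alpha,k$).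
   Context: $C(\pi\alpha/2)=\{x=(x_1,x_2)\in\mathbf{R}^2: x_1>|x|\cos(\pi\alpha/2)\}$, and $(x_1+ix_2)^{1/\alpha}$ is the principal branch. Let $J_m$ be the Bessel function of order $m$ and $\hat J_m(t)=(2/t)^m m!\,J_m(t)$ with $\hat J_m(0)=1$. For $\tau>0$, $$E^k_\alpha(x;\tau)=\sum_{m=0}^\infty\frac{\{\tau(x_1+ix_2)\}^m}{\Gamma(\alpha m+1)}\,\hat J_m(k|x|),\quad x\in\mathbf{R}^2.$$ *)

(* Defs.v *)
(** Stdlib reals with Coquelicot.

    Coquelicot defines [C := (R * R)%type], so a point (x1,x2) of the plane
    and the complex number x1 + i x2 are the same object [x : C], with
    [Re x = x1], [Im x = x2] and |x| = [Cmod x]. *)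

From Stdlib Require Import Reals Factorial.
From Coquelicot Require Import Coquelicot.
Open Scope R_scope.

(** Euler's integral; only used for s >= 1. *)
Definition Gamma (s : R) : R :=
  RInt_gen (fun t => Rpower t (s - 1) * exp (- t))
           (at_right 0) (Rbar_locally p_infty).

Definition BesselJ (m : nat) (t : R) : R :=
  Series (fun n => (-1) ^ n / (INR (fact n) * INR (fact (n + m)))
                   * (t / 2) ^ (2 * n + m)).

Definition BesselJ_hat (m : nat) (t : R) : R :=
  if Req_EM_T t 0 then 1
  else (2 / t) ^ m * INR (fact m) * BesselJ m t.

Definition Cexp (z : C) : C := (exp (Re z) * cos (Im z), exp (Re z) * sin (Im z)).

(** Principal argument, with values in (-PI, PI] for z <> 0. *)
Definition Arg (z : C) : R :=
  if Rle_dec 0 (Im z) then acos (Re z / Cmod z) else - acos (Re z / Cmod z).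

Definition Clog (z : C) : C := (ln (Cmod z), Arg z).

(** Principal branch of z^s for a real exponent s and z <> 0. *)
Definition Cpower (z : C) (s : R) : C := Cexp (RtoC s * Clog z)%C.

(** [Series] is real-valued, so a complex series is summed componentwise. *)
Definition CSeries (a : nat -> C) : C :=
  (Series (fun m => Re (a m)), Series (fun m => Im (a m))).

Definition E (k alpha tau : R) (x : C) : C :=
  CSeries (fun m =>
    (Cpow (RtoC tau * x) m / RtoC (Gamma (alpha * INR m + 1))
     * RtoC (BesselJ_hat m (k * Cmod x)))%C).

Definition leading (alpha tau : R) (x : C) : C :=
  (RtoC (1 / alpha)
   * Cexp (RtoC (Rpower tau (1 / alpha)) * Cpower x (1 / alpha)))%C.

(** Open cone of half-angle beta around the positive x1-axis. *)
Definition cone (beta : R) (x : C) : Prop := Re x > Cmod x * cos beta.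

Definition region (alpha rad eps : R) (x : C) : Prop :=
  cone (PI * alpha / 2) x /\
  / rad <= Cmod x <= rad /\
  Re (Cpower x (1 / alpha)) >= eps.

(** Partial derivatives of complex-valued functions on the plane.  [Derive] is
    total, so existence is stated separately by [ex_partial1], [ex_partial2]. *)
Definition CDerive (f : R -> C) (t : R) : C :=
  (Derive (fun s => Re (f s)) t, Derive (fun s => Im (f s)) t).

Definition partial1 (f : C -> C) (x : C) : C :=
  CDerive (fun t => f (t, Im x)) (Re x).

Definition partial2 (f : C -> C) (x : C) : C :=
  CDerive (fun t => f (Re x, t)) (Im x).

Definition ex_partial1 (f : C -> C) (x : C) : Prop :=
  ex_derive (fun t => f (t, Im x)) (Re x).

Definition ex_partial2 (f : C -> C) (x : C) : Prop :=
  ex_derive (fun t => f (Re x, t)) (Im x).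

(** F(tau,x) = A(tau,x) {1 + O(g(tau))} as tau -> +oo, uniformly for x in D. *)
Definition uniform_asymp (D : C -> Prop) (g : R -> R) (F A : R -> C -> C) : Prop :=
  exists M T : R, forall (tau : R) (x : C), T <= tau -> D x ->
    exists theta : C,
      F tau x = (A tau x * (1 + theta))%C /\ Cmod theta <= M * g tau.

(* Main.v *)
(** For s >= 2, [1 / Gamma s] is the Bromwich integral of e^z z^(-s) over a
    vertical line: Laplace transforming that integral in its time variable
    produces both [Gamma s] and a residue equal to 1.  Summing geometric series
    under the integral represents the tail of the Mittag-Leffler series
    E_alpha(w) by an integral over a line far to the right; moving the line to
    Re z = (Re mu) / 2, where mu = w^(1/alpha), crosses the single pole z = mu,
    of residue e^mu / alpha, and leaves O(e^(Re mu / 2)).  The same argument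
    handles w E_alpha'(w).

    The Bessel factor is
      J^_m(t) = sum_n (-t^2/4)^n / n! * m! / (m+n)!,
    so that E^k = sum_n (-t^2/4)^n / n! * S_n(w) with
    S_n(w) = sum_m w^m m! / ((m+n)! Gamma(alpha m + 1)) and S_0 = E_alpha.
    From d/ds (s^n S_n(s w)) = s^(n-1) S_(n-1)(s w) and
    |S_0(s w)| <= L e^(s Re mu) one gets |S_n(w)| <= L e^(Re mu) / Re mu for
    n >= 1, so only S_0 contributes to the leading order.  Derivatives in x are
    treated in the same way, since J^_m' is again a series of this form. *)

Require Import Defs.
From Stdlib Require Import Reals.
From Coquelicot Require Import Coquelicot.
From Stdlib Require Import Lra Lia Psatz Factorial.
Open Scope R_scope.

(** * Complex differentiation *)

(** Contour shifts rest on differentiation under the integral sign: the derivative in c of the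
    integral of f over a segment of Re z = c is, up to a factor i, the difference of the end values
    of f, so a decaying integrand can be moved freely. At a pole the polar part A/(z - mu), whose
    integral is elementary, is subtracted. Arguments at least 2 make e^z z^(-s) absolutely
    integrable on vertical lines; the finitely many earlier terms of the series are polynomial in w
    and disappear in e^(Re mu / 2).

    The cone puts mu in the right half-plane, so an [atan] logarithm suffices and two arguments
    differ by less than PI. The bounds on |x| and on Re x^(1/alpha) give |mu| <= B Re mu, which
    keeps the line Re z = (Re mu) / 2 at a distance from mu comparable to |mu|; they also give 1 /
    Re mu <= 1 / (eps tau^(1/alpha)), the source of the error term. Since 1/alpha >= 1, (s
    w)^(1/alpha) = s^(1/alpha) mu with s^(1/alpha) <= s on [0, 1], whence the bound on S_0(s w). *)

Definition Cdiff (f : C -> C) (z l : C) : Prop :=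
  @is_derive C_AbsRing (AbsRing_NormedModule C_AbsRing) f z l.

(** Unfolds the filters once and for all: the balls and the norm of [AbsRing_NormedModule C_AbsRing]
    are those of [Cmod], so later estimates deal with increments only. *)
Lemma Cdiff_iff (f : C -> C) (z l : C) :
  Cdiff f z l <->
  forall eps : R, 0 < eps -> exists d : R, 0 < d /\ forall h : C, Cmod h < d ->
    (Cmod (f (z + h) - f z - l * h) <= eps * Cmod h)%C.
Proof.
  split.
  - intros [_ H] eps Heps.
    destruct (H z (fun P HP => HP) (mkposreal eps Heps)) as [d Hd].
    exists d; split; [apply cond_pos|]. intros h Hh.
    assert (Hb : @ball (AbsRing_UniformSpace C_AbsRing) z d (z + h)%C).
    { unfold ball; simpl; unfold AbsRing_ball, minus, plus, opp, abs; simpl.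
      replace (z + h + - z)%C with h by ring. exact Hh. }
    generalize (Hd _ Hb); unfold minus, plus, opp, scal, norm; simpl.
    unfold mult; simpl.
    replace (z + h + - z)%C with h by ring.
    replace (f (z + h) + - f z + - (h * l))%C with (f (z + h) - f z - l * h)%C by ring.
    easy.
  - intros H. split.
    + apply is_linear_scal_l.
    + intros x Hx.
      assert (E : z = x).
      { apply (@is_filter_lim_locally_unique C_AbsRing (AbsRing_NormedModule C_AbsRing)). exact Hx. }
      subst x. intros eps.
      destruct (H eps (cond_pos eps)) as [d [Hd Hh]].
      exists (mkposreal d Hd). change (forall y : C, @ball (AbsRing_UniformSpace C_AbsRing) z d y ->
        Cmod (minus (minus (f y) (f z)) (scal (minus y z) l)) <= eps * Cmod (minus y z)).
      intros y Hy.
      unfold ball in Hy; simpl in Hy; unfold AbsRing_ball, minus, plus, opp, abs in Hy; simpl in Hy.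
      unfold minus, plus, opp, scal, norm; simpl. unfold mult; simpl.
      generalize (Hh (y + - z)%C Hy).
      replace (z + (y + - z))%C with y by ring.
      replace (f y + - f z + - ((y + - z) * l))%C with (f y - f z - l * (y + - z))%C by ring.
      easy.
Qed.

(** The criterion by which the inverse, the exponential and the logarithm are differentiated: each
    has an explicit second-order remainder. *)
Lemma Cdiff_quad (f : C -> C) (z l : C) (M d : R) :
  0 < d ->
  (forall h : C, Cmod h < d -> (Cmod (f (z + h) - f z - l * h) <= M * Cmod h ^ 2)%C) ->
  Cdiff f z l.
Proof.
  intros Hd H. apply Cdiff_iff. intros eps Heps.
  assert (HM : 0 < Rabs M + 1) by (generalize (Rabs_pos M); lra).
  exists (Rmin d (eps / (Rabs M + 1))). split.
  - apply Rmin_pos; auto. now apply Rdiv_lt_0_compat.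
  - intros h Hh.
    assert (H1 : Cmod h < d) by (eapply Rlt_le_trans; [exact Hh|apply Rmin_l]).
    assert (H2 : Cmod h < eps / (Rabs M + 1)) by (eapply Rlt_le_trans; [exact Hh|apply Rmin_r]).
    apply Rle_trans with (1 := H h H1).
    assert (H3 : Cmod h * (Rabs M + 1) <= eps).
    { apply Rlt_le. apply (Rmult_lt_compat_r (Rabs M + 1)) in H2; auto.
      unfold Rdiv in H2. rewrite Rmult_assoc, Rinv_l, Rmult_1_r in H2; lra. }
    generalize (Cmod_ge_0 h) (Rle_abs M). intros. nra.
Qed.

Lemma Cdiff_ext (f g : C -> C) (z l : C) :
  (forall u, f u = g u) -> Cdiff f z l -> Cdiff g z l.
Proof. intros H. apply is_derive_ext. exact H. Qed.

Lemma Cdiff_const (a z : C) : Cdiff (fun _ => a) z 0.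
Proof. apply (@is_derive_const C_AbsRing (AbsRing_NormedModule C_AbsRing)). Qed.

Lemma Cdiff_id (z : C) : Cdiff (fun u => u) z 1.
Proof. apply (@is_derive_id C_AbsRing). Qed.

Lemma Cdiff_plus (f g : C -> C) (z lf lg : C) :
  Cdiff f z lf -> Cdiff g z lg -> Cdiff (fun u => f u + g u)%C z (lf + lg)%C.
Proof. apply (@is_derive_plus C_AbsRing (AbsRing_NormedModule C_AbsRing)). Qed.

Lemma Cdiff_mult (f g : C -> C) (z lf lg : C) :
  Cdiff f z lf -> Cdiff g z lg -> Cdiff (fun u => f u * g u)%C z (lf * g z + f z * lg)%C.
Proof.
  intros Hf Hg. apply (@is_derive_mult C_AbsRing f g z lf lg Hf Hg).
  intros; apply Cmult_comm.
Qed.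

Lemma Cdiff_comp (f g : C -> C) (z lf lg : C) :
  Cdiff f (g z) lf -> Cdiff g z lg -> Cdiff (fun u => f (g u)) z (lg * lf)%C.
Proof. apply (@is_derive_comp C_AbsRing (AbsRing_NormedModule C_AbsRing)). Qed.

Lemma Cdiff_inv (z : C) : z <> 0%C -> Cdiff Cinv z (- / (z * z))%C.
Proof.
  intros Hz. assert (Hm : 0 < Cmod z) by (now apply Cmod_gt_0).
  (* The remainder is h^2 / (z^2 (z + h)), and |z + h| >= |z| / 2 on the chosen disc. *)
  apply (Cdiff_quad _ _ _ (2 / (Cmod z ^ 3)) (Cmod z / 2)).
  - lra.
  - intros h Hh.
    assert (H1 : Cmod z / 2 <= Cmod (z + h)).
    { generalize (Cmod_triangle (z + h) (- h)). rewrite Cmod_opp.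
      replace (z + h + - h)%C with z by ring. lra. }
    assert (Hn : (z + h)%C <> 0%C) by (apply Cmod_gt_0; lra).
    replace (/ (z + h) - / z - - / (z * z) * h)%C with (h * h / ((z * z) * (z + h)))%C
      by (field; repeat split; auto).
    rewrite Cmod_div, !Cmod_mult by (repeat apply Cmult_neq_0; auto).
    apply (Rmult_le_reg_r (Cmod z * Cmod z * Cmod (z + h))).
    + repeat apply Rmult_lt_0_compat; auto; lra.
    + unfold Rdiv at 1. rewrite Rmult_assoc, Rinv_l, Rmult_1_r.
      * replace (2 / Cmod z ^ 3 * Cmod h ^ 2 * (Cmod z * Cmod z * Cmod (z + h)))
          with (Cmod h * Cmod h * (Cmod (z + h) / (Cmod z / 2))) by (field; lra).
        rewrite <- (Rmult_1_r (Cmod h * Cmod h)) at 1.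
        apply Rmult_le_compat_l.
        -- apply Rmult_le_pos; apply Cmod_ge_0.
        -- apply (Rmult_le_reg_r (Cmod z / 2)); [lra|].
           unfold Rdiv at 2. rewrite Rmult_assoc, Rinv_l; lra.
      * apply Rgt_not_eq. repeat apply Rmult_lt_0_compat; auto; lra.
Qed.

Lemma Cmod_le_Re_Im (z : C) : Cmod z <= Rabs (Re z) + Rabs (Im z).
Proof.
  unfold Cmod. rewrite <- (sqrt_pow2 (Rabs (Re z) + Rabs (Im z))).
  - apply sqrt_le_1_alt. fold (Re z) (Im z).
    generalize (Rabs_pos (Re z)) (Rabs_pos (Im z)) (pow2_abs (Re z)) (pow2_abs (Im z)).
    unfold Re, Im. simpl. nra.
  - generalize (Rabs_pos (Re z)) (Rabs_pos (Im z)); lra.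
Qed.

Lemma Im_le_Cmod (z : C) : Rabs (Im z) <= Cmod z.
Proof. eapply Rle_trans; [apply Rmax_r|apply (Rmax_Cmod z)]. Qed.

Lemma Cexp_0 : Cexp 0 = 1.
Proof. unfold Cexp; simpl. rewrite exp_0, cos_0, sin_0. unfold RtoC. f_equal; ring. Qed.

Lemma Cexp_plus (z u : C) : Cexp (z + u) = (Cexp z * Cexp u)%C.
Proof.
  unfold Cexp, Cmult, Cplus, Re, Im; simpl. rewrite exp_plus, cos_plus, sin_plus.
  f_equal; ring.
Qed.

Lemma Cmod_Cexp (z : C) : Cmod (Cexp z) = exp (Re z).
Proof.
  unfold Cmod, Cexp; simpl.
  replace (exp (Re z) * cos (Im z) * (exp (Re z) * cos (Im z) * 1) +
    exp (Re z) * sin (Im z) * (exp (Re z) * sin (Im z) * 1)) with (exp (Re z) ^ 2).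
  - apply sqrt_pow2. left; apply exp_pos.
  - generalize (sin2_cos2 (Im z)). unfold Rsqr. intros H.
    replace (exp (Re z) ^ 2) with (exp (Re z) ^ 2 * (sin (Im z) * sin (Im z) + cos (Im z) * cos (Im z))).
    + ring.
    + rewrite H; ring.
Qed.

Lemma Cexp_neq_0 (z : C) : Cexp z <> 0%C.
Proof. apply Cmod_gt_0. rewrite Cmod_Cexp. apply exp_pos. Qed.

Lemma Cexp_opp (z : C) : Cexp (- z) = (/ Cexp z)%C.
Proof.
  assert (H : (Cexp (- z) * Cexp z)%C = 1%C).
  { rewrite <- Cexp_plus. replace (- z + z)%C with (RtoC 0) by ring. apply Cexp_0. }
  replace (Cexp (- z)) with (Cexp (- z) * Cexp z * / Cexp z)%C.
  - rewrite H. ring.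
  - field. apply Cexp_neq_0.
Qed.

Lemma Cexp_RtoC (x : R) : Cexp (RtoC x) = RtoC (exp x).
Proof. unfold Cexp, RtoC; simpl. rewrite cos_0, sin_0. f_equal; ring. Qed.

(** The lower bound is 1 + x <= e^x. For the upper one, e^x e^(-x/2)^2 = 1 and e^(-x/2) >= 1 - x/2
    give e^x <= (1 - x/2)^(-2), a rational function that is at most 1 + x + 2 x^2 on this range. *)
Lemma exp_quad (x : R) : Rabs x <= 1 / 2 -> Rabs (exp x - 1 - x) <= 2 * x ^ 2.
Proof.
  intros Hx. apply Rabs_le_between in Hx.
  assert (H1 := exp_ineq1_le x). assert (H3 := exp_ineq1_le (- x / 2)). assert (He := exp_pos x).
  assert (E : exp x * (exp (- x / 2) * exp (- x / 2)) = 1).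
  { rewrite <- !exp_plus. replace (x + (- x / 2 + - x / 2)) with 0 by field. apply exp_0. }
  rewrite Rabs_right by lra.
  assert (H4 : 0 < exp (- x / 2)) by apply exp_pos.
  assert (H5 : (1 - x / 2) * (1 - x / 2) <= exp (- x / 2) * exp (- x / 2)) by (apply Rmult_le_compat; lra).
  assert (H6 : exp x * ((1 - x / 2) * (1 - x / 2)) <= 1) 
    by (apply Rle_trans with (2 := Req_le _ _ E); apply Rmult_le_compat_l; lra).
  assert (H7 : 1 <= (1 + x + 2 * x ^ 2) * ((1 - x / 2) * (1 - x / 2))).
  { replace ((1 + x + 2 * x ^ 2) * ((1 - x / 2) * (1 - x / 2))) with
      (1 + x ^ 2 * (5 / 4 - 7 / 4 * x + x ^ 2 / 2)) by field.
    assert (0 <= x ^ 2) by nra. nra. }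
  assert (H8 : 0 < (1 - x / 2) * (1 - x / 2)) by nra.
  apply (Rmult_le_reg_r ((1 - x / 2) * (1 - x / 2))); nra.
Qed.

Lemma sin_abs_le (x : R) : Rabs (sin x) <= Rabs x.
Proof.
  destruct (MVT_gen sin 0 x cos) as [c [_ Hc]].
  - intros. auto_derive; auto; ring.
  - intros. apply continuity_pt_filterlim. apply (continuous_sin).
  - rewrite sin_0, !Rminus_0_r in Hc. rewrite Hc, Rabs_mult.
    assert (Rabs (cos c) <= 1) by (apply Rabs_le, COS_bound).
    generalize (Rabs_pos x); nra.
Qed.

(** Real and imaginary part split into real Taylor remainders of exp, cos and sin. These add up to 8
    |h|^2, so 20 leaves room. *)
Lemma Cexp_quad (h : C) : Cmod h <= 1 / 2 -> (Cmod (Cexp h - 1 - h) <= 20 * Cmod h ^ 2)%C.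
Proof.
  intros Hh. assert (Hx := re_le_Cmod h). assert (Hy := Im_le_Cmod h).
  apply Rle_trans with (1 := Cmod_le_Re_Im _).
  unfold Cexp; simpl. set (x := Re h) in *. set (y := Im h) in *.
  assert (Ex := exp_quad x ltac:(lra)).
  assert (Hc : Rabs (cos y - 1) <= y ^ 2 / 2).
  { assert (H := COS_bound y). replace y with (2 * (y / 2)) at 1 by field.
    rewrite cos_2a_sin.
    assert (Hs := sin_abs_le (y / 2)).
    apply Rsqr_le_abs_1 in Hs. unfold Rsqr in Hs.
    apply Rabs_le. nra. }
  assert (Hs : Rabs (sin y - y) <= y ^ 2).
  { destruct (MVT_gen (fun t => sin t - t) 0 y (fun t => cos t - 1)) as [c [Hcc Hc']].
    - intros. auto_derive; auto; ring.
    - intros. apply continuity_pt_filterlim.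
      apply (continuous_minus (V := R_NormedModule)); [apply continuous_sin|apply continuous_id].
    - rewrite sin_0, !Rminus_0_r in Hc'. rewrite Hc', Rabs_mult.
      assert (H1 : Rabs c <= Rabs y).
      { unfold Rmin, Rmax in Hcc. destruct (Rle_dec 0 y).
        - rewrite !Rabs_right; lra.
        - rewrite !Rabs_left1; lra. }
      assert (H2 : Rabs (cos c - 1) <= Rabs y).
      { destruct (MVT_gen cos 0 c (fun t => - sin t)) as [e [_ He]].
        - intros. auto_derive; auto; ring.
        - intros. apply continuity_pt_filterlim. apply continuous_cos.
        - rewrite cos_0, Rminus_0_r in He. rewrite He, Rabs_mult, Rabs_Ropp.
          assert (Rabs (sin e) <= 1) by (apply Rabs_le, SIN_bound).
          generalize (Rabs_pos c); nra. }
      rewrite <- (pow2_abs y). generalize (Rabs_pos y); nra. }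
  assert (Hsy : Rabs (sin y) <= 1) by (apply Rabs_le, SIN_bound).
  assert (Hcy : Rabs (cos y) <= 1) by (apply Rabs_le, COS_bound).
  assert (X2 : x ^ 2 <= Cmod h ^ 2) by (rewrite <- (pow2_abs x); generalize (Rabs_pos x); nra).
  assert (Y2 : y ^ 2 <= Cmod h ^ 2) by (rewrite <- (pow2_abs y); generalize (Rabs_pos y); nra).
  assert (XY : Rabs x * Rabs y <= Cmod h ^ 2) by (generalize (Rabs_pos x) (Rabs_pos y); nra).
  fold (Re h) (Im h) x y.
  replace (exp x * cos y + - (1) + - x) with ((exp x - 1 - x) * cos y + (1 + x) * (cos y - 1)) by ring.
  replace (exp x * sin y + - 0 + - y) with ((exp x - 1 - x) * sin y + x * (sin y - y) + x * y + (sin y - y)) by ring.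
  assert (P1 : Rabs ((exp x - 1 - x) * cos y) <= 2 * x ^ 2).
  { rewrite Rabs_mult. generalize (Rabs_pos (exp x - 1 - x)) (Rabs_pos (cos y)); nra. }
  assert (P2 : Rabs ((1 + x) * (cos y - 1)) <= y ^ 2).
  { rewrite Rabs_mult. assert (Rabs (1 + x) <= 2).
    { apply Rabs_le. assert (Rabs x <= 1 / 2) as Hx' by lra. apply Rabs_le_between in Hx'. lra. }
    generalize (Rabs_pos (1 + x)) (Rabs_pos (cos y - 1)); nra. }
  assert (P3 : Rabs ((exp x - 1 - x) * sin y) <= 2 * x ^ 2).
  { rewrite Rabs_mult. generalize (Rabs_pos (exp x - 1 - x)) (Rabs_pos (sin y)); nra. }
  assert (P4 : Rabs (x * (sin y - y)) <= y ^ 2).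
  { rewrite Rabs_mult. generalize (Rabs_pos x) (Rabs_pos (sin y - y)); nra. }
  assert (P5 : Rabs (x * y) <= Cmod h ^ 2) by (rewrite Rabs_mult; auto).
  generalize (Rabs_triang ((exp x - 1 - x) * cos y) ((1 + x) * (cos y - 1)))
    (Rabs_triang ((exp x - 1 - x) * sin y + x * (sin y - y) + x * y) (sin y - y))
    (Rabs_triang ((exp x - 1 - x) * sin y + x * (sin y - y)) (x * y))
    (Rabs_triang ((exp x - 1 - x) * sin y) (x * (sin y - y))).
  change (fst h) with x. change (snd h) with y. replace (Cmod h * (Cmod h * 1)) with (Cmod h ^ 2) by ring. clearbody x y. intros. generalize (pow2_ge_0 (Cmod h)). lra.
Qed.

Lemma Cdiff_exp (z : C) : Cdiff Cexp z (Cexp z).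
Proof.
  apply (Cdiff_quad _ _ _ (Cmod (Cexp z) * 20) (1 / 2)); [lra|].
  intros h Hh. rewrite Cexp_plus.
  replace (Cexp z * Cexp h - Cexp z - Cexp z * h)%C with (Cexp z * (Cexp h - 1 - h))%C by ring.
  rewrite Cmod_mult, Rmult_assoc. apply Rmult_le_compat_l; [apply Cmod_ge_0|].
  apply Cexp_quad; lra.
Qed.

Lemma surj_C (z : C) : z = (Re z, Im z).
Proof. now destruct z. Qed.

(** The principal logarithm, by a formula valid only for [Re z > 0]. *)
Definition Clog_rhp (z : C) : C := (ln (Cmod z), atan (Im z / Re z)).

Lemma Re_pos_neq_0 (z : C) : 0 < Re z -> z <> 0%C.
Proof. intros H E. rewrite E in H. simpl in H. lra. Qed.

Lemma Cexp_Clog_rhp (z : C) : 0 < Re z -> Cexp (Clog_rhp z) = z.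
Proof.
  intros H. assert (Hm : 0 < Cmod z) by (apply Cmod_gt_0, Re_pos_neq_0, H).
  unfold Cexp, Clog_rhp; simpl. rewrite exp_ln by auto. rewrite cos_atan, sin_atan.
  set (t := Im z / Re z).
  assert (Hs : 0 < sqrt (1 + t²)) by (apply sqrt_lt_R0; unfold Rsqr; nra).
  assert (E : Cmod z = Re z * sqrt (1 + t²)).
  { apply sqrt_lem_1.
    - generalize (pow2_ge_0 (fst z)) (pow2_ge_0 (snd z)). lra.
    - apply Rmult_le_pos; lra.
    - replace (Re z * sqrt (1 + t²) * (Re z * sqrt (1 + t²))) with
        (Re z ^ 2 * (sqrt (1 + t²) * sqrt (1 + t²))) by ring.
      rewrite sqrt_sqrt by (generalize (Rle_0_sqr t); lra). unfold t, Rsqr, Re, Im in *. field. lra. }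
  rewrite E. transitivity (Re z, Im z); [|symmetry; apply surj_C]. f_equal.
  - field. lra.
  - replace (Re z * sqrt (1 + t²) * (t / sqrt (1 + t²))) with (Re z * t) by (field; lra).
    unfold t. field. lra.
Qed.

Lemma Clog_rhp_Cexp (u : C) : Rabs (Im u) < PI / 2 -> Clog_rhp (Cexp u) = u.
Proof.
  intros H. apply Rabs_def2 in H. unfold Clog_rhp. rewrite Cmod_Cexp, ln_exp. unfold Cexp; simpl.
  transitivity (Re u, Im u); [|symmetry; apply surj_C]. f_equal.
  assert (Hc : 0 < cos (Im u)) by (apply cos_gt_0; lra).
  replace (exp (Re u) * sin (Im u) / (exp (Re u) * cos (Im u))) with (tan (Im u)).
  - apply atan_tan. lra.
  - unfold tan. field. split; [lra|]. apply Rgt_not_eq, exp_pos.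
Qed.

Lemma atan_lip (a b : R) : Rabs (atan a - atan b) <= Rabs (a - b).
Proof.
  destruct (MVT_gen atan b a (fun t => / (1 + t ^ 2))) as [c [_ Hc]].
  - intros. auto_derive; auto; unfold Rsqr; field_simplify_eq; nra.
  - intros. apply derivable_continuous_pt. apply derivable_pt_atan.
  - rewrite Hc, Rabs_mult. assert (0 < 1 + c ^ 2) by nra.
    assert (0 < / (1 + c ^ 2) <= 1).
    { split; [now apply Rinv_0_lt_compat|]. rewrite <- Rinv_1. apply Rinv_le_contravar; nra. }
    rewrite (Rabs_right (/ _)) by lra. generalize (Rabs_pos (a - b)); nra.
Qed.

Lemma ln_lip (m a b : R) : 0 < m -> m <= a -> m <= b -> Rabs (ln a - ln b) <= Rabs (a - b) / m.
Proof.
  intros Hm Ha Hb.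
  assert (H : forall a b, m <= a -> m <= b -> ln a - ln b <= Rabs (a - b) / m).
  { clear a b Ha Hb. intros a b Ha Hb. rewrite <- ln_div by lra.
    apply Rle_trans with (a / b - 1).
    - assert (Hp : 0 < a / b) by (apply Rdiv_lt_0_compat; lra).
      generalize (exp_ineq1_le (ln (a / b))). rewrite exp_ln by auto. lra.
    - replace (a / b - 1) with ((a - b) / b) by (field; lra).
      apply Rle_trans with (Rabs (a - b) / b).
      + apply Rmult_le_compat_r; [left; apply Rinv_0_lt_compat; lra|apply Rle_abs].
      + apply Rmult_le_compat_l; [apply Rabs_pos|]. apply Rinv_le_contravar; auto. }
  apply Rabs_le. split; [|auto].
  generalize (H b a Hb Ha). rewrite Rabs_minus_sym. lra.
Qed.

(** A crude modulus of continuity, whose purpose is to show that log(z + h) - log z is O(h) before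
    the derivative is known. *)
Lemma Clog_rhp_lip (z h : C) : 0 < Re z -> Cmod h < Re z / 2 ->
  (Cmod (Clog_rhp (z + h) - Clog_rhp z) <= (2 / Re z + 4 * Cmod z / (Re z) ^ 2) * Cmod h)%C.
Proof.
  intros Hz Hh. apply Rle_trans with (1 := Cmod_le_Re_Im _).
  unfold Clog_rhp; simpl. rewrite Rmult_plus_distr_r.
  assert (Hr := re_le_Cmod h). assert (Hi := Im_le_Cmod h).
  assert (Hzr := re_le_Cmod z). assert (Hzi := Im_le_Cmod z).
  rewrite (Rabs_right (Re z)) in Hzr by lra.
  change (fst h) with (Re h). change (snd h) with (Im h).
  change (fst z) with (Re z). change (snd z) with (Im z).
  assert (Hr' := Rabs_le_between (Re h) (Re z / 2)).
  assert (Hrr : - (Re z / 2) <= Re h <= Re z / 2) by (apply Hr'; lra).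
  assert (Hden : Re z / 2 <= Re z + Re h) by lra.
  apply Rplus_le_compat.
  - assert (T1 := Cmod_triangle (z + h) (- h)). rewrite Cmod_opp in T1.
    replace (z + h + - h)%C with z in T1 by ring.
    assert (T2 := Cmod_triangle z h).
    apply Rle_trans with (1 := ln_lip (Re z / 2) (Cmod (z + h)) (Cmod z) ltac:(lra) ltac:(lra) ltac:(lra)).
    replace (2 / Re z * Cmod h) with (Cmod h / (Re z / 2)) by (field; lra).
    apply Rmult_le_compat_r; [left; apply Rinv_0_lt_compat; lra|].
    apply Rabs_le. lra.
  - eapply Rle_trans; [apply atan_lip|].
    replace ((Im z + Im h) / (Re z + Re h) - Im z / Re z) with
      ((Im h * Re z + - (Im z * Re h)) / ((Re z + Re h) * Re z)) by (field; lra).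
    unfold Rdiv at 1. rewrite Rabs_mult, Rabs_inv.
    assert (D : Re z ^ 2 / 2 <= (Re z + Re h) * Re z) by nra.
    assert (D0 : 0 < Re z ^ 2 / 2) by nra.
    rewrite (Rabs_right ((Re z + Re h) * Re z)) by lra.
    replace (4 * Cmod z / (Re z * (Re z * 1)) * Cmod h) with (2 * Cmod z * Cmod h * / (Re z ^ 2 / 2)) by (field; lra).
    apply Rmult_le_compat.
    + apply Rabs_pos.
    + left; apply Rinv_0_lt_compat; lra.
    + apply Rle_trans with (1 := Rabs_triang _ _). rewrite Rabs_Ropp, !Rabs_mult, (Rabs_right (Re z)) by lra.
      assert (Rabs (Im h) * Re z <= Cmod h * Cmod z) by (apply Rmult_le_compat; try lra; apply Rabs_pos).
      assert (Rabs (Im z) * Rabs (Re h) <= Cmod z * Cmod h) by (apply Rmult_le_compat; try lra; apply Rabs_pos).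
      lra.
    + now apply Rinv_le_contravar.
Qed.

(** Inverts the exponential instead of differentiating [ln] and [atan]: with k = log(z + h) - log z
    one has h = z (e^k - 1), so k - h/z = -(e^k - 1 - k), which is quadratic in k and hence, by
    [Clog_rhp_lip], in h. *)
Lemma Cdiff_Clog_rhp (z : C) : 0 < Re z -> Cdiff Clog_rhp z (/ z)%C.
Proof.
  intros Hz. set (L := 2 / Re z + 4 * Cmod z / (Re z) ^ 2).
  assert (HL : 0 < L).
  { unfold L. assert (0 < 2 / Re z) by (apply Rdiv_lt_0_compat; lra).
    assert (0 <= 4 * Cmod z / Re z ^ 2); [|lra].
    apply Rmult_le_pos; [generalize (Cmod_ge_0 z); lra|].
    left; apply Rinv_0_lt_compat; nra. }
  assert (Hnz := Re_pos_neq_0 z Hz).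
  (* 20 is the constant of [Cexp_quad]; the radius 1 / (2 L) forces |k| <= 1/2, as that lemma
     requires. *)
  apply (Cdiff_quad _ _ _ (20 * L ^ 2) (Rmin (Re z / 2) (/ (2 * L)))).
  - apply Rmin_pos; [lra|]. apply Rinv_0_lt_compat; lra.
  - intros h Hh.
    assert (H1 : Cmod h < Re z / 2) by (eapply Rlt_le_trans; [exact Hh|apply Rmin_l]).
    assert (H2 : Cmod h < / (2 * L)) by (eapply Rlt_le_trans; [exact Hh|apply Rmin_r]).
    assert (Hk := Clog_rhp_lip z h Hz H1). fold L in Hk.
    set (k := (Clog_rhp (z + h) - Clog_rhp z)%C) in *.
    assert (Hk2 : Cmod k <= 1 / 2).
    { apply Rle_trans with (1 := Hk). apply (Rmult_lt_compat_l L) in H2; auto.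
      replace (L * / (2 * L)) with (1 / 2) in H2 by (field; lra). lra. }
    assert (Hpos : 0 < Re (z + h)).
    { assert (Hr := re_le_Cmod h). apply Rabs_le_between in Hr. simpl. unfold Re in *. lra. }
    assert (E : (z + h)%C = (z * Cexp k)%C).
    { rewrite <- (Cexp_Clog_rhp (z + h)) by auto. rewrite <- (Cexp_Clog_rhp z) at 2 by auto.
      rewrite <- Cexp_plus. f_equal. unfold k. ring. }
    replace (k - / z * h)%C with (- (Cexp k - 1 - k))%C.
    + rewrite Cmod_opp. apply Rle_trans with (1 := Cexp_quad k Hk2).
      generalize (Cmod_ge_0 k); intros. nra.
    + assert (Eh : h = (z * (Cexp k - 1))%C) by (replace h with (z + h - z)%C by ring; rewrite E; ring).
      rewrite Eh at 1. field. auto.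
Qed.

(** * Continuity and holomorphy in a complex variable *)

Definition Ccont (f : C -> C) (z : C) : Prop :=
  @continuous (AbsRing_UniformSpace C_AbsRing) (AbsRing_UniformSpace C_AbsRing) f z.

Lemma Cdiff_Ccont (f : C -> C) (z l : C) : Cdiff f z l -> Ccont f z.
Proof.
  intros H. apply (@ex_derive_continuous C_AbsRing (AbsRing_NormedModule C_AbsRing)).
  exists l. exact H.
Qed.

Lemma Ccont_const (a z : C) : Ccont (fun _ => a) z.
Proof. apply (@continuous_const (AbsRing_UniformSpace C_AbsRing) (AbsRing_UniformSpace C_AbsRing)). Qed.

Lemma Ccont_plus (f g : C -> C) (z : C) : Ccont f z -> Ccont g z -> Ccont (fun u => f u + g u)%C z.
Proof. exact (@continuous_plus (AbsRing_UniformSpace C_AbsRing) C_AbsRing (AbsRing_NormedModule C_AbsRing) f g z). Qed.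

Lemma Ccont_mult (f g : C -> C) (z : C) : Ccont f z -> Ccont g z -> Ccont (fun u => f u * g u)%C z.
Proof. exact (@continuous_mult (AbsRing_UniformSpace C_AbsRing) C_AbsRing f g z). Qed.

Lemma Ccont_comp (f g : C -> C) (z : C) : Ccont f (g z) -> Ccont g z -> Ccont (fun u => f (g u)) z.
Proof. intros Hf Hg. apply (@continuous_comp (AbsRing_UniformSpace C_AbsRing) (AbsRing_UniformSpace C_AbsRing) (AbsRing_UniformSpace C_AbsRing) g f z Hg Hf). Qed.

Lemma Ccont_iff (f : C -> C) (z : C) :
  Ccont f z <-> forall eps, 0 < eps -> exists d, 0 < d /\ forall w, (Cmod (w - z) < d -> Cmod (f w - f z) < eps)%C.
Proof.
  split.
  - intros H eps Heps.
    destruct (proj1 (filterlim_locally _ _) H (mkposreal eps Heps)) as [d Hd].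
    exists d; split; [apply cond_pos|]. intros w Hw. exact (Hd w Hw).
  - intros H. apply filterlim_locally. intros eps. destruct (H eps (cond_pos eps)) as [d [Hd Hw]].
    exists (mkposreal d Hd). intros w. exact (Hw w).
Qed.

(** Continuity of f' is included because differentiation under the integral uses it. U is an
    arbitrary set, often a single vertical line: [Cdiff] is always taken in all of C. *)
Definition hol (U : C -> Prop) (f : C -> C) : Prop :=
  exists f' : C -> C, forall z, U z -> Cdiff f z (f' z) /\ Ccont f' z.

Lemma hol_const (U : C -> Prop) (a : C) : hol U (fun _ => a).
Proof. exists (fun _ => 0%C). intros z _. split; [apply Cdiff_const|apply Ccont_const]. Qed.

Lemma hol_id (U : C -> Prop) : hol U (fun z => z).
Proof. exists (fun _ => 1%C). intros z _. split; [apply Cdiff_id|apply Ccont_const]. Qed.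

Lemma hol_plus (U : C -> Prop) (f g : C -> C) : hol U f -> hol U g -> hol U (fun z => f z + g z)%C.
Proof.
  intros [f' Hf] [g' Hg]. exists (fun z => f' z + g' z)%C. intros z Hz.
  destruct (Hf z Hz), (Hg z Hz). split; [now apply Cdiff_plus|now apply Ccont_plus].
Qed.

Lemma hol_mult (U : C -> Prop) (f g : C -> C) : hol U f -> hol U g -> hol U (fun z => f z * g z)%C.
Proof.
  intros [f' Hf] [g' Hg]. exists (fun z => f' z * g z + f z * g' z)%C. intros z Hz.
  destruct (Hf z Hz), (Hg z Hz). split; [now apply Cdiff_mult|].
  apply Ccont_plus; apply Ccont_mult; auto; eapply Cdiff_Ccont; eauto.
Qed.

Lemma hol_opp (U : C -> Prop) (f : C -> C) : hol U f -> hol U (fun z => - f z)%C.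
Proof.
  intros [f' Hf].
  destruct (hol_mult U (fun _ => (-1)%C) f (hol_const _ _) (ex_intro _ f' Hf)) as [h Hh].
  exists h. intros z Hz. destruct (Hh z Hz) as [H1 H2]. split; auto.
  eapply Cdiff_ext; [|exact H1]. intros u; simpl. ring.
Qed.

Lemma hol_minus (U : C -> Prop) (f g : C -> C) : hol U f -> hol U g -> hol U (fun z => f z - g z)%C.
Proof. intros Hf Hg. apply hol_plus; auto. now apply hol_opp. Qed.

Lemma hol_inv (U : C -> Prop) (f : C -> C) :
  (forall z, U z -> f z <> 0%C) -> hol U f -> hol U (fun z => / f z)%C.
Proof.
  intros H0 [f' Hf]. exists (fun z => f' z * - (/ f z * / f z))%C. intros z Hz.
  destruct (Hf z Hz) as [Hd Hc]. assert (Hi := Cdiff_inv (f z) (H0 z Hz)). split.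
  - replace (- (/ f z * / f z))%C with (- / (f z * f z))%C by (field; auto).
    now apply (Cdiff_comp Cinv f).
  - assert (Hfi : Ccont (fun z => / f z)%C z).
    { apply (Ccont_comp Cinv f); eapply Cdiff_Ccont; eauto. }
    apply Ccont_mult; auto.
    assert (Hm : Ccont (fun u => (RtoC (-1)) * (/ f u * / f u))%C z)
      by (apply (Ccont_mult (fun _ => RtoC (-1))); [apply Ccont_const|apply (Ccont_mult (fun u => / f u)%C); exact Hfi]).
    apply Ccont_iff. intros eps He. destruct (proj1 (Ccont_iff _ _) Hm eps He) as [d [Hd' Hw]].
    exists d; split; auto. intros w Hw'. generalize (Hw w Hw').
    replace (-1 * (/ f w * / f w) - -1 * (/ f z * / f z))%C with
      (- (/ f w * / f w) - - (/ f z * / f z))%C by ring. auto.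
Qed.

Lemma hol_div (U : C -> Prop) (f g : C -> C) :
  (forall z, U z -> g z <> 0%C) -> hol U f -> hol U g -> hol U (fun z => f z / g z)%C.
Proof. intros H0 Hf Hg. apply hol_mult; auto. now apply hol_inv. Qed.

Lemma hol_exp (U : C -> Prop) (f : C -> C) : hol U f -> hol U (fun z => Cexp (f z)).
Proof.
  intros [f' Hf]. exists (fun z => f' z * Cexp (f z))%C. intros z Hz.
  destruct (Hf z Hz) as [Hd Hc]. assert (He := Cdiff_exp (f z)). split.
  - now apply (Cdiff_comp Cexp f).
  - apply Ccont_mult; auto. apply (Ccont_comp Cexp f); eapply Cdiff_Ccont; eauto.
Qed.

Lemma hol_Clog_rhp (U : C -> Prop) : (forall z, U z -> 0 < Re z) -> hol U Clog_rhp.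
Proof.
  intros HU. exists Cinv. intros z Hz. split.
  - apply Cdiff_Clog_rhp; auto.
  - eapply Cdiff_Ccont, Cdiff_inv, Re_pos_neq_0; auto.
Qed.

Lemma hol_sub (U V : C -> Prop) (f : C -> C) : (forall z, V z -> U z) -> hol U f -> hol V f.
Proof. intros H [f' Hf]. exists f'. auto. Qed.

Lemma hol_Ccont (U : C -> Prop) (f : C -> C) (z : C) : hol U f -> U z -> Ccont f z.
Proof. intros [f' Hf] Hz. eapply Cdiff_Ccont, Hf, Hz. Qed.

(** * Curves in the plane and their integrals *)

(** Componentwise, like [CDerive] and [CInt]; [Rdiff_ex_derive] recovers differentiability as a map
    into the plane. *)
Definition Rdiff (g : R -> C) (t : R) (v : C) : Prop :=
  is_derive (fun s => Re (g s)) t (Re v) /\ is_derive (fun s => Im (g s)) t (Im v).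

Definition Rcont (g : R -> C) (t : R) : Prop :=
  continuous (fun s => Re (g s)) t /\ continuous (fun s => Im (g s)) t.

Lemma is_derive_eps (f : R -> R) (t l : R) :
  (forall eps, 0 < eps -> exists d, 0 < d /\ forall h, Rabs h < d ->
     Rabs (f (t + h) - f t - l * h) <= eps * Rabs h) -> is_derive f t l.
Proof.
  intros H. apply is_derive_Reals. intros eps Heps.
  destruct (H (eps / 2) ltac:(lra)) as [d [Hd Hh]].
  exists (mkposreal d Hd). intros h Hn Hs. simpl in Hs.
  replace ((f (t + h) - f t) / h - l) with ((f (t + h) - f t - l * h) / h) by (field; auto).
  unfold Rdiv. rewrite Rabs_mult, Rabs_inv.
  assert (0 < Rabs h) by (now apply Rabs_pos_lt).
  apply Rle_lt_trans with (eps / 2 * Rabs h * / Rabs h).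
  - apply Rmult_le_compat_r; auto. left; now apply Rinv_0_lt_compat.
  - rewrite Rmult_assoc, Rinv_r; lra.
Qed.

Lemma Rdiff_intro (g : R -> C) (t : R) (v : C) :
  (forall eps, 0 < eps -> exists d, 0 < d /\ forall h : R, Rabs h < d ->
     Cmod (g (t + h)%R - g t - v * RtoC h)%C <= eps * Rabs h) -> Rdiff g t v.
Proof.
  intros K.
  split; apply is_derive_eps; intros eps Heps; destruct (K eps Heps) as [d [Hd Hh]];
    exists d; split; auto; intros h Hs; apply Rle_trans with (2 := Hh h Hs).
  - eapply Rle_trans; [|apply re_le_Cmod]. apply Req_le. f_equal.
    unfold Re, Cplus, Cminus, Cmult, Copp, RtoC; simpl. ring.
  - eapply Rle_trans; [|apply Im_le_Cmod]. apply Req_le. f_equal.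
    unfold Im, Cplus, Cminus, Cmult, Copp, RtoC; simpl. ring.
Qed.

Lemma Cdiff_line (f : C -> C) (z v l : C) (t : R) :
  Cdiff f (z + RtoC t * v)%C l -> Rdiff (fun s => f (z + RtoC s * v)%C) t (l * v)%C.
Proof.
  intros H.
  apply Rdiff_intro. intros eps Heps. assert (Hm := Cmod_ge_0 v).
  assert (Hp : 0 < eps / (Cmod v + 1)) by (apply Rdiv_lt_0_compat; lra).
  destruct (proj1 (Cdiff_iff _ _ _) H _ Hp) as [d [Hd Hh]].
  exists (d / (Cmod v + 1)). split; [apply Rdiv_lt_0_compat; lra|].
  intros h Hs.
  assert (Hs' : Rabs h * (Cmod v + 1) < d).
  { apply (Rmult_lt_compat_r (Cmod v + 1)) in Hs; [|lra].
    unfold Rdiv in Hs. rewrite Rmult_assoc, Rinv_l in Hs; lra. }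
  assert (Hc : Cmod (RtoC h * v) < d).
  { rewrite Cmod_mult, Cmod_R. generalize (Rabs_pos h). nra. }
  generalize (Hh _ Hc). rewrite Cmod_mult, Cmod_R, RtoC_plus.
  replace (z + RtoC t * v + RtoC h * v)%C with (z + (RtoC t + RtoC h) * v)%C by ring.
  replace (l * (RtoC h * v))%C with (l * v * RtoC h)%C by ring.
  intros Q. apply Rle_trans with (1 := Q).
  replace (eps / (Cmod v + 1) * (Rabs h * Cmod v)) with (eps * Rabs h * (Cmod v / (Cmod v + 1))) by (field; lra).
  rewrite <- (Rmult_1_r (eps * Rabs h)) at 2. apply Rmult_le_compat_l.
  - generalize (Rabs_pos h); nra.
  - apply (Rmult_le_reg_r (Cmod v + 1)); [lra|]. unfold Rdiv. rewrite Rmult_assoc, Rinv_l; lra.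
Qed.

Lemma Rdiff_ext (f g : R -> C) (t : R) (l : C) : (forall s, f s = g s) -> Rdiff f t l -> Rdiff g t l.
Proof.
  intros H [H1 H2]. split.
  - eapply is_derive_ext; [|exact H1]. intros; simpl; now rewrite H.
  - eapply is_derive_ext; [|exact H2]. intros; simpl; now rewrite H.
Qed.

Lemma Cdiff_vert (f : C -> C) (c y : R) (l : C) : Cdiff f (c, y) l -> Rdiff (fun s => f (c, s)) y (l * Ci)%C.
Proof.
  intros H. assert (E : forall s, (RtoC c + RtoC s * Ci)%C = (c, s)).
  { intros s. unfold Cplus, Cmult, RtoC, Ci; simpl. f_equal; ring. }
  eapply Rdiff_ext; [|apply (Cdiff_line f (RtoC c) Ci)]. { intros s; simpl; now rewrite E. }
  now rewrite E.
Qed.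

Lemma Cdiff_horiz (f : C -> C) (c y : R) (l : C) : Cdiff f (c, y) l -> Rdiff (fun s => f (s, y)) c l.
Proof.
  intros H. assert (E : forall s, (RtoC y * Ci + RtoC s * 1)%C = (s, y)).
  { intros s. unfold Cplus, Cmult, RtoC, Ci; simpl. f_equal; ring. }
  replace l with (l * 1)%C by ring.
  eapply Rdiff_ext; [|apply (Cdiff_line f (RtoC y * Ci) 1)]. { intros s; simpl; now rewrite E. }
  now rewrite E.
Qed.

(** Project [F] on the direction of [F b - F a]. *)
Lemma Cmvt (F F' : R -> C) (g g' : R -> R) (a b : R) : a <= b ->
  (forall t, a <= t <= b -> Rdiff F t (F' t)) -> (forall t, a <= t <= b -> is_derive g t (g' t)) ->
  (forall t, a <= t <= b -> Cmod (F' t) <= g' t) ->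
  (Cmod (F b - F a) <= g b - g a)%C.
Proof.
  intros Hab HF Hg Hb. set (u := (F b - F a)%C).
  set (h := fun t => Re u * Re (F t) + Im u * Im (F t) - Cmod u * g t).
  set (h' := fun t => Re u * Re (F' t) + Im u * Im (F' t) - Cmod u * g' t).
  assert (Hd : forall t, a <= t <= b -> is_derive h t (h' t)).
  { intros t Ht. destruct (HF t Ht) as [F1 F2]. assert (G := Hg t Ht). unfold h, h'.
    apply (is_derive_minus (V := R_NormedModule)); [apply (is_derive_plus (V := R_NormedModule))|].
    - apply is_derive_scal. exact F1.
    - apply is_derive_scal. exact F2.
    - apply is_derive_scal. exact G. }
  destruct (MVT_gen h a b h') as [c [Hc E]].
  - intros t Ht. rewrite Rmin_left, Rmax_right in Ht by auto. apply Hd; lra.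
  - intros t Ht. rewrite Rmin_left, Rmax_right in Ht by auto.
    apply continuity_pt_filterlim. apply (ex_derive_continuous (V := R_NormedModule)).
    eexists; apply Hd; lra.
  - rewrite Rmin_left, Rmax_right in Hc by auto.
    assert (Hn : h' c <= 0).
    { unfold h'. assert (Q : Re u * Re (F' c) + Im u * Im (F' c) <= Cmod u * Cmod (F' c)).
      { rewrite <- (Cmod_conj u), <- Cmod_mult.
        eapply Rle_trans; [|apply re_le_Cmod]. eapply Rle_trans; [|apply Rle_abs].
        apply Req_le. unfold Re, Im, Cmult, Cconj; simpl. ring. }
      generalize (Hb c Hc) (Cmod_ge_0 u). intros. nra. }
    assert (Hle : h b - h a <= 0) by (rewrite E; nra).
    unfold h in Hle.
    assert (Q2 : Re u * (Re (F b) - Re (F a)) + Im u * (Im (F b) - Im (F a)) = Cmod u * Cmod u).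
    { replace (Cmod u * Cmod u) with (Cmod u ^ 2) by ring. rewrite Cmod2_alt.
      unfold u, Cminus, Cplus, Copp, Re, Im; simpl. ring. }
    (* When F a = F b the projection carries no information; what remains is 0 <= g b - g a, true
       because g' bounds a modulus. *)
    destruct (Req_dec (Cmod u) 0) as [Z|Z].
    + rewrite Z.
      destruct (MVT_gen g a b g') as [e [He Eg]].
      * intros t Ht. rewrite Rmin_left, Rmax_right in Ht by auto. apply Hg; lra.
      * intros t Ht. rewrite Rmin_left, Rmax_right in Ht by auto.
        apply continuity_pt_filterlim. apply (ex_derive_continuous (V := R_NormedModule)).
        eexists; apply Hg; lra.
      * rewrite Rmin_left, Rmax_right in He by auto.
        rewrite Eg. generalize (Hb e He) (Cmod_ge_0 (F' e)). nra.
    + assert (P : 0 < Cmod u) by (generalize (Cmod_ge_0 u); lra).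
      apply (Rmult_le_reg_l (Cmod u)); auto. lra.
Qed.

Definition CInt (f : R -> C) (a b : R) : C :=
  (RInt (fun t => Re (f t)) a b, RInt (fun t => Im (f t)) a b).

Definition Ccont_on (f : R -> C) (a b : R) : Prop := forall t, a <= t <= b -> Rcont f t.

Lemma Ccont_on_ex_RInt (f : R -> C) (a b : R) : a <= b -> Ccont_on f a b ->
  ex_RInt (fun t => Re (f t)) a b /\ ex_RInt (fun t => Im (f t)) a b.
Proof.
  intros Hab H. split.
  - apply (ex_RInt_continuous (V := R_CompleteNormedModule) (fun t => Re (f t))).
    rewrite Rmin_left, Rmax_right by auto. intros t Ht. apply (proj1 (H t Ht)).
  - apply (ex_RInt_continuous (V := R_CompleteNormedModule) (fun t => Im (f t))).
    rewrite Rmin_left, Rmax_right by auto. intros t Ht. apply (proj2 (H t Ht)).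
Qed.

Lemma Ccont_on_sub (f : R -> C) (a b a' b' : R) : a <= a' -> b' <= b -> Ccont_on f a b -> Ccont_on f a' b'.
Proof. intros H1 H2 H t Ht. apply H. lra. Qed.

(** The product norm on R x R is exactly [Cmod], so [norm_RInt_le] applied to the pair-valued
    integral avoids the factor lost when the components are estimated separately. *)
Lemma CInt_bound (f : R -> C) (g : R -> R) (a b lg : R) : a <= b -> Ccont_on f a b ->
  (forall t, a <= t <= b -> Cmod (f t) <= g t) -> is_RInt g a b lg -> Cmod (CInt f a b) <= lg.
Proof.
  intros Hab Hc Hb Hg. destruct (Ccont_on_ex_RInt f a b Hab Hc) as [H1 H2].
  assert (HI : @is_RInt (prod_NormedModule R_AbsRing R_NormedModule R_NormedModule) f a b (CInt f a b)).
  { apply is_RInt_fct_extend_pair; apply (RInt_correct (V := R_CompleteNormedModule)); assumption. }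
  assert (E : forall z : C, @norm R_AbsRing (prod_NormedModule R_AbsRing R_NormedModule R_NormedModule) z = Cmod z).
  { intros z. unfold norm; simpl. unfold prod_norm, Cmod. unfold norm; simpl. unfold abs; simpl.
    f_equal. rewrite !Rmult_1_r, <- !Rabs_mult, !Rabs_right; auto; apply Rle_ge, Rle_0_sqr. }
  rewrite <- E. eapply norm_RInt_le; eauto. intros x Hx. rewrite E. auto.
Qed.

Lemma CInt_bound_const (f : R -> C) (a b B : R) : a <= b -> Ccont_on f a b ->
  (forall t, a <= t <= b -> Cmod (f t) <= B) -> Cmod (CInt f a b) <= B * (b - a).
Proof.
  intros Hab Hc Hb. apply (CInt_bound f (fun _ => B)); auto.
  replace (B * (b - a)) with (scal (b - a) B) by (unfold scal; simpl; unfold mult; simpl; ring).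
  apply (is_RInt_const (V := R_NormedModule)).
Qed.

Lemma CInt_Chasles (f : R -> C) (a b c : R) : a <= b -> b <= c -> Ccont_on f a c ->
  (CInt f a b + CInt f b c)%C = CInt f a c.
Proof.
  intros Hab Hbc H.
  destruct (Ccont_on_ex_RInt f a b Hab) as [A1 A2]; [eapply Ccont_on_sub; eauto; lra|].
  destruct (Ccont_on_ex_RInt f b c Hbc) as [B1 B2]; [eapply Ccont_on_sub; eauto; lra|].
  unfold CInt, Cplus; simpl. f_equal; apply (RInt_Chasles (V := R_CompleteNormedModule)); auto.
Qed.

Lemma CInt_plus (f g : R -> C) (a b : R) : a <= b -> Ccont_on f a b -> Ccont_on g a b ->
  CInt (fun t => f t + g t)%C a b = (CInt f a b + CInt g a b)%C.
Proof.
  intros Hab Hf Hg. destruct (Ccont_on_ex_RInt f a b Hab Hf), (Ccont_on_ex_RInt g a b Hab Hg).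
  unfold CInt, Cplus; simpl. f_equal; apply (RInt_plus (V := R_CompleteNormedModule)); auto.
Qed.

Lemma CInt_minus (f g : R -> C) (a b : R) : a <= b -> Ccont_on f a b -> Ccont_on g a b ->
  CInt (fun t => f t - g t)%C a b = (CInt f a b - CInt g a b)%C.
Proof.
  intros Hab Hf Hg. destruct (Ccont_on_ex_RInt f a b Hab Hf), (Ccont_on_ex_RInt g a b Hab Hg).
  unfold CInt, Cminus, Cplus, Copp; simpl. f_equal; apply (RInt_minus (V := R_CompleteNormedModule)); auto.
Qed.

Lemma CInt_scal (w : C) (f : R -> C) (a b : R) : a <= b -> Ccont_on f a b ->
  CInt (fun t => w * f t)%C a b = (w * CInt f a b)%C.
Proof.
  intros Hab Hf. destruct (Ccont_on_ex_RInt f a b Hab Hf) as [H1 H2].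
  unfold CInt, Cmult; simpl. f_equal.
  - rewrite <- !(RInt_scal (V := R_CompleteNormedModule)) by auto.
    rewrite <- (RInt_minus (V := R_CompleteNormedModule)); auto.
    + now apply (ex_RInt_scal (V := R_NormedModule)).
    + now apply (ex_RInt_scal (V := R_NormedModule)).
  - rewrite <- !(RInt_scal (V := R_CompleteNormedModule)) by auto.
    rewrite <- (RInt_plus (V := R_CompleteNormedModule)); auto.
    + now apply (ex_RInt_scal (V := R_NormedModule)).
    + now apply (ex_RInt_scal (V := R_NormedModule)).
Qed.

Lemma CInt_ext (f g : R -> C) (a b : R) : a <= b -> (forall t, a <= t <= b -> f t = g t) -> CInt f a b = CInt g a b.
Proof.
  intros Hab H. unfold CInt. f_equal; apply RInt_ext; rewrite Rmin_left, Rmax_right by auto;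
    intros t Ht; rewrite H; auto; lra.
Qed.

Lemma CInt_FTC (F f : R -> C) (a b : R) : a <= b -> (forall t, a <= t <= b -> Rdiff F t (f t)) -> Ccont_on f a b ->
  CInt f a b = (F b - F a)%C.
Proof.
  intros Hab HF Hf. unfold CInt, Cminus, Cplus, Copp; simpl. f_equal; apply is_RInt_unique.
  - apply (is_RInt_derive (V := R_CompleteNormedModule) (fun t => Re (F t)) (fun t => Re (f t)));
      rewrite Rmin_left, Rmax_right by auto; intros t Ht; [apply (proj1 (HF t Ht))|apply (proj1 (Hf t Ht))].
  - apply (is_RInt_derive (V := R_CompleteNormedModule) (fun t => Im (F t)) (fun t => Im (f t)));
      rewrite Rmin_left, Rmax_right by auto; intros t Ht; [apply (proj2 (HF t Ht))|apply (proj2 (Hf t Ht))].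
Qed.

Lemma Ccont_Rcont (f : C -> C) (g : R -> C) (t : R) : Ccont f (g t) -> Rcont g t -> Rcont (fun s => f (g s)) t.
Proof.
  intros Hf [G1 G2].
  assert (K : forall eps, 0 < eps -> locally t (fun s => Cmod (f (g s) - f (g t)) < eps)%C).
  { intros eps He. destruct (proj1 (Ccont_iff _ _) Hf eps He) as [d [Hd Hw]].
    assert (Hd2 : 0 < d / 2) by lra.
    assert (L1 := proj1 (filterlim_locally _ _) G1 (mkposreal _ Hd2)).
    assert (L2 := proj1 (filterlim_locally _ _) G2 (mkposreal _ Hd2)).
    generalize (filter_and _ _ L1 L2). apply filter_imp. intros s [B1 B2].
    apply Hw. eapply Rle_lt_trans; [apply Cmod_le_Re_Im|].
    unfold ball in B1, B2; simpl in B1, B2; unfold AbsRing_ball, minus, plus, opp, abs in B1, B2; simpl in B1, B2.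
    unfold Re, Im in *. simpl. lra. }
  split; apply filterlim_locally; intros eps; generalize (K eps (cond_pos eps)); apply filter_imp;
    intros s Hs; unfold ball; simpl; unfold AbsRing_ball, minus, plus, opp, abs; simpl;
    eapply Rle_lt_trans; [|exact Hs| |exact Hs].
  - apply (re_le_Cmod (f (g s) - f (g t))%C).
  - apply (Im_le_Cmod (f (g s) - f (g t))%C).
Qed.

Lemma Rcont_vert (c t : R) : Rcont (fun y => (c, y)) t.
Proof. split; simpl; [apply continuous_const|apply continuous_id]. Qed.

(** * Shifting vertical lines *)

Definition box (a1 a2 b1 b2 : R) (z : C) : Prop := a1 < Re z < a2 /\ b1 < Im z < b2.

Lemma Ccont_2d (f : C -> C) (p : C -> R) (c y : R) :
  (forall z u, Rabs (p z - p u) <= Cmod (z - u)%C) ->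
  Ccont f (c, y) -> continuity_2d_pt (fun u v => p (f (u, v))) c y.
Proof.
  intros Hp Hf eps. destruct (proj1 (Ccont_iff _ _) Hf eps (cond_pos eps)) as [d [Hd Hw]].
  assert (Hd2 : 0 < d / 2) by lra.
  exists (mkposreal _ Hd2). intros u v Hu Hv. simpl in Hu, Hv.
  eapply Rle_lt_trans; [apply Hp|]. apply Hw.
  eapply Rle_lt_trans; [apply Cmod_le_Re_Im|]. unfold Re, Im; simpl. unfold Rminus in *. lra.
Qed.

Lemma Re_lip (z u : C) : Rabs (Re z - Re u) <= Cmod (z - u)%C.
Proof. apply (re_le_Cmod (z - u)%C). Qed.

Lemma Im_lip (z u : C) : Rabs (Im z - Im u) <= Cmod (z - u)%C.
Proof. apply (Im_le_Cmod (z - u)%C). Qed.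

Lemma Ccont_on_vert (U : C -> Prop) (f : C -> C) (c y1 y2 : R) :
  hol U f -> (forall y, y1 <= y <= y2 -> U (c, y)) -> Ccont_on (fun y => f (c, y)) y1 y2.
Proof.
  intros Hf HU t Ht. apply (Ccont_Rcont f (fun y => (c, y))); [|apply Rcont_vert].
  eapply hol_Ccont; eauto.
Qed.

(** The parameter u is the abscissa of a line in [CInt_param] and a time variable in
    [laplace_integrand_derive]; hence the form with two real arguments. *)
Lemma CInt_param_gen (f f' : R -> R -> C) (y1 y2 c d : R) : 0 < d -> y1 <= y2 ->
  (forall u y, Rabs (u - c) < d -> y1 - d < y < y2 + d -> Rdiff (fun s => f s y) u (f' u y)) ->
  (forall u, Rabs (u - c) < d -> Ccont_on (f u) y1 y2) ->
  (forall y, y1 <= y <= y2 -> continuity_2d_pt (fun u v => Re (f' u v)) c y /\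
     continuity_2d_pt (fun u v => Im (f' u v)) c y) ->
  Rdiff (fun u => CInt (f u) y1 y2) c (CInt (f' c) y1 y2).
Proof.
  intros Hd Hy Hder HC H2.
  assert (E0 : Rabs (c - c) < d) by (rewrite Rminus_diag, Rabs_R0; auto).
  assert (Key : forall p : C -> R,
    (forall u y, Rabs (u - c) < d -> y1 - d < y < y2 + d -> is_derive (fun s => p (f s y)) u (p (f' u y))) ->
    (forall u, Rabs (u - c) < d -> ex_RInt (fun y => p (f u y)) y1 y2) ->
    (forall y, y1 <= y <= y2 -> continuity_2d_pt (fun u v => p (f' u v)) c y) ->
    is_derive (fun u => RInt (fun y => p (f u y)) y1 y2) c (RInt (fun y => p (f' c y)) y1 y2)).
  { intros p Hp He Hc.
    replace (RInt (fun y => p (f' c y)) y1 y2) with (RInt (fun t => Derive (fun u => p (f u t)) c) y1 y2).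
    - apply (is_derive_RInt_param (fun u y => p (f u y))).
      + exists (mkposreal d Hd). intros u Hu t Ht. rewrite Rmin_left, Rmax_right in Ht by auto.
        exists (p (f' u t)). apply Hp; [exact Hu|lra].
      + intros t Ht. rewrite Rmin_left, Rmax_right in Ht by auto.
        apply continuity_2d_pt_ext_loc with (f := fun u v => p (f' u v)); [|now apply Hc].
        exists (mkposreal d Hd). intros u v Hu Hv; simpl in Hu, Hv. symmetry. apply is_derive_unique.
        apply Hp; auto. apply Rabs_def2 in Hv. lra.
      + exists (mkposreal d Hd). intros u Hu. now apply He.
    - apply RInt_ext. rewrite Rmin_left, Rmax_right by auto. intros t Ht. apply is_derive_unique.
      apply Hp; auto; lra. }
  split; unfold CInt; cbn [fst snd Re Im].
  - apply (Key Re).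
    + intros u y Hu Hyy. apply (proj1 (Hder u y Hu Hyy)).
    + intros u Hu. apply (proj1 (Ccont_on_ex_RInt _ _ _ Hy (HC u Hu))).
    + intros y Hyy. apply (proj1 (H2 y Hyy)).
  - apply (Key Im).
    + intros u y Hu Hyy. apply (proj2 (Hder u y Hu Hyy)).
    + intros u Hu. apply (proj2 (Ccont_on_ex_RInt _ _ _ Hy (HC u Hu))).
    + intros y Hyy. apply (proj2 (H2 y Hyy)).
Qed.

Lemma CInt_param (f f' : C -> C) (a1 a2 b1 b2 y1 y2 c : R) :
  a1 < c < a2 -> b1 < y1 -> y1 <= y2 -> y2 < b2 ->
  (forall z, box a1 a2 b1 b2 z -> Cdiff f z (f' z) /\ Ccont f' z) ->
  Rdiff (fun c => CInt (fun y => f (c, y)) y1 y2) c (CInt (fun y => f' (c, y)) y1 y2).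
Proof.
  intros Hc Hy1 Hy Hy2 Hf.
  set (d := Rmin (Rmin (c - a1) (a2 - c)) (Rmin (y1 - b1) (b2 - y2))).
  assert (Hd : 0 < d) by (unfold d; repeat apply Rmin_pos; lra).
  assert (Hd1 : d <= c - a1) by (unfold d; eapply Rle_trans; [apply Rmin_l|apply Rmin_l]).
  assert (Hd2 : d <= a2 - c) by (unfold d; eapply Rle_trans; [apply Rmin_l|apply Rmin_r]).
  assert (Hd3 : d <= y1 - b1) by (unfold d; eapply Rle_trans; [apply Rmin_r|apply Rmin_l]).
  assert (Hd4 : d <= b2 - y2) by (unfold d; eapply Rle_trans; [apply Rmin_r|apply Rmin_r]).
  assert (HB : forall u v, Rabs (u - c) < d -> y1 - d < v < y2 + d -> box a1 a2 b1 b2 (u, v)).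
  { intros u v Hu Hv. apply Rabs_def2 in Hu. unfold box; simpl. lra. }
  apply (CInt_param_gen (fun c y => f (c, y)) (fun c y => f' (c, y)) y1 y2 c d); auto.
  - intros u y Hu Hv. apply Cdiff_horiz, Hf, HB; auto.
  - intros u Hu. apply (Ccont_on_vert (box a1 a2 b1 b2)).
    + exists f'; auto.
    + intros y Hyy. apply HB; auto; lra.
  - intros y Hyy.
    assert (Hcc : Ccont f' (c, y)).
    { apply Hf, HB; [|lra]. rewrite Rminus_diag, Rabs_R0; auto. }
    split.
    + exact (Ccont_2d f' Re c y Re_lip Hcc).
    + exact (Ccont_2d f' Im c y Im_lip Hcc).
Qed.

(** A quantitative Cauchy theorem on a rectangle: only the two horizontal sides are charged. The
    margin m provides the open box on which the parameter derivative is taken. *)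
Lemma rect_bound (U : C -> Prop) (f : C -> C) (m c1 c2 y1 y2 B : R) :
  0 < m -> c1 <= c2 -> y1 <= y2 -> hol U f ->
  (forall z, box (c1 - m) (c2 + m) (y1 - m) (y2 + m) z -> U z) ->
  (forall c, c1 <= c <= c2 -> Cmod (f (c, y1)) + Cmod (f (c, y2)) <= B) ->
  (Cmod (CInt (fun y => f (c2, y)) y1 y2 - CInt (fun y => f (c1, y)) y1 y2) <= B * (c2 - c1))%C.
Proof.
  intros Hm Hc Hy [f' Hf] HU HB.
  replace (B * (c2 - c1)) with (B * c2 - B * c1) by ring.
  apply (Cmvt (fun c => CInt (fun y => f (c, y)) y1 y2) (fun c => CInt (fun y => f' (c, y)) y1 y2)
    (fun t => B * t) (fun _ => B)); auto.
  - intros t Ht. apply (CInt_param f f' (c1 - m) (c2 + m) (y1 - m) (y2 + m)); try lra.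
    intros z Hz. apply Hf, HU, Hz.
  - intros t Ht. auto_derive; auto; ring.
  - intros t Ht. apply Rle_trans with (2 := HB t Ht).
    assert (Hin : forall y, y1 <= y <= y2 -> U (t, y)) by (intros; apply HU; unfold box; simpl; lra).
    assert (Hcon : Ccont_on (fun y => f' (t, y)) y1 y2).
    { intros y Hyy. apply (Ccont_Rcont f' (fun y => (t, y))); [|apply Rcont_vert]. now apply Hf, Hin. }
    (* Since d/dy f(t + i y) = i f'(t + i y), the integral of f' along the segment reduces to the
       end values of f. *)
    assert (E : (Ci * CInt (fun y => f' (t, y)) y1 y2)%C = (f (t, y2) - f (t, y1))%C).
    { rewrite <- CInt_scal by auto.
      apply (CInt_FTC (fun y => f (t, y))); auto.
      - intros y Hyy. replace (Ci * f' (t, y))%C with (f' (t, y) * Ci)%C by ring.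
        apply Cdiff_vert. now apply Hf, Hin.
      - intros y Hyy.
        apply (Ccont_Rcont (fun z => Ci * f' z)%C (fun y => (t, y))); [|apply Rcont_vert].
        apply Ccont_mult; [apply Ccont_const|]. now apply Hf, Hin. }
    replace (Cmod (CInt (fun y => f' (t, y)) y1 y2)) with (Cmod (Ci * CInt (fun y => f' (t, y)) y1 y2)%C)
      by (rewrite Cmod_mult, Cmod_Ci; ring).
    rewrite E. unfold Cminus. rewrite Rplus_comm, <- (Cmod_opp (f (t, y1))). apply Cmod_triangle.
Qed.

(** 1 / (d + i (y - b)) has an elementary antiderivative in each component, without any branch of
    the complex logarithm, so both signs of d are covered. *)
Lemma CInt_inv (d b Y : R) : d <> 0 -> 0 < Y ->
  CInt (fun y => / (d, (y - b)%R))%C (- Y) Y =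
   (atan ((Y - b) / d) + atan ((Y + b) / d),
    ln (d ^ 2 + (Y + b) ^ 2) / 2 - ln (d ^ 2 + (Y - b) ^ 2) / 2).
Proof.
  intros Hd HY.
  assert (Hp : forall y, 0 < d ^ 2 + y ^ 2).
  { intros y. generalize (pow2_ge_0 y). assert (0 < d ^ 2) by nra. lra. }
  rewrite (CInt_FTC (fun y => (atan ((y - b) / d), - ln (d ^ 2 + (y - b) ^ 2) / 2))).
  - unfold Cminus, Cplus, Copp; simpl. f_equal.
    + rewrite <- atan_opp. f_equal. f_equal. field. auto.
    + replace ((- Y - b) * ((- Y - b) * 1)) with ((Y + b) * ((Y + b) * 1)) by ring. lra.
  - lra.
  - intros y _. unfold Cinv. split; simpl.
    + auto_derive; auto. specialize (Hp (y - b)). unfold Rsqr. field.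
      split; [nra|auto].
    + specialize (Hp (y - b)). auto_derive; simpl in Hp; simpl; auto.
      field. nra.
  - intros y _. unfold Cinv. assert (Q := Hp (y - b)). simpl in Q. split; simpl.
    + apply (ex_derive_continuous (V := R_NormedModule)). auto_derive. simpl. lra.
    + apply (ex_derive_continuous (V := R_NormedModule)). auto_derive. simpl. lra.
Qed.

Lemma atan_large (x : R) : 0 < x -> PI / 2 - / x <= atan x <= PI / 2.
Proof.
  intros Hx. assert (Hi := Rinv_0_lt_compat x Hx). split.
  - rewrite <- (Rinv_inv x) at 2. rewrite atan_inv by auto.
    assert (H := atan_lip (/ x) 0). rewrite atan_0, !Rminus_0_r in H.
    rewrite (Rabs_right (/ x)) in H by lra. generalize (Rle_abs (atan (/ x))). lra.
  - left. apply atan_bound.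
Qed.

(** A line to the right of the pole contributes PI, one to the left -PI; the difference is the 2 PI
    of the residue theorem. *)
Lemma CInt_inv_lim (d b Y : R) : 0 < d -> 2 * Rabs b + 1 <= Y ->
  (Cmod (CInt (fun y => / (d, (y - b)%R))%C (- Y) Y - RtoC PI) <= (4 * d + 8 * Rabs b) / Y)%C /\
  (Cmod (CInt (fun y => / ((- d)%R, (y - b)%R))%C (- Y) Y + RtoC PI) <= (4 * d + 8 * Rabs b) / Y)%C.
Proof.
  intros Hd HY. assert (Hb := Rabs_pos b). assert (Hbb : - Rabs b <= b <= Rabs b) by (apply Rabs_le_between; lra).
  assert (HY0 : 0 < Y) by lra.
  assert (B1 : Y / 2 <= Y - b) by lra. assert (B2 : Y / 2 <= Y + b) by lra.
  assert (A1 : forall u, Y / 2 <= u -> Rabs (atan (u / d) - PI / 2) <= 2 * d / Y).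
  { intros u Hu. assert (Hud : 0 < u / d) by (apply Rdiv_lt_0_compat; lra).
    destruct (atan_large _ Hud) as [L1 L2]. rewrite Rabs_left1 by lra.
    assert (/ (u / d) <= 2 * d / Y); [|lra].
    replace (/ (u / d)) with (d * / u) by (field; lra). replace (2 * d / Y) with (d * / (Y / 2)) by (field; lra).
    apply Rmult_le_compat_l; [lra|]. apply Rinv_le_contravar; lra. }
  assert (L : Rabs (ln (d ^ 2 + (Y + b) ^ 2) / 2 - ln (d ^ 2 + (Y - b) ^ 2) / 2) <= 8 * Rabs b / Y).
  { replace (ln (d ^ 2 + (Y + b) ^ 2) / 2 - ln (d ^ 2 + (Y - b) ^ 2) / 2) with
      (/ 2 * (ln (d ^ 2 + (Y + b) ^ 2) - ln (d ^ 2 + (Y - b) ^ 2))) by field.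
    rewrite Rabs_mult, (Rabs_right (/ 2)) by lra.
    assert (M : 0 < Y ^ 2 / 4) by nra.
    assert (Q := ln_lip (Y ^ 2 / 4) (d ^ 2 + (Y + b) ^ 2) (d ^ 2 + (Y - b) ^ 2) M ltac:(nra) ltac:(nra)).
    replace (d ^ 2 + (Y + b) ^ 2 - (d ^ 2 + (Y - b) ^ 2)) with (4 * Y * b) in Q by ring.
    rewrite !Rabs_mult, (Rabs_right 4), (Rabs_right Y) in Q by lra.
    replace (8 * Rabs b / Y) with (/ 2 * (4 * Y * Rabs b / (Y ^ 2 / 4))) by (field; lra). lra. }
  replace ((4 * d + 8 * Rabs b) / Y) with (2 * d / Y + 2 * d / Y + 8 * Rabs b / Y) by (field; lra).
  assert (P1 := A1 _ B1). assert (P2 := A1 _ B2). split.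
  - rewrite CInt_inv by lra. eapply Rle_trans; [apply Cmod_le_Re_Im|]. apply Rplus_le_compat.
    + simpl. replace (atan ((Y - b) / d) + atan ((Y + b) / d) + - PI) with
        ((atan ((Y - b) / d) - PI / 2) + (atan ((Y + b) / d) - PI / 2)) by lra.
      eapply Rle_trans; [apply Rabs_triang|lra].
    + cbn [Re Im fst snd Cminus Cplus Copp RtoC]. rewrite Ropp_0, Rplus_0_r. exact L.
  - rewrite CInt_inv by lra. eapply Rle_trans; [apply Cmod_le_Re_Im|]. apply Rplus_le_compat.
    + simpl. replace ((Y - b) / - d) with (- ((Y - b) / d)) by (field; lra).
      replace ((Y + b) / - d) with (- ((Y + b) / d)) by (field; lra). rewrite !atan_opp.
      replace (- atan ((Y - b) / d) + - atan ((Y + b) / d) + PI) with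
        (- ((atan ((Y - b) / d) - PI / 2) + (atan ((Y + b) / d) - PI / 2))) by lra.
      rewrite Rabs_Ropp. eapply Rle_trans; [apply Rabs_triang|lra].
    + cbn [Re Im fst snd Cminus Cplus Copp RtoC]. rewrite Rplus_0_r.
      replace ((- d) ^ 2) with (d ^ 2) by ring. exact L.
Qed.

Lemma Cmod_sum3 (x y z : C) : (Cmod (x + y + z) <= Cmod x + Cmod y + Cmod z)%C.
Proof. generalize (Cmod_triangle (x + y) z) (Cmod_triangle x y). lra. Qed.

Lemma inv_le_large (K eps : R) : 0 <= K -> 0 < eps -> exists Y0, 0 < Y0 /\ forall Y, Y0 <= Y -> K / Y <= eps.
Proof.
  intros HK He. assert (0 < (K + 1) / eps) by (apply Rdiv_lt_0_compat; lra).
  exists ((K + 1) / eps). split; auto. intros Y HY.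
  apply (Rmult_le_reg_r Y); [lra|]. unfold Rdiv at 1. rewrite Rmult_assoc, Rinv_l, Rmult_1_r by lra.
  apply (Rmult_le_compat_l eps) in HY; [|lra]. replace (eps * ((K + 1) / eps)) with (K + 1) in HY by (field; lra). lra.
Qed.

(** Residue theorem for a vertical strip: [rect_bound] controls the integral outside a small square around [mu]. *)
Lemma pole_shift (G : C -> C) (mu A : C) (m c1 c2 : R) :
  0 < m -> c1 < Re mu < c2 ->
  hol (fun z => c1 - m < Re z < c2 + m /\ z <> mu) G ->
  (forall eps, 0 < eps -> exists eta, 0 < eta /\ forall z, (z <> mu -> Cmod (z - mu) < eta ->
      Cmod ((z - mu) * G z - A) <= eps)%C) ->
  (forall eps, 0 < eps -> exists Y0, forall z, c1 <= Re z <= c2 -> Y0 <= Rabs (Im z) -> Cmod (G z) <= eps) ->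
  forall eps, 0 < eps -> exists Y0, forall Y, Y0 <= Y ->
    (Cmod (CInt (fun y => G (c2, y)) (- Y) Y - CInt (fun y => G (c1, y)) (- Y) Y - RtoC (2 * PI) * A) <= eps)%C.
Proof.
  intros Hm Ha HG Hlim Hdec eps Heps.
  destruct mu as [a b]. cbn [Re fst] in Ha. set (mu := (a, b) : C) in *.
  set (U := fun z : C => c1 - m < Re z < c2 + m /\ z <> mu) in *.
  (* The hypothesis gives (z - mu) H(z) -> 0 rather than an extension of H across mu. That suffices:
     on a square of half-side eta, |H| is o(1/eta) against a perimeter of 8 eta. *)
  set (H := fun z => (G z - A * / (z - mu))%C).
  assert (HH : hol U H).
  { apply hol_minus; auto. apply hol_mult; [apply hol_const|]. apply hol_inv.
    - intros z [_ Hz] E. apply Hz. replace z with (z - mu + mu)%C by ring. rewrite E. ring.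
    - apply hol_minus; [apply hol_id|apply hol_const]. }
  (* With |H| <= e1 / eta on the square, its four sides contribute 8 e1 = eps / 4. *)
  set (e1 := eps / 32). assert (He1 : 0 < e1) by (unfold e1; lra).
  destruct (Hlim e1 He1) as [eta0 [Heta0 Hnear]].
  (* The boundary of the square is within 2 eta < eta0 of mu, and the square stays strictly between
     the two lines. *)
  set (eta := Rmin (eta0 / 4) (Rmin ((a - c1) / 2) ((c2 - a) / 2))).
  assert (Heta : 0 < eta) by (unfold eta; repeat apply Rmin_pos; lra).
  assert (Q1 : eta <= eta0 / 4) by apply Rmin_l.
  assert (Q2 : eta <= (a - c1) / 2) by (eapply Rle_trans; [apply Rmin_r|apply Rmin_l]).
  assert (Q3 : eta <= (c2 - a) / 2) by (eapply Rle_trans; [apply Rmin_r|apply Rmin_r]).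
  set (m' := Rmin m eta / 2).
  assert (Hm' : 0 < m') by (unfold m'; assert (0 < Rmin m eta) by (apply Rmin_pos; lra); lra).
  assert (Hm1 : m' <= m / 2) by (unfold m'; generalize (Rmin_l m eta); lra).
  assert (Hm2 : m' <= eta / 2) by (unfold m'; generalize (Rmin_r m eta); lra).
  (* Far up and down |H| <= 2 e2, one e2 from G and one from the polar part; the two horizontal
     sides over the whole width cost 4 e2 (c2 - c1) = eps / 4. *)
  set (e2 := eps / (16 * (c2 - c1))). assert (He2 : 0 < e2) by (apply Rdiv_lt_0_compat; lra).
  destruct (Hdec e2 He2) as [Y1 HY1].
  destruct (inv_le_large (Cmod A) e2 (Cmod_ge_0 A) He2) as [Y2 [HY2p HY2]].
  set (K := Cmod A * ((4 * (c2 - a) + 8 * Rabs b) + (4 * (a - c1) + 8 * Rabs b))).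
  assert (HK : 0 <= K).
  { apply Rmult_le_pos; [apply Cmod_ge_0|]. generalize (Rabs_pos b). lra. }
  destruct (inv_le_large K (eps / 4) HK ltac:(lra)) as [Y3 [HY3p HY3]].
  exists (Y1 + Rabs Y1 + Y2 + Y3 + eta + 2 * Rabs b + 1). intros Y HY.
  assert (Pb := Rabs_pos b). assert (PY1 := Rabs_pos Y1). assert (PY1' := Rle_abs (- Y1)). rewrite Rabs_Ropp in PY1'.
  assert (Pbb : - Rabs b <= b <= Rabs b) by (apply Rabs_le_between; lra).
  assert (B1 : forall z, z <> mu -> eta <= Cmod (z - mu)%C -> Cmod (z - mu)%C < eta0 -> Cmod (H z) <= e1 / eta).
  { intros z Hz G1 G2. assert (Hn : (z - mu)%C <> 0%C) by (apply Cmod_gt_0; lra).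
    unfold H. replace (G z - A * / (z - mu))%C with (((z - mu) * G z - A) / (z - mu))%C by (field; auto).
    rewrite Cmod_div by auto. apply Rmult_le_compat.
    - apply Cmod_ge_0.
    - left; apply Rinv_0_lt_compat; lra.
    - apply Hnear; auto.
    - apply Rinv_le_contravar; auto. }
  assert (B1' : forall u v, Rabs (u - a) <= eta -> Rabs (v - b) <= eta -> Rabs (u - a) = eta \/ Rabs (v - b) = eta ->
     Cmod (H (u, v)) <= e1 / eta).
  { intros u v Hu Hv Huv.
    assert (R1 := re_le_Cmod ((u, v) - mu)%C). assert (R2 := Im_le_Cmod ((u, v) - mu)%C).
    assert (R3 := Cmod_le_Re_Im ((u, v) - mu)%C). unfold mu in R1, R2, R3; simpl in R1, R2, R3.
    fold (u - a) in R1, R3. fold (v - b) in R2, R3. fold mu in R1, R2, R3.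
    assert (L1 : eta <= Cmod ((u, v) - mu)%C) by (destruct Huv; lra).
    apply B1; auto; [|lra].
    intros E. rewrite E in L1. replace (mu - mu)%C with (RtoC 0) in L1 by ring. rewrite Cmod_0 in L1. lra. }
  assert (B2 : forall c y, c1 <= c <= c2 -> Rabs y = Y -> Cmod (H (c, y)) <= 2 * e2).
  { intros c y Hc Hy. unfold H. eapply Rle_trans; [apply Cmod_triangle|]. rewrite Cmod_opp.
    assert (R2 := Im_le_Cmod ((c, y) - mu)%C). unfold mu in R2; simpl in R2. fold (y - b) in R2. fold mu in R2.
    assert (R4 : Y - Rabs b <= Rabs (y - b)).
    { rewrite <- Hy. generalize (Rabs_triang (y - b) b). replace (y - b + b) with y by ring. lra. }
    assert (Hn : ((c, y) - mu)%C <> 0%C) by (apply Cmod_gt_0; lra).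
    assert (Cmod (G (c, y)) <= e2) by (apply HY1; simpl; [auto|lra]).
    assert (Cmod (A * / ((c, y) - mu))%C <= e2); [|lra].
    rewrite Cmod_mult, Cmod_inv by auto. apply HY2. lra. }
  assert (PY : 0 < Y) by lra.
  assert (AbsY : Rabs Y = Y) by (apply Rabs_right; lra).
  assert (AbsmY : Rabs (- Y) = Y) by (rewrite Rabs_Ropp; auto).
  assert (Hcon : forall c, c1 <= c <= c2 -> c <> a -> Ccont_on (fun y => H (c, y)) (- Y) Y).
  { intros c Hc Hn. apply (Ccont_on_vert U); auto. intros y _. split; simpl; [lra|].
    intros E. injection E. auto. }
  set (J := fun c y1 y2 => CInt (fun y => H (c, y)) y1 y2).
  (* [rect_bound] on the four rectangles to the left, to the right, above and below the square. *)
  assert (S1 : Cmod (J (a - eta)%R (- Y)%R Y - J c1 (- Y)%R Y)%C <= 4 * e2 * ((a - eta)%R - c1)).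
  { apply (rect_bound U H m'); try lra; auto.
    - intros z Hz. unfold box in Hz. split; [lra|]. intros E. rewrite E in Hz. simpl in Hz. lra.
    - intros c Hc. generalize (B2 c (- Y)%R ltac:(lra) AbsmY) (B2 c Y ltac:(lra) AbsY). lra. }
  assert (S2 : Cmod (J c2 (- Y)%R Y - J (a + eta)%R (- Y)%R Y)%C <= 4 * e2 * (c2 - (a + eta)%R)).
  { apply (rect_bound U H m'); try lra; auto.
    - intros z Hz. unfold box in Hz. split; [lra|]. intros E. rewrite E in Hz. simpl in Hz. lra.
    - intros c Hc. generalize (B2 c (- Y)%R ltac:(lra) AbsmY) (B2 c Y ltac:(lra) AbsY). lra. }
  assert (S3 : Cmod (J (a + eta)%R (b + eta)%R Y - J (a - eta)%R (b + eta)%R Y)%C <= (e1 / eta + 2 * e2) * ((a + eta)%R - (a - eta)%R)).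
  { apply (rect_bound U H m'); try lra; auto.
    - intros z Hz. unfold box in Hz. split; [lra|]. intros E. rewrite E in Hz. simpl in Hz. lra.
    - intros c Hc. generalize (B2 c Y ltac:(lra) AbsY).
      assert (Rabs (c - a) <= eta) by (apply Rabs_le; lra).
      assert (E : Rabs (b + eta - b) = eta) by (replace (b + eta - b) with eta by ring; apply Rabs_right; lra).
      generalize (B1' c (b + eta)%R ltac:(auto) ltac:(lra) (or_intror E)). lra. }
  assert (S4 : Cmod (J (a + eta)%R (- Y)%R (b - eta)%R - J (a - eta)%R (- Y)%R (b - eta)%R)%C <= (e1 / eta + 2 * e2) * ((a + eta)%R - (a - eta)%R)).
  { apply (rect_bound U H m'); try lra; auto.
    - intros z Hz. unfold box in Hz. split; [lra|]. intros E. rewrite E in Hz. simpl in Hz. lra.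
    - intros c Hc. generalize (B2 c (- Y)%R ltac:(lra) AbsmY).
      assert (Rabs (c - a) <= eta) by (apply Rabs_le; lra).
      assert (E : Rabs (b - eta - b) = eta) by (replace (b - eta - b) with (- eta) by ring; rewrite Rabs_left; lra).
      generalize (B1' c (b - eta)%R ltac:(auto) ltac:(lra) (or_intror E)). lra. }
  assert (S5 : forall c, Rabs (c - a) = eta -> Cmod (J c (b - eta)%R (b + eta)%R) <= e1 / eta * ((b + eta)%R - (b - eta)%R)).
  { intros c Hc. assert (Hc' : - eta <= c - a <= eta) by (apply Rabs_le_between; lra).
    apply CInt_bound_const; [lra| |].
    - apply (Ccont_on_sub _ (- Y)%R Y); try lra. apply Hcon; [lra|].
      intros E. rewrite E, Rminus_diag, Rabs_R0 in Hc. lra.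
    - intros y Hy. apply B1'; auto; [lra|]. apply Rabs_le. lra. }
  assert (E1 : Rabs (a - eta - a) = eta) by (replace (a - eta - a) with (- eta) by ring; rewrite Rabs_left; lra).
  assert (E2 : Rabs (a + eta - a) = eta) by (replace (a + eta - a) with eta by ring; apply Rabs_right; lra).
  assert (S6 := S5 _ E1). assert (S7 := S5 _ E2). clear S5.
  assert (Spl : forall c, c1 <= c <= c2 -> c <> a -> J c (- Y)%R Y = (J c (- Y)%R (b - eta)%R + J c (b - eta)%R (b + eta)%R + J c (b + eta)%R Y)%C).
  { intros c Hc Hn. unfold J. rewrite !CInt_Chasles; auto; try lra.
    apply (Ccont_on_sub _ (- Y)%R Y); try lra; auto. }
  assert (F1 := Spl (a - eta)%R ltac:(lra) ltac:(lra)). assert (F2 := Spl (a + eta)%R ltac:(lra) ltac:(lra)).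
  assert (SH : Cmod (J c2 (- Y)%R Y - J c1 (- Y)%R Y)%C <= eps / 4 + eps / 4).
  { replace (J c2 (- Y)%R Y - J c1 (- Y)%R Y)%C with
      ((J c2 (- Y)%R Y - J (a + eta)%R (- Y)%R Y) + (J (a + eta)%R (- Y)%R Y - J (a - eta)%R (- Y)%R Y)
        + (J (a - eta)%R (- Y)%R Y - J c1 (- Y)%R Y))%C by ring.
    eapply Rle_trans; [apply Cmod_sum3|].
    assert (SM : Cmod (J (a + eta)%R (- Y)%R Y - J (a - eta)%R (- Y)%R Y)%C <= 8 * e1 + 8 * e2 * eta).
    { rewrite F1, F2.
      replace (J (a + eta)%R (- Y)%R (b - eta)%R + J (a + eta)%R (b - eta)%R (b + eta)%R + J (a + eta)%R (b + eta)%R Y -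
        (J (a - eta)%R (- Y)%R (b - eta)%R + J (a - eta)%R (b - eta)%R (b + eta)%R + J (a - eta)%R (b + eta)%R Y))%C
        with ((J (a + eta)%R (- Y)%R (b - eta)%R - J (a - eta)%R (- Y)%R (b - eta)%R) +
          (J (a + eta)%R (b - eta)%R (b + eta)%R + - J (a - eta)%R (b - eta)%R (b + eta)%R) +
          (J (a + eta)%R (b + eta)%R Y - J (a - eta)%R (b + eta)%R Y))%C by ring.
      eapply Rle_trans; [apply Cmod_sum3|].
      assert (T := Cmod_triangle (J (a + eta)%R (b - eta)%R (b + eta)%R) (- J (a - eta)%R (b - eta)%R (b + eta)%R)).
      rewrite Cmod_opp in T.
      replace (8 * e1 + 8 * e2 * eta) with ((e1 / eta + 2 * e2) * (a + eta - (a - eta)%R) +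
         (e1 / eta * (b + eta - (b - eta)%R) + e1 / eta * (b + eta - (b - eta)%R)) +
         (e1 / eta + 2 * e2) * (a + eta - (a - eta)%R)) by (field; lra).
      lra. }
    assert (X1 : 4 * e2 * (c2 - c1) = eps / 4) by (unfold e2; field; lra).
    assert (X2 : 8 * e1 = eps / 4) by (unfold e1; field).
    nra. }
  (* The polar part is added back; its integral tends to PI A on the right line and to -PI A on the
     left one. *)
  assert (Split : forall c, c1 <= c <= c2 -> c <> a ->
     CInt (fun y => G (c, y)) (- Y)%R Y = (J c (- Y)%R Y + A * CInt (fun y => / ((c - a)%R, (y - b)%R)) (- Y)%R Y)%C).
  { intros c Hc Hn.
    assert (Hcv : Ccont_on (fun y => / ((c - a)%R, (y - b)%R))%C (- Y)%R Y).
    { intros y _. apply (Ccont_Rcont (fun z => / (z - mu))%C (fun y => (c, y))); [|apply Rcont_vert].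
      apply (hol_Ccont U); [|split; simpl; [lra|intros E; injection E; auto]].
      apply hol_inv; [|apply hol_minus; [apply hol_id|apply hol_const]].
      intros z [_ Hz] E. apply Hz. replace z with (z - mu + mu)%C by ring. rewrite E. ring. }
    assert (Hcv2 : Ccont_on (fun y => A * / ((c - a)%R, (y - b)%R))%C (- Y)%R Y).
    { intros y Hy. apply (Ccont_Rcont (fun z => A * z)%C (fun y => / ((c - a)%R, (y - b)%R))%C); [|apply Hcv; auto].
      apply Ccont_mult; [apply Ccont_const|]. eapply Cdiff_Ccont, Cdiff_id. }
    rewrite <- CInt_scal by (auto; lra). unfold J. rewrite <- CInt_plus by (auto; lra).
    apply CInt_ext; [lra|]. intros y _. unfold H.
    replace ((c, y) - mu)%C with ((c - a)%R, (y - b)%R) by reflexivity. ring. }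
  rewrite (Split c1), (Split c2) by lra.
  assert (D2 := proj1 (CInt_inv_lim (c2 - a) b Y ltac:(lra) ltac:(lra))).
  assert (D1 := proj2 (CInt_inv_lim (a - c1) b Y ltac:(lra) ltac:(lra))).
  replace (- (a - c1)) with (c1 - a) in D1 by ring.
  set (I1 := CInt (fun y => / ((c1 - a)%R, (y - b)%R))%C (- Y)%R Y) in *.
  set (I2 := CInt (fun y => / ((c2 - a)%R, (y - b)%R))%C (- Y)%R Y) in *.
  replace (J c2 (- Y)%R Y + A * I2 - (J c1 (- Y)%R Y + A * I1) - RtoC (2 * PI) * A)%C with
    ((J c2 (- Y)%R Y - J c1 (- Y)%R Y) + A * (I2 - RtoC PI) + - (A * (I1 + RtoC PI)))%C.
  2:{ rewrite RtoC_mult. ring. }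
  eapply Rle_trans; [apply Cmod_sum3|]. rewrite Cmod_opp, !Cmod_mult.
  assert (HKY := HY3 Y ltac:(lra)). unfold K in HKY.
  assert (PA := Cmod_ge_0 A).
  apply (Rmult_le_compat_l (Cmod A)) in D1; auto. apply (Rmult_le_compat_l (Cmod A)) in D2; auto.
  replace (Cmod A * (4 * (c2 - a) + 8 * Rabs b + (4 * (a - c1) + 8 * Rabs b)) / Y) with
    (Cmod A * ((4 * (c2 - a) + 8 * Rabs b) / Y) + Cmod A * ((4 * (a - c1) + 8 * Rabs b) / Y)) in HKY by (field; lra).
  lra.
Qed.

(** * Bromwich's integral for the reciprocal Gamma function *)

(** The principal power z^s, for [Re z > 0]. *)
Definition Cpow_rhp (z : C) (s : R) : C := Cexp (RtoC s * Clog_rhp z).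

Lemma Re_RtoC_mult (s : R) (z : C) : Re (RtoC s * z) = s * Re z.
Proof. unfold Re, Cmult, RtoC; simpl. ring. Qed.

Lemma Im_RtoC_mult (s : R) (z : C) : Im (RtoC s * z) = s * Im z.
Proof. unfold Im, Cmult, RtoC; simpl. ring. Qed.

Lemma Cmod_Cpow_rhp (z : C) (s : R) : Cmod (Cpow_rhp z s) = exp (s * ln (Cmod z)).
Proof. unfold Cpow_rhp. rewrite Cmod_Cexp, Re_RtoC_mult. reflexivity. Qed.

Lemma Cpow_rhp_plus (z : C) (s t : R) : Cpow_rhp z (s + t) = (Cpow_rhp z s * Cpow_rhp z t)%C.
Proof. unfold Cpow_rhp. rewrite <- Cexp_plus, RtoC_plus. f_equal. ring. Qed.

Lemma Cpow_rhp_1 (z : C) : 0 < Re z -> Cpow_rhp z 1 = z.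
Proof. intros H. unfold Cpow_rhp. rewrite Cmult_1_l. now apply Cexp_Clog_rhp. Qed.

Lemma Clog_rhp_scal (t : R) (z : C) : 0 < t -> 0 < Re z -> Clog_rhp (RtoC t * z) = (RtoC (ln t) + Clog_rhp z)%C.
Proof.
  intros Ht Hz. unfold Clog_rhp. rewrite Re_RtoC_mult, Im_RtoC_mult, Cmod_mult, Cmod_R, Rabs_right by lra.
  assert (0 < Cmod z) by (apply Cmod_gt_0, Re_pos_neq_0; auto).
  rewrite ln_mult by auto. unfold Cplus, RtoC; simpl. f_equal. rewrite Rplus_0_l. f_equal.
  field. unfold Re in *. lra.
Qed.

Lemma Cpow_rhp_scal (t : R) (z : C) (s : R) : 0 < t -> 0 < Re z -> Cpow_rhp (RtoC t * z) s = (RtoC (Rpower t s) * Cpow_rhp z s)%C.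
Proof.
  intros Ht Hz. unfold Cpow_rhp. rewrite Clog_rhp_scal by auto. unfold Rpower. rewrite <- Cexp_RtoC, <- Cexp_plus, RtoC_mult.
  f_equal. ring.
Qed.

Lemma hol_Cpow_rhp (U : C -> Prop) (s : R) : (forall z, U z -> 0 < Re z) -> hol U (fun z => Cpow_rhp z s).
Proof.
  intros HU. unfold Cpow_rhp. apply (hol_exp U (fun z => RtoC s * Clog_rhp z)%C).
  apply hol_mult; [apply hol_const|now apply hol_Clog_rhp].
Qed.

Lemma exp_le (x y : R) : x <= y -> exp x <= exp y.
Proof. intros [H|H]; [left; now apply exp_increasing|rewrite H; lra]. Qed.

(** Splitting off |z|^(-2) yields the integrable weight 1 / (c^2 + y^2); the remaining exponent -(s
    - 2) is at most 0, so there |z| may be replaced by c <= |z|. *)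
Lemma Cmod_Cpow_rhp_neg (c y s : R) : 0 < c -> 2 <= s ->
  Cmod (Cpow_rhp (c, y) (- s)) <= exp (- (s - 2) * ln c) * / (c ^ 2 + y ^ 2).
Proof.
  intros Hc Hs. rewrite Cmod_Cpow_rhp. set (r := Cmod (c, y)).
  assert (Hr2 : r ^ 2 = c ^ 2 + y ^ 2) by (unfold r; rewrite Cmod2_alt; reflexivity).
  assert (Hrc : c <= r).
  { unfold r. eapply Rle_trans; [|apply re_le_Cmod]. apply Rle_abs. }
  rewrite <- Hr2. replace (- s * ln r) with (- (s - 2) * ln r + - (2 * ln r)) by ring.
  rewrite exp_plus. apply Rmult_le_compat; try (left; apply exp_pos).
  - apply exp_le. assert (ln c <= ln r) by (apply ln_le; auto). nra.
  - rewrite exp_Ropp. apply Req_le. f_equal. replace (2 * ln r) with (ln r + ln r) by ring.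
    rewrite exp_plus, exp_ln by lra. ring.
Qed.

Definition half_plane (z : C) : Prop := 0 < Re z.

(** The integral of e^(t z) z^(-s) dz / i over the segment from c - iY to c + iY. *)
Definition bromwich (s c t Y : R) : C := CInt (fun y => Cexp (RtoC t * (c, y)) * Cpow_rhp (c, y) (- s))%C (- Y) Y.

Lemma hol_bromwich (s t : R) : hol half_plane (fun z => Cexp (RtoC t * z) * Cpow_rhp z (- s))%C.
Proof.
  apply hol_mult; [|apply hol_Cpow_rhp; auto].
  apply (hol_exp half_plane (fun z => RtoC t * z)%C). apply hol_mult; [apply hol_const|apply hol_id].
Qed.

Lemma Ccont_on_bromwich (s t c a b : R) : 0 < c -> Ccont_on (fun y => Cexp (RtoC t * (c, y)) * Cpow_rhp (c, y) (- s))%C a b.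
Proof.
  intros Hc. apply (Ccont_on_vert half_plane (fun z => Cexp (RtoC t * z) * Cpow_rhp z (- s))%C); [apply hol_bromwich|].
  intros y _. exact Hc.
Qed.

Lemma Cmod_bromwich (s t c y : R) : 0 < c -> 2 <= s ->
  (Cmod (Cexp (RtoC t * (c, y)) * Cpow_rhp (c, y) (- s)) <= exp (t * c) * exp (- (s - 2) * ln c) * / (c ^ 2 + y ^ 2))%C.
Proof.
  intros Hc Hs. rewrite Cmod_mult, Cmod_Cexp, Re_RtoC_mult, Rmult_assoc.
  apply Rmult_le_compat_l; [left; apply exp_pos|]. now apply Cmod_Cpow_rhp_neg.
Qed.

Lemma is_RInt_inv_sq (c a b : R) : 0 < c ->
  is_RInt (fun y => / (c ^ 2 + y ^ 2)) a b (atan (b / c) / c - atan (a / c) / c).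
Proof.
  intros Hc. apply (is_RInt_derive (V := R_CompleteNormedModule) (fun y => atan (y / c) / c)).
  - intros y _. assert (0 < c ^ 2 + y ^ 2) by nra. auto_derive; auto. unfold Rsqr. field. split; nra.
  - intros y _. assert (0 < c ^ 2 + y ^ 2) by nra. apply (ex_derive_continuous (V := R_NormedModule)).
    auto_derive. simpl in *. lra.
Qed.

Lemma is_RInt_inv_sq_tail (a b : R) : 0 < a -> a <= b -> is_RInt (fun y => / y ^ 2) a b (/ a - / b).
Proof.
  intros Ha Hab. replace (/ a - / b) with (- / b - - / a) by ring.
  apply (is_RInt_derive (V := R_CompleteNormedModule) (fun y => - / y)); rewrite Rmin_left, Rmax_right by auto.
  - intros y Hy. auto_derive; [lra|]. field. lra.
  - intros y Hy. apply (ex_derive_continuous (V := R_NormedModule)).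
    auto_derive. nra.
Qed.

(** The weight 1 / (c^2 + y^2) has total mass PI / c over the whole line, so the bound is uniform in
    Y. *)
Lemma CInt_line_bound (f : R -> C) (K c Y : R) : 0 < c -> 0 <= Y -> 0 <= K -> Ccont_on f (- Y) Y ->
  (forall y, - Y <= y <= Y -> Cmod (f y) <= K * / (c ^ 2 + y ^ 2)) -> Cmod (CInt f (- Y) Y) <= K * (PI / c).
Proof.
  intros Hc HY HK Hf Hb.
  eapply Rle_trans.
  - apply (CInt_bound f (fun y => K * / (c ^ 2 + y ^ 2)) (- Y) Y (K * (atan (Y / c) / c - atan (- Y / c) / c))); auto; [lra|].
    apply (is_RInt_scal (V := R_NormedModule)). now apply is_RInt_inv_sq.
  - apply Rmult_le_compat_l; auto. unfold Rdiv at 5.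
    replace (atan (Y / c) / c - atan (- Y / c) / c) with ((atan (Y / c) - atan (- Y / c)) * / c) by (field; lra).
    apply Rmult_le_compat_r; [left; now apply Rinv_0_lt_compat|].
    generalize (atan_bound (Y / c)) (atan_bound (- Y / c)). lra.
Qed.

Lemma bromwich_bound (s t c Y : R) : 0 < c -> 2 <= s -> 0 <= Y ->
  Cmod (bromwich s c t Y) <= exp (t * c) * exp (- (s - 2) * ln c) * (PI / c).
Proof.
  intros Hc Hs HY. apply CInt_line_bound; auto.
  - apply Rmult_le_pos; left; apply exp_pos.
  - now apply Ccont_on_bromwich.
  - intros y _. now apply Cmod_bromwich.
Qed.

Lemma bromwich_tail (s t c Y Y' : R) : 0 < c -> 2 <= s -> 0 < Y -> Y <= Y' ->
  Cmod (bromwich s c t Y' - bromwich s c t Y)%C <= 2 * (exp (t * c) * exp (- (s - 2) * ln c)) / Y.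
Proof.
  intros Hc Hs HY HYY. unfold bromwich. set (f := fun y => (Cexp (RtoC t * (c, y)) * Cpow_rhp (c, y) (- s))%C).
  assert (Hf : forall a b, Ccont_on f a b) by (intros; now apply Ccont_on_bromwich).
  set (K := exp (t * c) * exp (- (s - 2) * ln c)).
  assert (HK : 0 < K) by (unfold K; apply Rmult_lt_0_compat; apply exp_pos).
  assert (Hb : forall y, y <> 0 -> Cmod (f y) <= K * / y ^ 2).
  { intros y Hy. eapply Rle_trans; [now apply Cmod_bromwich|]. apply Rmult_le_compat_l; [lra|].
    assert (0 < y ^ 2) by nra. apply Rinv_le_contravar; nra. }
  rewrite <- (CInt_Chasles f (- Y') (- Y) Y') by (auto; lra).
  rewrite <- (CInt_Chasles f (- Y) Y Y') by (auto; lra).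
  replace (CInt f (- Y')%R (- Y)%R + (CInt f (- Y)%R Y + CInt f Y Y') - CInt f (- Y)%R Y)%C with (CInt f (- Y')%R (- Y)%R + CInt f Y Y')%C by ring.
  assert (HT : / Y - / Y' <= / Y) by (assert (0 < / Y') by (apply Rinv_0_lt_compat; lra); lra).
  assert (B2 : Cmod (CInt f Y Y') <= K * (/ Y - / Y')).
  { apply (CInt_bound f (fun y => K * / y ^ 2)); auto.
    - intros y Hy. apply Hb. lra.
    - apply (is_RInt_scal (V := R_NormedModule)). apply is_RInt_inv_sq_tail; auto. }
  assert (B1 : Cmod (CInt f (- Y') (- Y)) <= K * (/ Y - / Y')).
  { apply (CInt_bound f (fun y => K * / y ^ 2)); auto; [lra| |].
    - intros y Hy. apply Hb. lra.
    - apply (is_RInt_scal (V := R_NormedModule)).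
      replace (/ Y - / Y') with (- / (- Y) - - / (- Y')) by (field; lra).
      apply (is_RInt_derive (V := R_CompleteNormedModule) (fun y => - / y)); rewrite Rmin_left, Rmax_right by lra.
      + intros y Hy. auto_derive; [lra|]. field. lra.
      + intros y Hy. apply (ex_derive_continuous (V := R_NormedModule)). auto_derive. nra. }
  eapply Rle_trans; [apply Cmod_triangle|].
  replace (2 * K / Y) with (K * / Y + K * / Y) by (field; lra). nra.
Qed.

(** The limit is found along the integers, componentwise; the Cauchy estimate then carries it, with
    its rate, to real Y. *)
Lemma Cauchy_limit (F : R -> C) (K : R) : 0 <= K ->
  (forall Y Y', 1 <= Y -> Y <= Y' -> Cmod (F Y' - F Y)%C <= K / Y) ->
  exists l, forall Y, 1 <= Y -> Cmod (F Y - l)%C <= K / Y.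
Proof.
  intros HK HF.
  assert (P : forall p : C -> R, (forall z u, Rabs (p z - p u) <= Cmod (z - u)%C) ->
     exists l : R, is_lim_seq (fun n => p (F (INR n))) l).
  { intros p Hp. apply ex_lim_seq_cauchy_corr. intros eps.
    destruct (inv_le_large K (eps / 3) HK ltac:(generalize (cond_pos eps); lra)) as [Y0 [HY0 HY]].
    destruct (nfloor_ex (Y0 + 1)) as [N HN]; [lra|]. exists (S N).
    assert (Hle : forall n, (S N <= n)%nat -> Y0 + 1 <= INR n).
    { intros n Hn. apply le_INR in Hn. rewrite S_INR in Hn. lra. }
    assert (Hw : forall n m, (S N <= n)%nat -> (n <= m)%nat -> Rabs (p (F (INR m)) - p (F (INR n))) < eps).
    { intros n m Hn Hm. eapply Rle_lt_trans; [apply Hp|].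
      assert (Q := Hle n Hn). apply le_INR in Hm.
      eapply Rle_lt_trans; [apply HF; lra|]. eapply Rle_lt_trans; [apply HY; lra|].
      generalize (cond_pos eps); lra. }
    intros n m Hn Hm. destruct (Nat.le_gt_cases n m).
    - rewrite Rabs_minus_sym. now apply Hw.
    - apply Hw; auto; lia. }
  destruct (P Re Re_lip) as [l1 H1]. destruct (P Im Im_lip) as [l2 H2].
  exists (l1, l2). intros Y HY. apply le_epsilon. intros e He.
  destruct (proj1 (filterlim_locally _ _) H1 (mkposreal (e / 2) ltac:(lra))) as [N1 HN1].
  destruct (proj1 (filterlim_locally _ _) H2 (mkposreal (e / 2) ltac:(lra))) as [N2 HN2].
  destruct (nfloor_ex Y) as [N3 HN3]; [lra|].
  set (n := (N1 + N2 + S N3)%nat).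
  specialize (HN1 n ltac:(unfold n; lia)). specialize (HN2 n ltac:(unfold n; lia)).
  assert (Hn : Y <= INR n).
  { apply Rle_trans with (INR (S N3)); [rewrite S_INR; lra|apply le_INR; unfold n; lia]. }
  unfold ball in HN1, HN2; simpl in HN1, HN2. unfold AbsRing_ball, minus, plus, opp, abs in HN1, HN2; simpl in HN1, HN2.
  assert (B1 := HF Y (INR n) HY Hn).
  replace (F Y - (l1, l2))%C with (- (F (INR n) - F Y) + (F (INR n) - (l1, l2)))%C by ring.
  eapply Rle_trans; [apply Cmod_triangle|]. rewrite Cmod_opp.
  assert (B2 := Cmod_le_Re_Im (F (INR n) - (l1, l2))%C). unfold Re, Im in *. simpl in B2. lra.
Qed.

Definition tends (F : R -> C) (l : C) : Prop :=
  forall eps, 0 < eps -> exists Y0, forall Y, Y0 <= Y -> Cmod (F Y - l)%C <= eps.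

Lemma tends_unique (F : R -> C) (l1 l2 : C) : tends F l1 -> tends F l2 -> l1 = l2.
Proof.
  intros H1 H2. assert (E : Cmod (l1 - l2)%C <= 0).
  { apply le_epsilon. intros e He. destruct (H1 (e / 2) ltac:(lra)) as [A HA]. destruct (H2 (e / 2) ltac:(lra)) as [B HB].
    specialize (HA (Rmax A B) (Rmax_l _ _)). specialize (HB (Rmax A B) (Rmax_r _ _)).
    replace (l1 - l2)%C with (- (F (Rmax A B) - l1) + (F (Rmax A B) - l2))%C by ring.
    eapply Rle_trans; [apply Cmod_triangle|]. rewrite Cmod_opp. lra. }
  assert (Z : (l1 - l2)%C = 0%C) by (apply Cmod_eq_0; generalize (Cmod_ge_0 (l1 - l2)%C); lra).
  replace l1 with (l1 - l2 + l2)%C by ring. rewrite Z. ring.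
Qed.

Lemma tends_plus (F G : R -> C) (l1 l2 : C) : tends F l1 -> tends G l2 -> tends (fun Y => F Y + G Y)%C (l1 + l2)%C.
Proof.
  intros H1 H2 e He. destruct (H1 (e / 2) ltac:(lra)) as [A HA]. destruct (H2 (e / 2) ltac:(lra)) as [B HB].
  exists (Rmax A B). intros Y HY. generalize (Rmax_l A B) (Rmax_r A B); intros.
  specialize (HA Y ltac:(lra)). specialize (HB Y ltac:(lra)).
  replace (F Y + G Y - (l1 + l2))%C with ((F Y - l1) + (G Y - l2))%C by ring.
  eapply Rle_trans; [apply Cmod_triangle|]. lra.
Qed.

Lemma tends_scal (w : C) (F : R -> C) (l : C) : tends F l -> tends (fun Y => w * F Y)%C (w * l)%C.
Proof.
  intros H e He. assert (Hw := Cmod_ge_0 w).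
  destruct (H (e / (Cmod w + 1))) as [A HA]; [apply Rdiv_lt_0_compat; lra|].
  exists A. intros Y HY. specialize (HA Y HY).
  replace (w * F Y - w * l)%C with (w * (F Y - l))%C by ring. rewrite Cmod_mult.
  apply (Rmult_le_compat_l (Cmod w + 1)) in HA; [|lra].
  replace ((Cmod w + 1) * (e / (Cmod w + 1))) with e in HA by (field; lra).
  generalize (Cmod_ge_0 (F Y - l)%C). nra.
Qed.

Lemma tends_const (l : C) : tends (fun _ => l) l.
Proof.
  intros e He. exists 0. intros Y _. replace (l - l)%C with (RtoC 0) by ring. rewrite Cmod_0. lra.
Qed.

Lemma tends_ext (F G : R -> C) (Y0 : R) (l : C) : (forall Y, Y0 <= Y -> F Y = G Y) -> tends F l -> tends G l.
Proof.
  intros H HF e He. destruct (HF e He) as [A HA]. exists (Rmax A Y0). intros Y HY.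
  generalize (Rmax_l A Y0) (Rmax_r A Y0); intros. rewrite <- H by lra. apply HA; lra.
Qed.

Lemma tends_minus (F G : R -> C) (l1 l2 : C) : tends F l1 -> tends G l2 -> tends (fun Y => F Y - G Y)%C (l1 - l2)%C.
Proof.
  intros H1 H2. apply (tends_ext (fun Y => F Y + (-1) * G Y)%C _ 0).
  - intros; ring.
  - replace (l1 - l2)%C with (l1 + (-1) * l2)%C by ring. apply tends_plus; auto. now apply tends_scal.
Qed.

Lemma tends_bound (F : R -> C) (l a : C) (Y0 B : R) : tends F l -> (forall Y, Y0 <= Y -> Cmod (F Y - a)%C <= B) -> Cmod (l - a)%C <= B.
Proof.
  intros H HB. apply le_epsilon. intros e He. destruct (H e He) as [A HA].
  specialize (HA (Rmax A Y0) (Rmax_l _ _)). specialize (HB (Rmax A Y0) (Rmax_r _ _)).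
  replace (l - a)%C with (- (F (Rmax A Y0) - l) + (F (Rmax A Y0) - a))%C by ring.
  eapply Rle_trans; [apply Cmod_triangle|]. rewrite Cmod_opp. lra.
Qed.

Lemma tends_0_inv (F : R -> C) (Y0 K : R) : 0 <= K -> (forall Y, Y0 <= Y -> Cmod (F Y) <= K / Y) -> tends F 0.
Proof.
  intros HK H e He. destruct (inv_le_large K e HK He) as [Y1 [HY1 HY]].
  exists (Rmax Y0 Y1). intros Y HYY. generalize (Rmax_l Y0 Y1) (Rmax_r Y0 Y1); intros.
  replace (F Y - 0)%C with (F Y) by ring. eapply Rle_trans; [apply H; lra|]. apply HY; lra.
Qed.

Lemma tends_scale_arg (F : R -> C) (l : C) (t : R) : 0 < t -> tends F l -> tends (fun Y => F (Y * t)) l.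
Proof.
  intros Ht H e He. destruct (H e He) as [A HA]. exists (A / t). intros Y HY. apply HA.
  apply (Rmult_le_compat_r t) in HY; [|lra]. unfold Rdiv in HY. rewrite Rmult_assoc, Rinv_l in HY; lra.
Qed.

(** The horizontal sides at height Y contribute O(1/Y), so the limit in Y cannot depend on the
    line. *)
Lemma bromwich_shift_le (s c1 c2 : R) : 2 <= s -> 0 < c1 -> c1 <= c2 -> tends (fun Y => bromwich s c2 1 Y - bromwich s c1 1 Y)%C 0.
Proof.
  intros Hs Hc1 Hc. set (K := exp (1 * c2) * exp (- (s - 2) * ln c1)).
  assert (HK : 0 < K) by (apply Rmult_lt_0_compat; apply exp_pos).
  apply (tends_0_inv _ 1 ((K + K) * (c2 - c1))); [nra|]. intros Y HY.
  assert (HB : forall c y, c1 <= c <= c2 -> y ^ 2 = Y ^ 2 -> Cmod (Cexp (RtoC 1 * (c, y)) * Cpow_rhp (c, y) (- s))%C <= K / Y).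
  { intros c y Hcc Hy. eapply Rle_trans; [apply Cmod_bromwich; lra|]. apply Rmult_le_compat.
    - apply Rmult_le_pos; left; apply exp_pos.
    - left; apply Rinv_0_lt_compat. rewrite Hy. nra.
    - apply Rmult_le_compat; try (left; apply exp_pos); apply exp_le; [lra|].
      assert (ln c1 <= ln c) by (apply ln_le; lra). nra.
    - rewrite Hy. apply Rinv_le_contravar; nra. }
  unfold bromwich. replace ((K + K) * (c2 - c1) / Y) with ((K / Y + K / Y) * (c2 - c1)) by (field; lra).
  apply (rect_bound half_plane (fun z => Cexp (RtoC 1 * z) * Cpow_rhp z (- s))%C (c1 / 2)); try lra.
  - apply hol_bromwich.
  - intros z Hz. unfold box, half_plane in *. lra.
  - intros c Hcc. apply Rplus_le_compat; apply HB; auto; ring.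
Qed.

Lemma CInt_comp_scal (f : R -> C) (t Y : R) : 0 < t -> 0 <= Y -> (forall a b, Ccont_on f a b) ->
  (RtoC t * CInt (fun y => f (t * y)%R) (- Y) Y)%C = CInt f (- (Y * t)) (Y * t).
Proof.
  intros Ht HY Hf.
  assert (HYt : - (Y * t) <= Y * t) by nra.
  destruct (Ccont_on_ex_RInt f _ _ HYt (Hf _ _)) as [H1 H2].
  replace (- (Y * t)) with (t * (- Y) + 0) in * by ring. replace (Y * t) with (t * Y + 0) in * by ring.
  assert (K1 := RInt_comp_lin (V := R_CompleteNormedModule) _ _ _ _ _ H1).
  assert (K2 := RInt_comp_lin (V := R_CompleteNormedModule) _ _ _ _ _ H2).
  assert (X1 := ex_RInt_comp_lin (V := R_NormedModule) _ _ _ _ _ H1).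
  assert (X2 := ex_RInt_comp_lin (V := R_NormedModule) _ _ _ _ _ H2).
  unfold CInt. rewrite <- K1, <- K2. unfold Cmult, RtoC; simpl. f_equal.
  - rewrite Rmult_0_l, Rminus_0_r. rewrite <- (RInt_scal (V := R_CompleteNormedModule)).
    + apply RInt_ext. intros x _. rewrite Rplus_0_r. reflexivity.
    + apply (ex_RInt_ext (fun y => scal (/ t) (scal t (Re (f (t * y + 0)))))).
      * intros x _. rewrite Rplus_0_r. unfold scal; simpl; unfold mult; simpl. field. lra.
      * apply (ex_RInt_scal (V := R_NormedModule)). exact X1.
  - rewrite Rmult_0_l, Rplus_0_r. rewrite <- (RInt_scal (V := R_CompleteNormedModule)).
    + apply RInt_ext. intros x _. rewrite Rplus_0_r. reflexivity.
    + apply (ex_RInt_ext (fun y => scal (/ t) (scal t (Im (f (t * y + 0)))))).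
      * intros x _. rewrite Rplus_0_r. unfold scal; simpl; unfold mult; simpl. field. lra.
      * apply (ex_RInt_scal (V := R_NormedModule)). exact X2.
Qed.

(** The substitution z -> t z reduces time t to time 1. It moves the line from c to c t, which is
    harmless in the limit. *)
Lemma bromwich_scal (s c t Y : R) : 0 < c -> 0 < t -> 0 <= Y ->
  bromwich s c t Y = (RtoC (Rpower t (s - 1)) * bromwich s (c * t) 1 (Y * t))%C.
Proof.
  intros Hc Ht HY. unfold bromwich at 2.
  assert (Hct : 0 < c * t) by nra.
  rewrite <- (CInt_comp_scal (fun y => Cexp (RtoC 1 * ((c * t)%R, y)) * Cpow_rhp ((c * t)%R, y) (- s))%C t Y) by
    (auto; intros; now apply Ccont_on_bromwich).
  rewrite Cmult_assoc, <- RtoC_mult.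
  rewrite <- (Rpower_1 t) at 3 by auto. rewrite <- Rpower_plus. replace (s - 1 + 1) with s by ring.
  assert (E : forall y, ((c * t)%R, (t * y)%R) = (RtoC t * (c, y))%C).
  { intros y. unfold Cmult, RtoC; simpl. f_equal; ring. }
  rewrite (CInt_ext _ (fun y => RtoC (Rpower t (- s)) * (Cexp (RtoC t * (c, y)) * Cpow_rhp (c, y) (- s)))%C).
  - rewrite CInt_scal by (try lra; now apply Ccont_on_bromwich).
    rewrite Cmult_assoc, <- RtoC_mult, <- Rpower_plus, Rplus_opp_r, Rpower_O, Cmult_1_l by auto. reflexivity.
  - lra.
  - intros y _. rewrite E, Cpow_rhp_scal by auto. rewrite Cmult_1_l. ring.
Qed.

(** The limit l is identified as 2 PI / Gamma s in [Gamma_line]. The second clause uses the line Re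
    z = 1/2 because its error e^(t/2) / Y must remain integrable against e^(-t). *)
Lemma bromwich_limit (s : R) : 2 <= s -> exists l : C,
  (forall c, 0 < c -> tends (bromwich s c 1) l) /\
  (forall t Y, 0 < t -> 1 <= Y ->
    Cmod (bromwich s (1 / 2) t Y - RtoC (Rpower t (s - 1)) * l)%C <= 2 * exp (- (s - 2) * ln (1 / 2)) * exp (t / 2) / Y).
Proof.
  intros Hs.
  destruct (Cauchy_limit (bromwich s 1 1) (2 * (exp (1 * 1) * exp (- (s - 2) * ln 1)))) as [l Hl].
  - assert (0 < exp (1 * 1) * exp (- (s - 2) * ln 1)) by (apply Rmult_lt_0_compat; apply exp_pos). lra.
  - intros Y Y' H1 H2. apply bromwich_tail; lra.
  - set (K := 2 * (exp (1 * 1) * exp (- (s - 2) * ln 1))) in *.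
    assert (HK : 0 < K) by (unfold K; assert (0 < exp (1 * 1) * exp (- (s - 2) * ln 1)) by (apply Rmult_lt_0_compat; apply exp_pos); lra).
    assert (T1 : tends (bromwich s 1 1) l).
    { replace l with (0 + l)%C by ring. apply (tends_ext (fun Y => (bromwich s 1 1 Y - l) + l)%C _ 0); [intros; ring|].
      apply tends_plus; [|apply tends_const]. apply (tends_0_inv _ 1 K); [lra|]. exact Hl. }
    assert (Tc : forall c, 0 < c -> tends (bromwich s c 1) l).
    { intros c Hc. destruct (Rle_dec 1 c) as [H|H].
      - replace l with (0 + l)%C by ring. apply (tends_ext (fun Y => (bromwich s c 1 Y - bromwich s 1 1 Y) + bromwich s 1 1 Y)%C _ 0); [intros; ring|].
        apply tends_plus; auto. apply bromwich_shift_le; lra.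
      - replace l with (l - 0)%C by ring. apply (tends_ext (fun Y => bromwich s 1 1 Y - (bromwich s 1 1 Y - bromwich s c 1 Y))%C _ 0); [intros; ring|].
        apply tends_minus; auto. apply bromwich_shift_le; lra. }
    exists l. split; auto.
    intros t Y Ht HY.
    assert (T2 : tends (bromwich s (1 / 2) t) (RtoC (Rpower t (s - 1)) * l)%C).
    { apply (tends_ext (fun Y => RtoC (Rpower t (s - 1)) * bromwich s (1 / 2 * t) 1 (Y * t))%C _ 0).
      - intros Z HZ. symmetry. apply bromwich_scal; lra.
      - apply tends_scal. apply (tends_scale_arg (bromwich s (1 / 2 * t) 1)); auto. apply Tc. lra. }
    replace (bromwich s (1 / 2) t Y - RtoC (Rpower t (s - 1)) * l)%C with (- (RtoC (Rpower t (s - 1)) * l - bromwich s (1 / 2) t Y))%C by ring.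
    rewrite Cmod_opp. apply (tends_bound _ _ _ Y _ T2). intros Z HZ.
    eapply Rle_trans; [apply bromwich_tail; lra|]. apply Req_le.
    replace (t * (1 / 2)) with (t / 2) by field. field. lra.
Qed.

Lemma Ccont_2d_comp (g : C -> C) (w : R -> R -> C) (u v : R) : Ccont g (w u v) ->
  continuity_2d_pt (fun a b => Re (w a b)) u v -> continuity_2d_pt (fun a b => Im (w a b)) u v ->
  continuity_2d_pt (fun a b => Re (g (w a b))) u v /\ continuity_2d_pt (fun a b => Im (g (w a b))) u v.
Proof.
  intros Hg H1 H2.
  assert (Key : forall p : C -> R, (forall z z', Rabs (p z - p z') <= Cmod (z - z')%C) ->
    continuity_2d_pt (fun a b => p (g (w a b))) u v).
  { intros p Hp eps. destruct (proj1 (Ccont_iff _ _) Hg eps (cond_pos eps)) as [d [Hd Hw]].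
    assert (Hd2 : 0 < d / 2) by lra.
    generalize (locally_2d_and _ _ _ _ (H1 (mkposreal _ Hd2)) (H2 (mkposreal _ Hd2))).
    apply locally_2d_impl, locally_2d_forall. intros a b [B1 B2]. simpl in B1, B2.
    eapply Rle_lt_trans; [apply Hp|]. apply Hw. eapply Rle_lt_trans; [apply Cmod_le_Re_Im|].
    unfold Re, Im in *. simpl. unfold Rminus in *. lra. }
  split; apply Key; [apply Re_lip|apply Im_lip].
Qed.

(** The line Re z = 1/2 lies to the left of the pole z = 1 of the Laplace transform, and e^(-t) e^(t
    z) decays on it. *)
Definition half_pt (y : R) : C := (1 / 2, y).

Lemma one_minus_half_pt (y : R) : 1 / 2 <= Cmod (1 - half_pt y)%C.
Proof.
  eapply Rle_trans; [|apply re_le_Cmod]. unfold Re, half_pt; simpl. rewrite Rabs_right; lra.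
Qed.

Lemma one_minus_half_pt_neq_0 (y : R) : (1 - half_pt y)%C <> 0%C.
Proof. apply Cmod_gt_0. generalize (one_minus_half_pt y). lra. Qed.

(** Integrating e^(-t) e^(z t) z^(-s) over t in [0, T], at z = 1/2 + iy. *)
Definition laplace_integrand (s T y : R) : C := (Cpow_rhp (half_pt y) (- s) * ((1 - Cexp (RtoC T * (half_pt y - 1))) / (1 - half_pt y)))%C.

Lemma hol_laplace_integrand_exp (U : C -> Prop) (T : R) : hol U (fun z => Cexp (RtoC T * (z - 1)))%C.
Proof.
  apply (hol_exp U (fun z => RtoC T * (z - 1))%C). apply hol_mult; [apply hol_const|].
  apply hol_minus; [apply hol_id|apply hol_const].
Qed.

Lemma Ccont_on_half_pt (f : C -> C) (a b : R) : hol (fun z => Re z = 1 / 2) f -> Ccont_on (fun y => f (half_pt y)) a b.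
Proof. intros H. apply (Ccont_on_vert (fun z => Re z = 1 / 2) f (1 / 2)); auto. Qed.

Lemma hol_one_minus : hol (fun z => Re z = 1 / 2) (fun z => / (1 - z))%C.
Proof.
  apply hol_inv.
  - intros z Hz. rewrite (surj_C z), Hz. apply (one_minus_half_pt_neq_0 (Im z)).
  - apply hol_minus; [apply hol_const|apply hol_id].
Qed.

Lemma Ccont_on_laplace_integrand (s T a b : R) : Ccont_on (laplace_integrand s T) a b.
Proof.
  apply (Ccont_on_half_pt (fun z => Cpow_rhp z (- s) * ((1 - Cexp (RtoC T * (z - 1))) / (1 - z)))%C).
  apply hol_mult.
  - apply hol_Cpow_rhp. intros z Hz. rewrite Hz. lra.
  - apply hol_mult; [|apply hol_one_minus]. apply hol_minus; [apply hol_const|apply hol_laplace_integrand_exp].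
Qed.

(** Stands in for Fubini: the t-integral has been carried out under the line integral, and
    differentiation in T recovers e^(-T) times Bromwich's integral at time T. *)
Lemma laplace_integrand_derive (s T Y : R) : 0 <= Y ->
  Rdiff (fun T => CInt (laplace_integrand s T) (- Y) Y) T (RtoC (exp (- T)) * bromwich s (1 / 2) T Y)%C.
Proof.
  intros HY.
  replace (RtoC (exp (- T)) * bromwich s (1 / 2) T Y)%C with
    (CInt (fun y => Cpow_rhp (half_pt y) (- s) * Cexp (RtoC T * (half_pt y - 1)))%C (- Y) Y).
  - apply (CInt_param_gen (fun T y => laplace_integrand s T y) (fun T y => Cpow_rhp (half_pt y) (- s) * Cexp (RtoC T * (half_pt y - 1)))%C (- Y) Y T 1);
      try lra.
    + intros u y _ _.
      set (K := (Cpow_rhp (half_pt y) (- s) * / (1 - half_pt y))%C).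
      replace (Cpow_rhp (half_pt y) (- s) * Cexp (RtoC u * (half_pt y - 1)))%C
        with ((K * - Cexp (0 + RtoC u * (half_pt y - 1))) * (half_pt y - 1))%C.
      * eapply Rdiff_ext; [|apply (Cdiff_line (fun z => K * (1 - Cexp z))%C)].
        -- intros x. unfold laplace_integrand, K. simpl. rewrite Cplus_0_l. unfold Cdiv. ring.
        -- set (z0 := (0 + RtoC u * (half_pt y - 1))%C).
           assert (D := Cdiff_mult _ _ z0 _ _ (Cdiff_const K z0)
             (Cdiff_plus _ _ z0 _ _ (Cdiff_const 1 z0) (Cdiff_mult _ _ z0 _ _ (Cdiff_const (-1) z0) (Cdiff_exp z0)))).
           eapply Cdiff_ext; [|replace (K * - Cexp z0)%C with (0 * (1 + -1 * Cexp z0) + K * (0 + (0 * Cexp z0 + -1 * Cexp z0)))%C by ring; exact D].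
           intros z; simpl. ring.
      * rewrite Cplus_0_l. unfold K. field. apply one_minus_half_pt_neq_0.
    + intros u _. apply Ccont_on_laplace_integrand.
    + intros y _.
      (* Power and exponential merge into [Cexp] of one exponent that is jointly continuous in (u,
         v). *)
      set (w := fun u v => (RtoC (- s) * Clog_rhp (half_pt v) + RtoC u * (half_pt v - 1))%C).
      assert (HL : Rcont (fun v => Clog_rhp (half_pt v)) y).
      { apply (Ccont_on_half_pt Clog_rhp y y); [|lra]. apply hol_Clog_rhp. intros z Hz. rewrite Hz. lra. }
      assert (Q : forall q1 q2 : R -> R, continuous q1 y -> continuous q2 y ->
         continuity_2d_pt (fun u v => - s * q1 v + u * q2 v) T y).
      { intros q1 q2 C1 C2. apply continuity_2d_pt_plus; apply continuity_2d_pt_mult.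
        - apply continuity_2d_pt_const.
        - apply (continuity_1d_2d_pt_comp q1 (fun _ v => v)).
          + now apply continuity_pt_filterlim.
          + apply continuity_2d_pt_id2.
        - apply continuity_2d_pt_id1.
        - apply (continuity_1d_2d_pt_comp q2 (fun _ v => v)).
          + now apply continuity_pt_filterlim.
          + apply continuity_2d_pt_id2. }
      destruct (Ccont_2d_comp Cexp w T y) as [R1 R2].
      * eapply Cdiff_Ccont, Cdiff_exp.
      * apply (continuity_2d_pt_ext (fun u v => - s * Re (Clog_rhp (half_pt v)) + u * (- 1 / 2))).
        -- intros u v. unfold w, half_pt, Re, Cplus, Cminus, Cmult, Copp, RtoC; simpl. field.
        -- apply (Q (fun v => Re (Clog_rhp (half_pt v))) (fun _ => - 1 / 2)); [apply HL|apply continuous_const].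
      * apply (continuity_2d_pt_ext (fun u v => - s * Im (Clog_rhp (half_pt v)) + u * v)).
        -- intros u v. unfold w, half_pt, Im, Cplus, Cminus, Cmult, Copp, RtoC; simpl. ring.
        -- apply (Q (fun v => Im (Clog_rhp (half_pt v))) (fun v => v)); [apply HL|apply continuous_id].
      * split.
        -- eapply continuity_2d_pt_ext; [|exact R1]. intros u v. unfold w, Cpow_rhp. now rewrite Cexp_plus.
        -- eapply continuity_2d_pt_ext; [|exact R2]. intros u v. unfold w, Cpow_rhp. now rewrite Cexp_plus.
  - unfold bromwich. rewrite <- CInt_scal by (try lra; apply Ccont_on_bromwich; lra). apply CInt_ext; [lra|].
    intros y _. fold (half_pt y). rewrite <- Cexp_RtoC, Cmult_assoc, <- Cexp_plus, Cmult_comm. f_equal. f_equal.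
    rewrite RtoC_opp. ring.
Qed.

Lemma laplace_integrand_line (s Y K : R) (f : R -> C) : 2 <= s -> 0 <= Y -> 0 <= K ->
  Ccont_on (fun y => Cpow_rhp (half_pt y) (- s) * f y)%C (- Y) Y -> (forall y, Cmod (f y) <= K) ->
  Cmod (CInt (fun y => Cpow_rhp (half_pt y) (- s) * f y)%C (- Y) Y) <= exp (- (s - 2) * ln (1 / 2)) * (2 * PI) * K.
Proof.
  intros Hs HY HK Hc Hf.
  replace (exp (- (s - 2) * ln (1 / 2)) * (2 * PI) * K) with ((K * exp (- (s - 2) * ln (1 / 2))) * (PI / (1 / 2))) by field.
  apply CInt_line_bound; auto; try lra.
  - apply Rmult_le_pos; auto. left; apply exp_pos.
  - intros y _. rewrite Cmod_mult, Rmult_comm, Rmult_assoc. apply Rmult_le_compat; auto; try apply Cmod_ge_0.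
    apply Cmod_Cpow_rhp_neg; lra.
Qed.

(** Mean value inequality for t -> e^(t v), whose derivative has modulus at most |v| when Re v <= 0.
    It controls the Laplace integral near t = 0. *)
Lemma exp_div_le (v : C) (T : R) : v <> 0%C -> Re v <= 0 -> 0 <= T ->
  (Cmod ((1 - Cexp (RtoC T * v)) / v) <= T)%C.
Proof.
  intros Hv Hr HT.
  assert (M := Cmvt (fun t => Cexp (0 + RtoC t * v)) (fun t => Cexp (0 + RtoC t * v) * v)%C
    (fun t => Cmod v * t) (fun _ => Cmod v) 0 T HT).
  rewrite Cmod_div by auto. apply (Rmult_le_reg_r (Cmod v)); [now apply Cmod_gt_0|].
  unfold Rdiv. rewrite Rmult_assoc, Rinv_l, Rmult_1_r by (apply Rgt_not_eq; now apply Cmod_gt_0).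
  replace (1 - Cexp (RtoC T * v))%C with (- (Cexp (0 + RtoC T * v) - Cexp (0 + RtoC 0 * v)))%C.
  - rewrite Cmod_opp. replace (T * Cmod v) with (Cmod v * T - Cmod v * 0) by ring. apply M.
    + intros t _. apply (Cdiff_line Cexp). apply Cdiff_exp.
    + intros t _. auto_derive; auto; ring.
    + intros t Ht. rewrite Cmod_mult, Cmod_Cexp, Cplus_0_l, Re_RtoC_mult.
      rewrite <- (Rmult_1_l (Cmod v)) at 2. apply Rmult_le_compat_r; [apply Cmod_ge_0|].
      rewrite <- exp_0. apply exp_le. nra.
  - rewrite Cmult_0_l, !Cplus_0_l, Cexp_0. ring.
Qed.

(** The integrand z^(-s) / (1 - z) has residue -1 at z = 1, and its integral over Re z = c2 is O(1 /
    c2); moving the line far to the right leaves only the residue. *)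
Lemma laplace_integrand_inf (s : R) : 2 <= s -> tends (fun Y => CInt (fun y => Cpow_rhp (half_pt y) (- s) * / (1 - half_pt y))%C (- Y) Y) (RtoC (2 * PI)).
Proof.
  intros Hs e He.
  set (G := fun z => (Cpow_rhp z (- s) * / (1 - z))%C).
  destruct (inv_le_large PI (e / 2) ltac:(generalize PI_RGT_0; lra) ltac:(lra)) as [X [HX HXX]].
  (* PI / c2 <= e / 2 makes the right line negligible, and c2 >= 2 gives |1 - z| >= 1 on it. *)
  set (c2 := X + 2).
  assert (HG : forall U : C -> Prop, (forall z, U z -> 0 < Re z /\ z <> 1%C) -> hol U G).
  { intros U HU. apply hol_mult; [apply hol_Cpow_rhp; intros; now apply HU|]. apply hol_inv.
    - intros z Hz E. apply (proj2 (HU z Hz)). replace z with (1 - (1 - z))%C by ring. rewrite E. ring.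
    - apply hol_minus; [apply hol_const|apply hol_id]. }
  destruct (pole_shift G 1 (-1) (1 / 4) (1 / 2) c2) with (eps := e / 2) as [Y0 HY0]; try lra.
  - simpl; unfold c2; lra.
  - apply HG. intros z [H1 H2]. split; auto; lra.
  - intros eps Heps.
    assert (HC : Ccont (fun z => Cpow_rhp z (- s)) 1).
    { apply (hol_Ccont half_plane); [apply hol_Cpow_rhp; auto|unfold half_plane; simpl; lra]. }
    destruct (proj1 (Ccont_iff _ _) HC eps Heps) as [d [Hd Hw]]. exists d. split; auto. intros z Hz Hzd.
    unfold G. replace ((z - 1) * (Cpow_rhp z (- s) * / (1 - z)) - -1)%C with (- (Cpow_rhp z (- s) - Cpow_rhp 1 (- s)))%C.
    + rewrite Cmod_opp. left. now apply Hw.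
    + assert (E1 : Cpow_rhp 1 (- s) = 1%C).
      { unfold Cpow_rhp, Clog_rhp. rewrite Cmod_1, ln_1. simpl. replace (0 / 1) with 0 by field. rewrite atan_0.
        replace (RtoC (- s) * (0, 0))%C with (RtoC 0) by (unfold RtoC, Cmult; simpl; f_equal; ring). apply Cexp_0. }
      rewrite E1. field. intros E. apply Hz. replace z with (1 - (1 - z))%C by ring. rewrite E. ring.
  - intros eps Heps.
    destruct (inv_le_large (exp (- (s - 2) * ln (1 / 2))) eps ltac:(left; apply exp_pos) Heps) as [Y1 [HY1 HYY]].
    exists (Y1 + 1). intros z Hz Hi. unfold G.
    assert (R2 := Im_le_Cmod (1 - z)%C).
    replace (Im (1 - z)%C) with (- Im z) in R2 by (unfold Im; simpl; ring). rewrite Rabs_Ropp in R2.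
    assert (Hn : (1 - z)%C <> 0%C) by (apply Cmod_gt_0; lra).
    rewrite Cmod_mult, Cmod_inv by auto. rewrite (surj_C z) at 1.
    assert (B := Cmod_Cpow_rhp_neg (Re z) (Im z) s ltac:(lra) Hs).
    eapply Rle_trans; [|apply (HYY (Rabs (Im z))); lra]. apply Rmult_le_compat.
    + apply Cmod_ge_0.
    + left; apply Rinv_0_lt_compat. lra.
    + eapply Rle_trans; [exact B|]. rewrite <- (Rmult_1_r (exp (- (s - 2) * ln (1 / 2)))).
      apply Rmult_le_compat; try (left; apply exp_pos).
      * left; apply Rinv_0_lt_compat. nra.
      * apply exp_le. assert (ln (1 / 2) <= ln (Re z)) by (apply ln_le; lra). nra.
      * rewrite <- Rinv_1. apply Rinv_le_contravar; [lra|]. rewrite <- (pow2_abs (Im z)). nra.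
    + apply Rinv_le_contravar; lra.
  - exists (Rmax Y0 0). intros Y HY. generalize (Rmax_l Y0 0) (Rmax_r Y0 0); intros.
    specialize (HY0 Y ltac:(lra)). fold (half_pt) in HY0.
    assert (B : Cmod (CInt (fun y => G (c2, y)) (- Y) Y) <= e / 2).
    { eapply Rle_trans; [apply (CInt_line_bound _ 1 c2 Y); try (unfold c2; lra)|].
      - apply (Ccont_on_vert (fun z => Re z = c2) G); auto. apply HG. intros z Hz. rewrite Hz. unfold c2. split; [lra|].
        intros E. rewrite E in Hz. simpl in Hz. unfold c2 in Hz. lra.
      - intros y _. unfold G. assert (R1 := re_le_Cmod (1 - (c2, y))%C).
        unfold Re in R1; simpl in R1. rewrite Rabs_left in R1 by (unfold c2; lra).
        assert (R3 : 1 <= Cmod (1 - (c2, y))%C) by (unfold c2 in *; lra).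
        assert (Hn : (1 - (c2, y))%C <> 0%C) by (apply Cmod_gt_0; lra).
        rewrite Cmod_mult, Cmod_inv, Rmult_comm by auto. apply Rmult_le_compat.
        + left; apply Rinv_0_lt_compat; lra.
        + apply Cmod_ge_0.
        + apply Rle_trans with (/ 1); [apply Rinv_le_contravar; lra|lra].
        + eapply Rle_trans; [apply Cmod_Cpow_rhp_neg; unfold c2; lra|].
          rewrite <- (Rmult_1_l (/ _)) at 2. apply Rmult_le_compat_r.
          * left; apply Rinv_0_lt_compat. unfold c2. nra.
          * rewrite <- exp_0. apply exp_le. assert (0 <= ln c2) by (rewrite <- ln_1; apply ln_le; unfold c2; lra). nra.
      - rewrite Rmult_1_l. apply HXX. unfold c2; lra. }
    change (fun y => (Cpow_rhp (half_pt y) (- s) * / (1 - half_pt y))%C) with (fun y => G (1 / 2, y)).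
    set (I2 := CInt (fun y => G (c2, y)) (- Y) Y) in *. set (I1 := CInt (fun y => G (1 / 2, y)) (- Y) Y) in *.
    replace (I1 - RtoC (2 * PI))%C with (- (I2 - I1 - RtoC (2 * PI) * -1) + I2)%C by ring.
    eapply Rle_trans; [apply Cmod_triangle|]. rewrite Cmod_opp. lra.
Qed.

Lemma Rdiff_minus (f g : R -> C) (t : R) (lf lg : C) : Rdiff f t lf -> Rdiff g t lg -> Rdiff (fun s => f s - g s)%C t (lf - lg)%C.
Proof.
  intros [F1 F2] [G1 G2]. split.
  - exact (is_derive_minus (V := R_NormedModule) _ _ _ _ _ F1 G1).
  - exact (is_derive_minus (V := R_NormedModule) _ _ _ _ _ F2 G2).
Qed.

Lemma Rdiff_scal_real (w : C) (g : R -> R) (t l : R) : is_derive g t l -> Rdiff (fun s => w * RtoC (g s))%C t (w * RtoC l)%C.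
Proof.
  intros H. split.
  - apply (is_derive_ext (fun s => Re w * g s)).
    + intros; unfold Re, Cmult, RtoC; simpl; ring.
    + replace (Re (w * RtoC l)) with (Re w * l) by (unfold Re, Cmult, RtoC; simpl; ring). now apply is_derive_scal.
  - apply (is_derive_ext (fun s => Im w * g s)).
    + intros; unfold Im, Cmult, RtoC; simpl; ring.
    + replace (Im (w * RtoC l)) with (Im w * l) by (unfold Im, Cmult, RtoC; simpl; ring). now apply is_derive_scal.
Qed.

Definition gamma_integrand (s t : R) : R := Rpower t (s - 1) * exp (- t).

Lemma gamma_integrand_continuous (s t : R) : 0 < t -> continuous (gamma_integrand s) t.
Proof.
  intros Ht. apply (ex_derive_continuous (V := R_NormedModule)). unfold gamma_integrand, Rpower. auto_derive. auto.
Qed.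

Lemma gamma_integrand_ex (s a b : R) : 0 < a -> a <= b -> ex_RInt (gamma_integrand s) a b.
Proof.
  intros Ha Hab. apply (ex_RInt_continuous (V := R_CompleteNormedModule)).
  rewrite Rmin_left, Rmax_right by auto. intros t Ht. apply gamma_integrand_continuous. lra.
Qed.

Lemma gamma_integrand_derive (s a t : R) : 0 < a -> a <= t -> is_derive (RInt (gamma_integrand s) a) t (gamma_integrand s t).
Proof.
  intros Ha Hat. apply (is_derive_RInt (V := R_NormedModule) (gamma_integrand s) (RInt (gamma_integrand s) a) a t).
  - exists (mkposreal t ltac:(lra)). intros u Hu.
    unfold ball in Hu; simpl in Hu; unfold AbsRing_ball, minus, plus, opp, abs in Hu; simpl in Hu.
    apply Rabs_def2 in Hu. apply (RInt_correct (V := R_CompleteNormedModule)).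
    destruct (Rle_dec a u) as [H|H].
    + apply gamma_integrand_ex; lra.
    + apply ex_RInt_swap. apply gamma_integrand_ex; lra.
  - apply gamma_integrand_continuous; lra.
Qed.

(** As Y -> infinity, l times the truncated Euler integral becomes the increment between a and b of
    the line integral of [laplace_integrand]. This differs from the full value 2 PI by the part
    beyond b, of order e^(-b/2), and the part below a, of order a. *)
Lemma gamma_laplace (s a b : R) (l : C) : 2 <= s -> 0 < a -> a <= b ->
  (forall t Y, 0 < t -> 1 <= Y ->
    Cmod (bromwich s (1 / 2) t Y - RtoC (Rpower t (s - 1)) * l)%C <= 2 * exp (- (s - 2) * ln (1 / 2)) * exp (t / 2) / Y) ->
  Cmod (RtoC (2 * PI) - l * RtoC (RInt (gamma_integrand s) a b))%C <= exp (- (s - 2) * ln (1 / 2)) * (2 * PI) * (2 * exp (- b / 2) + a).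
Proof.
  intros Hs Ha Hab HJ. set (Ks := exp (- (s - 2) * ln (1 / 2))) in *.
  assert (HK : 0 < Ks) by apply exp_pos. assert (HPI := PI_RGT_0).
  assert (HvZ : forall y, (half_pt y - 1)%C <> 0%C).
  { intros y E. apply (one_minus_half_pt_neq_0 y). replace (1 - half_pt y)%C with (- (half_pt y - 1))%C by ring. rewrite E. ring. }
  assert (HvR : forall y, Re (half_pt y - 1)%C = - (1 / 2)) by (intros y; unfold Re, half_pt; simpl; lra).
  set (P := fun Y => CInt (fun y => Cpow_rhp (half_pt y) (- s) * / (1 - half_pt y))%C (- Y) Y).
  assert (HP : tends (fun Y => P Y - l * RtoC (RInt (gamma_integrand s) a b))%C (RtoC (2 * PI) - l * RtoC (RInt (gamma_integrand s) a b))%C).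
  { apply tends_minus; [now apply laplace_integrand_inf|apply tends_const]. }
  assert (HP' : tends (fun Y => (P Y - l * RtoC (RInt (gamma_integrand s) a b)) -
      ((CInt (laplace_integrand s b) (- Y) Y - CInt (laplace_integrand s a) (- Y) Y) - l * RtoC (RInt (gamma_integrand s) a b)))%C
      (RtoC (2 * PI) - l * RtoC (RInt (gamma_integrand s) a b) - 0)%C).
  { apply tends_minus; auto. apply (tends_0_inv _ 1 (4 * Ks)); [lra|]. intros Y HY.
    (* Its T-derivative is e^(-T) times the error bounded in [HJ], hence at most 2 [Ks] e^(-T/2) /
       Y; the comparison function in [M] is the antiderivative of that bound. *)
    set (F := fun T => (CInt (laplace_integrand s T) (- Y) Y - l * RtoC (RInt (gamma_integrand s) a T))%C).
    assert (M := Cmvt F (fun T => RtoC (exp (- T)) * bromwich s (1 / 2) T Y - l * RtoC (gamma_integrand s T))%C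
       (fun T => - (4 * Ks / Y) * exp (- T / 2)) (fun T => 2 * Ks / Y * exp (- T / 2)) a b Hab).
    replace (CInt (laplace_integrand s b) (- Y)%R Y - CInt (laplace_integrand s a) (- Y)%R Y - l * RtoC (RInt (gamma_integrand s) a b))%C with (F b - F a)%C.
    - eapply Rle_trans; [apply M|].
      + intros T HT. apply Rdiff_minus; [apply laplace_integrand_derive; lra|]. apply Rdiff_scal_real. apply gamma_integrand_derive; lra.
      + intros T HT. auto_derive; auto. unfold Rdiv. set (E := exp (- T * / 2)). clearbody Ks E. field. lra.
      + intros T HT. unfold gamma_integrand. rewrite RtoC_mult.
        replace (RtoC (exp (- T)) * bromwich s (1 / 2) T Y - l * (RtoC (Rpower T (s - 1)) * RtoC (exp (- T))))%C with
          (RtoC (exp (- T)) * (bromwich s (1 / 2) T Y - RtoC (Rpower T (s - 1)) * l))%C by ring.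
        rewrite Cmod_mult, Cmod_R, Rabs_right by (left; apply exp_pos).
        specialize (HJ T Y ltac:(lra) HY). apply (Rmult_le_compat_l (exp (- T))) in HJ; [|left; apply exp_pos].
        eapply Rle_trans; [exact HJ|]. apply Req_le.
        replace (- T / 2) with (- T + T / 2) by field. rewrite exp_plus. field. lra.
      + assert (0 < exp (- b / 2)) by apply exp_pos.
        assert (exp (- a / 2) <= 1) by (rewrite <- exp_0; apply exp_le; lra).
        assert (0 < 4 * Ks / Y) by (apply Rdiv_lt_0_compat; lra). nra.
    - unfold F. replace (RInt (gamma_integrand s) a a) with 0 by (rewrite RInt_point; reflexivity). ring. }
  replace (RtoC (2 * PI) - l * RtoC (RInt (gamma_integrand s) a b))%C with
    (RtoC (2 * PI) - l * RtoC (RInt (gamma_integrand s) a b) - 0 - 0)%C by ring.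
  apply (tends_bound _ _ 0 0 _ HP'). intros Y HY.
  assert (C0 : forall (f : C -> C), hol (fun z => Re z = 1 / 2) f -> Ccont_on (fun y => Cpow_rhp (half_pt y) (- s) * f (half_pt y))%C (- Y) Y).
  { intros f Hf. apply (Ccont_on_half_pt (fun z => Cpow_rhp z (- s) * f z)%C). apply hol_mult; auto.
    apply hol_Cpow_rhp. intros z Hz. rewrite Hz. lra. }
  assert (C1 : Ccont_on (fun y => Cpow_rhp (half_pt y) (- s) * / (1 - half_pt y))%C (- Y) Y) by (apply (C0 (fun z => / (1 - z))%C), hol_one_minus).
  assert (B1 : Cmod (P Y - CInt (laplace_integrand s b) (- Y) Y)%C <= Ks * (2 * PI) * (2 * exp (- b / 2))).
  { unfold P. rewrite <- CInt_minus by (auto; apply Ccont_on_laplace_integrand || lra).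
    rewrite (CInt_ext _ (fun y => Cpow_rhp (half_pt y) (- s) * (Cexp (RtoC b * (half_pt y - 1)) * / (1 - half_pt y)))%C) by
      (try lra; intros; unfold laplace_integrand, Cdiv; ring).
    apply (laplace_integrand_line s Y (2 * exp (- b / 2)) (fun y => (Cexp (RtoC b * (half_pt y - 1)) * / (1 - half_pt y)))%C); auto; try lra.
    - assert (0 < exp (- b / 2)) by apply exp_pos. lra.
    - apply (C0 (fun z => Cexp (RtoC b * (z - 1)) * / (1 - z))%C). apply hol_mult; [apply hol_laplace_integrand_exp|apply hol_one_minus].
    - intros y. rewrite Cmod_mult, Cmod_Cexp, Re_RtoC_mult, HvR, Cmod_inv by apply one_minus_half_pt_neq_0.
      replace (b * - (1 / 2)) with (- b / 2) by field. rewrite Rmult_comm.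
      apply Rmult_le_compat_r; [left; apply exp_pos|]. replace 2 with (/ (1 / 2)) by field.
      apply Rinv_le_contravar; [lra|apply one_minus_half_pt]. }
  assert (B2 : Cmod (CInt (laplace_integrand s a) (- Y) Y) <= Ks * (2 * PI) * a).
  { apply (laplace_integrand_line s Y a (fun y => (1 - Cexp (RtoC a * (half_pt y - 1))) / (1 - half_pt y))%C); auto; try lra.
    - apply Ccont_on_laplace_integrand.
    - intros y. replace ((1 - Cexp (RtoC a * (half_pt y - 1))) / (1 - half_pt y))%C with
        (- ((1 - Cexp (RtoC a * (half_pt y - 1))) / (half_pt y - 1)))%C.
      + rewrite Cmod_opp. apply exp_div_le; auto; [|lra]. rewrite HvR; lra.
      + field. split; [apply one_minus_half_pt_neq_0|apply HvZ]. }
  match goal with |- Cmod ?X <= _ => replace X with ((P Y - CInt (laplace_integrand s b) (- Y)%R Y) + CInt (laplace_integrand s a) (- Y)%R Y)%C by ring end.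
  eapply Rle_trans; [apply Cmod_triangle|]. lra.
Qed.

Lemma exp_neg_le (x : R) : 0 < x -> exp (- x) <= / x.
Proof.
  intros Hx. rewrite exp_Ropp. apply Rinv_le_contravar; auto. generalize (exp_ineq1_le x). lra.
Qed.

Lemma Im_RtoC (x : R) : Im (RtoC x) = 0.
Proof. reflexivity. Qed.

(** Letting a -> 0 and b -> infinity in [gamma_laplace] gives l Gamma s = 2 PI. This single identity
    yields the convergence of Euler's integral, Gamma s <> 0 and the value of l. *)
Lemma Gamma_line (s : R) : 2 <= s ->
  Gamma s <> 0 /\ forall c, 0 < c -> tends (bromwich s c 1) (RtoC (2 * PI / Gamma s)).
Proof.
  intros Hs. destruct (bromwich_limit s Hs) as [l [Hl HJ]].
  assert (HL := fun a b Ha Hab => gamma_laplace s a b l Hs Ha Hab HJ).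
  set (K := exp (- (s - 2) * ln (1 / 2)) * (2 * PI)) in *. assert (HPI := PI_RGT_0).
  assert (HK : 0 < K) by (unfold K; apply Rmult_lt_0_compat; [apply exp_pos|lra]).
  assert (Hsmall : forall e, 0 < e -> exists d, 0 < d <= 1 /\ forall a b, 0 < a < d -> / d < b ->
     Cmod (RtoC (2 * PI) - l * RtoC (RInt (gamma_integrand s) a b))%C <= e).
  (* For b > 1/d, e^(-b/2) <= 2/b <= 2 d, so the error 2 e^(-b/2) + a is at most 5 d. *)
  { intros e He. set (d := Rmin 1 (e / (5 * K))). assert (Hd : 0 < d) by (apply Rmin_pos; [lra|apply Rdiv_lt_0_compat; lra]).
    assert (Hd1 : d <= 1) by apply Rmin_l. assert (Hd2 : d <= e / (5 * K)) by apply Rmin_r.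
    exists d. split; [lra|]. intros a b Ha Hb.
    assert (H1d : 1 <= / d) by (rewrite <- Rinv_1 at 1; apply Rinv_le_contravar; lra).
    eapply Rle_trans; [apply HL; lra|].
    assert (E : exp (- b / 2) <= 2 * d).
    { replace (- b / 2) with (- (b / 2)) by field. eapply Rle_trans; [apply exp_neg_le; lra|].
      replace (2 * d) with (/ (/ d / 2)) by (field; lra). apply Rinv_le_contravar; lra. }
    apply Rle_trans with (K * (5 * d)); [apply Rmult_le_compat_l; lra|].
    apply (Rmult_le_compat_l (5 * K)) in Hd2; [|lra].
    replace (5 * K * (e / (5 * K))) with e in Hd2 by (field; lra). lra. }
  assert (Hl0 : l <> 0%C).
  { intros E. destruct (Hsmall 1 ltac:(lra)) as [d [Hd HH]].
    specialize (HH (d / 2) (/ d + 1) ltac:(lra) ltac:(lra)). rewrite E in HH.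
    replace (RtoC (2 * PI) - 0 * RtoC (RInt (gamma_integrand s) (d / 2) (/ d + 1)))%C with (RtoC (2 * PI)) in HH by ring.
    rewrite Cmod_R, Rabs_right in HH by lra. generalize PI2_1. lra. }
  assert (Hlm : 0 < Cmod l) by now apply Cmod_gt_0.
  set (w := (RtoC (2 * PI) / l)%C).
  assert (Hw : forall e, 0 < e -> exists d, 0 < d <= 1 /\ forall a b, 0 < a < d -> / d < b ->
     Cmod (w - RtoC (RInt (gamma_integrand s) a b))%C < e).
  { intros e He. destruct (Hsmall (e / 2 * Cmod l)) as [d [Hd HH]]; [nra|]. exists d. split; auto.
    intros a b Ha Hb. specialize (HH a b Ha Hb).
    replace (RtoC (2 * PI) - l * RtoC (RInt (gamma_integrand s) a b))%C with (l * (w - RtoC (RInt (gamma_integrand s) a b)))%C in HH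
      by (unfold w; field; auto).
    rewrite Cmod_mult, (Rmult_comm (Cmod l)) in HH. apply Rmult_le_reg_r in HH; auto. lra. }
  (* w = 2 PI / l is a limit of real integrals. *)
  assert (HwI : Im w = 0).
  { assert (Rabs (Im w) <= 0).
    { apply le_epsilon. intros e He. destruct (Hw e He) as [d [Hd HH]].
      specialize (HH (d / 2) (/ d + 1) ltac:(lra) ltac:(lra)).
      assert (I := Im_lip w (RtoC (RInt (gamma_integrand s) (d / 2) (/ d + 1)))). rewrite Im_RtoC, Rminus_0_r in I. lra. }
    generalize (Rabs_pos (Im w)). intros. apply Rabs_eq_0. lra. }
  assert (Ew : w = RtoC (Re w)) by (rewrite (surj_C w) at 1; rewrite HwI; reflexivity).
  assert (HG : Gamma s = Re w).
  { unfold Gamma. apply (is_RInt_gen_unique (V := R_CompleteNormedModule)).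
    intros P [e He]. destruct (Hw e (cond_pos e)) as [d [Hd HH]].
    apply (Filter_prod _ _ _ (fun a => 0 < a < d) (fun b => / d < b)).
    - exists (mkposreal d (proj1 Hd)). intros y Hy Hy0.
      unfold ball in Hy; simpl in Hy; unfold AbsRing_ball, minus, plus, opp, abs in Hy; simpl in Hy.
      apply Rabs_def2 in Hy. lra.
    - exists (/ d). auto.
    - intros a b Ha Hb. simpl. exists (RInt (gamma_integrand s) a b). split.
      + assert (1 <= / d) by (rewrite <- Rinv_1 at 1; apply Rinv_le_contravar; lra).
        apply (RInt_correct (V := R_CompleteNormedModule)). apply gamma_integrand_ex; lra.
      + apply He. specialize (HH a b Ha Hb). rewrite Ew, <- RtoC_minus, Cmod_R, Rabs_minus_sym in HH. exact HH. }
  assert (Hw0 : w <> 0%C).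
  { unfold w. intros E. assert (RtoC (2 * PI) = 0%C).
    { replace (RtoC (2 * PI)) with (RtoC (2 * PI) / l * l)%C by (field; auto). rewrite E. ring. }
    apply RtoC_inj in H. lra. }
  assert (HG0 : Gamma s <> 0) by (rewrite HG; intros E; apply Hw0; rewrite Ew, E; reflexivity).
  split; auto. replace (RtoC (2 * PI / Gamma s)) with l; auto.
  rewrite HG, RtoC_div by (rewrite <- HG; auto). rewrite <- Ew. unfold w. field. split; auto.
  intros E. apply RtoC_inj in E. lra.
Qed.

(** The freedom in c is the point: [entire_ml_coef] picks c according to the radius, which makes 1 /
    Gamma decay faster than any geometric sequence. *)
Lemma Gamma_inv_bound (s c : R) : 2 <= s -> 0 < c ->
  Rabs (/ Gamma s) <= exp c * exp (- (s - 2) * ln c) / (2 * c).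
Proof.
  intros Hs Hc. destruct (Gamma_line s Hs) as [HG HT]. assert (HPI := PI_RGT_0).
  assert (B : Cmod (RtoC (2 * PI / Gamma s) - 0)%C <= exp c * exp (- (s - 2) * ln c) * (PI / c)).
  { apply (tends_bound _ _ 0 0 _ (HT c Hc)). intros Y HY. replace (bromwich s c 1 Y - 0)%C with (bromwich s c 1 Y) by ring.
    rewrite <- (Rmult_1_l c) at 2. now apply bromwich_bound. }
  replace (RtoC (2 * PI / Gamma s) - 0)%C with (RtoC (2 * PI / Gamma s)) in B by ring.
  rewrite Cmod_R in B. unfold Rdiv in B at 1. rewrite Rabs_mult, (Rabs_right (2 * PI)) in B by lra.
  apply (Rmult_le_reg_l (2 * PI)); [lra|]. eapply Rle_trans; [exact B|]. apply Req_le. field. lra.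
Qed.

Lemma Cpow_rhp_neg_succ (z : C) (s : R) : 0 < Re z -> Cpow_rhp z (- (s + 1)) = (Cpow_rhp z (- s) * / z)%C.
Proof.
  intros Hz. replace (- (s + 1)) with (- s + - (1)) by ring. rewrite Cpow_rhp_plus. f_equal.
  transitivity (/ Cpow_rhp z 1)%C; [|now rewrite Cpow_rhp_1].
  unfold Cpow_rhp. rewrite <- Cexp_opp. f_equal. rewrite RtoC_opp. ring.
Qed.

Lemma Cdiff_Cpow_rhp (z : C) (s : R) : 0 < Re z -> Cdiff (fun u => Cpow_rhp u s) z (RtoC s * / z * Cpow_rhp z s)%C.
Proof.
  intros Hz. assert (D := Cdiff_mult _ _ z _ _ (Cdiff_const (RtoC s) z) (Cdiff_Clog_rhp z Hz)).
  assert (D2 := Cdiff_comp Cexp _ z _ _ (Cdiff_exp _) D).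
  replace (RtoC s * / z * Cpow_rhp z s)%C with ((0 * Clog_rhp z + RtoC s * / z) * Cexp (RtoC s * Clog_rhp z))%C by (unfold Cpow_rhp; ring).
  exact D2.
Qed.

(** Integration by parts on Re z = 1: e^z z^(-s) has derivative e^z z^(-s) - s e^z z^(-s-1) and
    vanishes at both ends. The relation turns m / Gamma(alpha m + 1) into 1 / (alpha Gamma(alpha
    m)). *)
Lemma Gamma_succ (s : R) : 2 <= s -> Gamma (s + 1) = s * Gamma s.
Proof.
  intros Hs. destruct (Gamma_line s Hs) as [HG HT]. destruct (Gamma_line (s + 1) ltac:(lra)) as [HG1 HT1].
  assert (HPI := PI_RGT_0).
  set (K := exp (1 * 1) * exp (- (s - 2) * ln 1)).
  assert (HK : 0 < K) by (apply Rmult_lt_0_compat; apply exp_pos).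
  set (f := fun z => (Cexp (RtoC 1 * z) * Cpow_rhp z (- s))%C).
  assert (T0 : tends (fun Y => Ci * (bromwich s 1 1 Y - RtoC s * bromwich (s + 1) 1 1 Y))%C 0).
  { apply (tends_0_inv _ 1 (2 * K)); [lra|]. intros Y HY.
    replace (Ci * (bromwich s 1 1 Y - RtoC s * bromwich (s + 1) 1 1 Y))%C with (f (1, Y) - f (1, (- Y)%R))%C.
    - assert (HB : forall y, y ^ 2 = Y ^ 2 -> Cmod (f (1, y)) <= K / Y).
      { intros y Hy. unfold f. eapply Rle_trans; [apply Cmod_bromwich; lra|]. rewrite Hy.
        apply Rmult_le_compat_l; [exact (Rlt_le _ _ HK)|]. apply Rinv_le_contravar; nra. }
      eapply Rle_trans; [apply Cmod_triangle|]. rewrite Cmod_opp.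
      assert (B1 := HB Y eq_refl). assert (B2 := HB (- Y) ltac:(ring)).
      replace (2 * K / Y) with (K / Y + K / Y) by (field; lra). lra.
    - assert (P1 : 0 < 1) by lra.
      unfold bromwich. rewrite <- CInt_scal by (try lra; now apply Ccont_on_bromwich).
      assert (CR : Ccont_on (fun y => RtoC s * (Cexp (RtoC 1 * (1, y)) * Cpow_rhp (1, y) (- (s + 1))))%C (- Y) Y).
      { apply (Ccont_on_vert half_plane (fun z => RtoC s * (Cexp (RtoC 1 * z) * Cpow_rhp z (- (s + 1))))%C).
        - apply hol_mult; [apply hol_const|apply hol_bromwich].
        - intros y _. exact P1. }
      rewrite <- CInt_minus by (try lra; auto; now apply Ccont_on_bromwich).
      assert (CM : Ccont_on (fun y => Cexp (RtoC 1 * (1, y)) * Cpow_rhp (1, y) (- s) - RtoC s * (Cexp (RtoC 1 * (1, y)) * Cpow_rhp (1, y) (- (s + 1))))%C (- Y) Y).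
      { apply (Ccont_on_vert half_plane (fun z => Cexp (RtoC 1 * z) * Cpow_rhp z (- s) - RtoC s * (Cexp (RtoC 1 * z) * Cpow_rhp z (- (s + 1))))%C).
        - apply hol_minus; [apply hol_bromwich|apply hol_mult; [apply hol_const|apply hol_bromwich]].
        - intros y _. exact P1. }
      rewrite <- CInt_scal by (try lra; auto).
      symmetry. apply (CInt_FTC (fun y => f (1, y))); [lra| |].
      + intros y _. assert (Hz : 0 < Re (1, y)) by (simpl; lra).
        assert (D1 := Cdiff_mult _ _ (1, y) _ _ (Cdiff_const (RtoC 1) (1, y)) (Cdiff_id (1, y))).
        assert (D2 := Cdiff_comp Cexp _ _ _ _ (Cdiff_exp _) D1).
        assert (D3 := Cdiff_mult _ _ _ _ _ D2 (Cdiff_Cpow_rhp (1, y) (- s) Hz)).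
        rewrite Cpow_rhp_neg_succ by auto.
        match goal with |- Rdiff _ _ ?X => replace X with
          (((0 * (1, y) + RtoC 1 * 1) * Cexp (RtoC 1 * (1, y)) * Cpow_rhp (1, y) (- s) +
            Cexp (RtoC 1 * (1, y)) * (RtoC (- s) * / (1, y) * Cpow_rhp (1, y) (- s))) * Ci)%C end.
        * apply Cdiff_vert. exact D3.
        * rewrite RtoC_opp. ring.
      + intros y Hy. apply (Ccont_Rcont (fun z => Ci * z)%C); [|apply CM; auto].
        apply Ccont_mult; [apply Ccont_const|]. eapply Cdiff_Ccont, Cdiff_id. }
  assert (T1 : tends (fun Y => Ci * (bromwich s 1 1 Y - RtoC s * bromwich (s + 1) 1 1 Y))%C
     (Ci * (RtoC (2 * PI / Gamma s) - RtoC s * RtoC (2 * PI / Gamma (s + 1))))%C).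
  { apply tends_scal. apply tends_minus; [apply HT; lra|]. apply tends_scal. apply HT1; lra. }
  assert (E := tends_unique _ _ _ T0 T1).
  assert (E2 : RtoC (2 * PI / Gamma s) = RtoC (s * (2 * PI / Gamma (s + 1)))).
  { rewrite RtoC_mult.
    replace (RtoC (2 * PI / Gamma s)) with (- Ci * (Ci * (RtoC (2 * PI / Gamma s) - RtoC s * RtoC (2 * PI / Gamma (s + 1))))
       + RtoC s * RtoC (2 * PI / Gamma (s + 1)))%C.
    - rewrite <- E. ring.
    - assert (CC : (Ci * Ci)%C = RtoC (-1)) by (unfold Ci, Cmult, RtoC; simpl; f_equal; ring).
      replace (- Ci * (Ci * (RtoC (2 * PI / Gamma s) - RtoC s * RtoC (2 * PI / Gamma (s + 1)))))%C with
        (- (Ci * Ci) * (RtoC (2 * PI / Gamma s) - RtoC s * RtoC (2 * PI / Gamma (s + 1))))%C by ring.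
      rewrite CC. replace (RtoC (-1)) with (- RtoC 1)%C by (rewrite <- RtoC_opp; f_equal; ring). ring. }
  apply RtoC_inj in E2.
  apply (Rmult_eq_reg_l (2 * PI)); [|lra].
  apply (f_equal (fun x => x * Gamma s * Gamma (s + 1))) in E2.
  replace (2 * PI / Gamma s * Gamma s * Gamma (s + 1)) with (2 * PI * Gamma (s + 1)) in E2 by (field; auto).
  rewrite E2. field. auto.
Qed.

(** Both terms on the right are non-negative, so either alone is a lower bound: one detects Re v,
    the other Im v. *)
Lemma Cmod_exp_minus_1 (v : C) : Cmod (Cexp v - 1)%C ^ 2 = (exp (Re v) - 1) ^ 2 + 4 * exp (Re v) * sin (Im v / 2) ^ 2.
Proof.
  rewrite Cmod2_alt.
  replace (Re (Cexp v - 1)%C) with (exp (Re v) * cos (Im v) - 1) by (unfold Cexp, Re; simpl; ring).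
  replace (Im (Cexp v - 1)%C) with (exp (Re v) * sin (Im v)) by (unfold Cexp, Im; simpl; ring).
  assert (S := sin2_cos2 (Im v)). unfold Rsqr in S.
  assert (H : cos (Im v) = 1 - 2 * sin (Im v / 2) * sin (Im v / 2)).
  { rewrite <- cos_2a_sin. f_equal. field. }
  replace ((exp (Re v) * cos (Im v) - 1) ^ 2 + (exp (Re v) * sin (Im v)) ^ 2) with
    (exp (Re v) ^ 2 * (sin (Im v) * sin (Im v) + cos (Im v) * cos (Im v)) - 2 * exp (Re v) * cos (Im v) + 1) by ring.
  rewrite S, H. ring.
Qed.

(** Keeps the denominator [1 - w z^(- alpha)] away from 0 on the shifted line. *)
Lemma exp_scal_far (alpha eta : R) : 0 < alpha <= 1 -> 0 < eta -> exists delta, 0 < delta /\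
  forall u : C, Rabs (Im u) < PI -> eta <= Cmod (Cexp (- u) - 1)%C -> delta <= Cmod (Cexp (RtoC alpha * u) - 1)%C.
Proof.
  intros Ha He. assert (HPI := PI_RGT_0). assert (HPI2 := PI2_1).
  (* If |Re u| and |Im u| were both below r, then |e^(-u) - 1|^2 <= 6 r^2 < 9 r^2 <= eta^2. So one
     of them is at least r, and the matching term of [Cmod_exp_minus_1] bounds |e^(alpha u) - 1|
     from below. *)
  set (r := Rmin (1 / 2) (eta / 3)).
  assert (Hr : 0 < r) by (apply Rmin_pos; lra).
  assert (Hr1 : r <= 1 / 2) by apply Rmin_l. assert (Hr2 : r <= eta / 3) by apply Rmin_r.
  assert (Har : 0 < alpha * r <= 1 / 2) by nra.
  assert (D1 : 0 < 1 - exp (- (alpha * r))).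
  { assert (exp (- (alpha * r)) < 1); [|lra]. rewrite <- exp_0. apply exp_increasing. lra. }
  assert (D2 : 0 < sin (alpha * r / 2)) by (apply sin_gt_0; lra).
  exists (Rmin (1 - exp (- (alpha * r))) (sin (alpha * r / 2))). split; [now apply Rmin_pos|].
  intros u Hq Hu. set (X := Cmod (Cexp (RtoC alpha * u) - 1)%C).
  assert (HX : X ^ 2 = _) by apply Cmod_exp_minus_1. assert (HX0 : 0 <= X) by apply Cmod_ge_0.
  rewrite Re_RtoC_mult, Im_RtoC_mult in HX.
  set (p := Re u) in *. set (q := Im u) in *.
  assert (Hep := exp_pos (alpha * p)).
  destruct (Rle_dec r (Rabs p)) as [Hp|Hp].
  - eapply Rle_trans; [apply Rmin_l|].
    assert (HL : (1 - exp (- (alpha * r))) ^ 2 <= (exp (alpha * p) - 1) ^ 2).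
    { unfold Rabs in Hp. destruct (Rcase_abs p).
      - assert (exp (alpha * p) <= exp (- (alpha * r))) by (apply exp_le; nra). nra.
      - assert (exp (alpha * r) <= exp (alpha * p)) by (apply exp_le; nra).
        assert (E : exp (alpha * r) * exp (- (alpha * r)) = 1) by (rewrite <- exp_plus, Rplus_opp_r; apply exp_0).
        assert (1 - exp (- (alpha * r)) <= exp (alpha * r) - 1) by (generalize (exp_pos (- (alpha * r))); intros; nra).
        nra. }
    assert (Hs2 : 0 <= sin (alpha * q / 2) ^ 2) by apply pow2_ge_0.
    assert (0 <= 4 * exp (alpha * p) * sin (alpha * q / 2) ^ 2) by nra.
    apply Rsqr_incr_0_var; auto. unfold Rsqr. nra.
  - apply Rnot_le_lt in Hp. destruct (Rle_dec r (Rabs q)) as [Hqr|Hqr].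
    + eapply Rle_trans; [apply Rmin_r|].
      assert (Hp' := Rabs_def2 _ _ Hp).
      assert (E1 : 1 / 2 <= exp (alpha * p)) by (generalize (exp_ineq1_le (alpha * p)); nra).
      (* |Im u| < PI and alpha <= 1 keep alpha |Im u| / 2 below PI/2, where the sine increases. *)
      assert (S1 : sin (alpha * r / 2) <= sin (alpha * Rabs q / 2)).
      { apply sin_incr_1; nra. }
      assert (S2 : sin (alpha * q / 2) ^ 2 = sin (alpha * Rabs q / 2) ^ 2).
      { unfold Rabs. destruct (Rcase_abs q); auto. replace (alpha * - q / 2) with (- (alpha * q / 2)) by field.
        rewrite sin_neg. ring. }
      rewrite S2 in HX. apply Rsqr_incr_0_var; auto. unfold Rsqr.
      assert (S3 : sin (alpha * r / 2) * sin (alpha * r / 2) <= sin (alpha * Rabs q / 2) ^ 2) by nra.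
      assert (0 <= (exp (alpha * p) - 1) ^ 2) by apply pow2_ge_0. nra.
    + exfalso. apply Rnot_le_lt in Hqr.
      assert (Hv := Cmod_exp_minus_1 (- u)%C).
      replace (Re (- u)%C) with (- p) in Hv by (unfold p, Re; simpl; ring).
      replace (Im (- u)%C) with (- q) in Hv by (unfold q, Im; simpl; ring).
      assert (Hpp : Rabs (- p) <= 1 / 2) by (rewrite Rabs_Ropp; lra).
      assert (Eq := exp_quad (- p) Hpp).
      assert (Hp' := Rabs_def2 _ _ Hp).
      assert (Ea : Rabs (exp (- p) - 1) <= 2 * r).
      { replace (exp (- p) - 1) with ((exp (- p) - 1 - - p) + - p) by ring.
        eapply Rle_trans; [apply Rabs_triang|]. rewrite Rabs_Ropp.
        assert (p ^ 2 = Rabs p * Rabs p) by (rewrite <- (pow2_abs p); ring).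
        replace ((- p) ^ 2) with (p ^ 2) in Eq by ring. generalize (Rabs_pos p); nra. }
      assert (Eb : (exp (- p) - 1) ^ 2 <= 4 * r ^ 2) by (rewrite <- (pow2_abs (exp (- p) - 1)); generalize (Rabs_pos (exp (- p) - 1)); nra).
      assert (Ec : exp (- p) <= 2) by (apply Rabs_le_between in Ea; lra).
      assert (Es : sin (- q / 2) ^ 2 <= r ^ 2 / 4).
      { assert (S := sin_abs_le (- q / 2)). replace (Rabs (- q / 2)) with (Rabs q / 2) in S.
        - rewrite <- (pow2_abs (sin (- q / 2))). generalize (Rabs_pos (sin (- q / 2))); nra.
        - unfold Rdiv. rewrite Rabs_mult, Rabs_Ropp, (Rabs_right (/ 2)); lra. }
      assert (0 <= sin (- q / 2) ^ 2) by apply pow2_ge_0.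
      assert (Cmod (Cexp (- u) - 1)%C ^ 2 <= 6 * r ^ 2) by (rewrite Hv; generalize (exp_pos (- p)); nra).
      assert (eta ^ 2 <= Cmod (Cexp (- u) - 1)%C ^ 2) by nra. nra.
Qed.

(** The residue N(mu) / D'(mu) at a simple zero of D, in the form that [pole_shift] consumes: D(z) =
    r (z - mu) with r close to d. *)
Lemma simple_pole (N D : C -> C) (mu d : C) : Ccont N mu -> D mu = 0%C -> Cdiff D mu d -> d <> 0%C ->
  forall eps, 0 < eps -> exists eta, 0 < eta /\ forall z, z <> mu -> Cmod (z - mu)%C < eta ->
   Cmod ((z - mu) * (N z / D z) - N mu / d)%C <= eps.
Proof.
  intros HN HD0 HD Hd eps Heps.
  assert (Pd : 0 < Cmod d) by now apply Cmod_gt_0.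
  assert (PN := Cmod_ge_0 (N mu)).
  set (e2 := eps * Cmod d / 4). assert (He2 : 0 < e2) by (unfold e2; nra).
  (* The first bound keeps |r| >= |d| / 2 for the difference quotient r of D; the second makes
     |N(mu)| |r - d| at most eps |d|^2 / 4. *)
  set (e1 := Rmin (Cmod d / 2) (eps * Cmod d ^ 2 / (4 * (Cmod (N mu) + 1)))).
  assert (He1 : 0 < e1).
  { apply Rmin_pos; [lra|]. apply Rdiv_lt_0_compat; [|lra]. apply Rmult_lt_0_compat; auto. nra. }
  assert (H11 : e1 <= Cmod d / 2) by apply Rmin_l.
  assert (H12 : Cmod (N mu) * e1 <= eps * Cmod d ^ 2 / 4).
  { assert (Q : e1 <= eps * Cmod d ^ 2 / (4 * (Cmod (N mu) + 1))) by apply Rmin_r.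
    apply (Rmult_le_compat_l (Cmod (N mu) + 1)) in Q; [|lra].
    replace ((Cmod (N mu) + 1) * (eps * Cmod d ^ 2 / (4 * (Cmod (N mu) + 1)))) with (eps * Cmod d ^ 2 / 4) in Q by (field; lra).
    nra. }
  destruct (proj1 (Ccont_iff _ _) HN e2 He2) as [t1 [Ht1 K1]].
  destruct (proj1 (Cdiff_iff _ _ _) HD e1 He1) as [t2 [Ht2 K2]].
  exists (Rmin t1 t2). split; [now apply Rmin_pos|]. intros z Hz Hzt.
  assert (Z1 : Cmod (z - mu)%C < t1) by (eapply Rlt_le_trans; [exact Hzt|apply Rmin_l]).
  assert (Z2 : Cmod (z - mu)%C < t2) by (eapply Rlt_le_trans; [exact Hzt|apply Rmin_r]).
  assert (Hn : (z - mu)%C <> 0%C).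
  { intros E. apply Hz. replace z with (z - mu + mu)%C by ring. rewrite E. ring. }
  assert (Pn : 0 < Cmod (z - mu)%C) by now apply Cmod_gt_0.
  assert (Q1 := K1 z Z1). assert (Q2 := K2 _ Z2).
  replace (mu + (z - mu))%C with z in Q2 by ring. rewrite HD0 in Q2.
  set (r := (D z / (z - mu))%C).
  assert (ED : D z = (r * (z - mu))%C) by (unfold r; field; auto).
  assert (Hr : Cmod (r - d)%C <= e1).
  { rewrite ED in Q2. replace (r * (z - mu) - 0 - d * (z - mu))%C with ((r - d) * (z - mu))%C in Q2 by ring.
    rewrite Cmod_mult in Q2. now apply Rmult_le_reg_r in Q2. }
  assert (Hr2 : Cmod d / 2 <= Cmod r).
  { assert (T := Cmod_triangle r (- (r - d))). rewrite Cmod_opp in T. replace (r + - (r - d))%C with d in T by ring. lra. }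
  assert (Hr0 : r <> 0%C) by (apply Cmod_gt_0; lra).
  rewrite ED. replace ((z - mu) * (N z / (r * (z - mu))) - N mu / d)%C with
    (((N z - N mu) * d + N mu * - (r - d)) / (r * d))%C by (field; auto).
  rewrite Cmod_div, Cmod_mult by (now apply Cmult_neq_0).
  apply (Rmult_le_reg_r (Cmod r * Cmod d)); [apply Rmult_lt_0_compat; lra|].
  unfold Rdiv. rewrite Rmult_assoc, Rinv_l, Rmult_1_r by (apply Rgt_not_eq; apply Rmult_lt_0_compat; lra).
  eapply Rle_trans; [apply Cmod_triangle|]. rewrite !Cmod_mult, Cmod_opp.
  assert (U1 : Cmod (N z - N mu)%C * Cmod d <= e2 * Cmod d) by (apply Rmult_le_compat_r; lra).
  assert (U2 : Cmod (N mu) * Cmod (r - d)%C <= Cmod (N mu) * e1) by (apply Rmult_le_compat_l; lra).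
  assert (U3 : eps * (Cmod d / 2 * Cmod d) <= eps * (Cmod r * Cmod d)) by (apply Rmult_le_compat_l; [lra|]; apply Rmult_le_compat_r; lra).
  unfold e2 in U1. nra.
Qed.

(** * Exponential asymptotics of Mittag-Leffler sums *)

(** Sums over the indices below n, whereas [sum_n] includes n; hence the [S n] wherever the two are
    compared. *)
Fixpoint Csum (f : nat -> C) (n : nat) : C :=
  match n with O => 0%C | S n => (Csum f n + f n)%C end.

Lemma Csum_mult (w : C) (f : nat -> C) (n : nat) : (w * Csum f n)%C = Csum (fun m => w * f m)%C n.
Proof. induction n as [|n IH]; simpl; [ring|]. rewrite <- IH. ring. Qed.

Lemma Csum_ext (f g : nat -> C) (n : nat) : (forall m, f m = g m) -> Csum f n = Csum g n.
Proof. intros H. induction n as [|n IH]; simpl; auto. now rewrite IH, H. Qed.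

Lemma tends_Csum (F : nat -> R -> C) (l : nat -> C) (n : nat) : (forall m, tends (F m) (l m)) ->
  tends (fun Y => Csum (fun m => F m Y) n) (Csum l n).
Proof.
  intros H. induction n as [|n IH]; simpl; [apply tends_const|]. now apply tends_plus.
Qed.

Lemma CInt_Csum (f : nat -> C -> C) (c Y : R) (n : nat) : 0 <= Y -> (forall m, hol (fun z => Re z = c) (f m)) ->
  hol (fun z => Re z = c) (fun z => Csum (fun m => f m z) n) /\
  CInt (fun y => Csum (fun m => f m (c, y)) n) (- Y) Y = Csum (fun m => CInt (fun y => f m (c, y)) (- Y) Y) n.
Proof.
  intros HY Hf. induction n as [|n [IH1 IH2]]; simpl.
  - split; [apply hol_const|]. unfold CInt; simpl. rewrite !RInt_const.
    unfold scal; simpl; unfold mult; simpl. rewrite !Rmult_0_r. reflexivity.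
  - split; [now apply hol_plus|]. rewrite <- IH2. apply CInt_plus; [lra| |].
    + apply (Ccont_on_vert (fun z => Re z = c) (fun z => Csum (fun m => f m z) n)); auto.
    + apply (Ccont_on_vert (fun z => Re z = c) (f n)); auto.
Qed.

Lemma Csum_geom (q : C) (n : nat) : ((1 - q) * Csum (Cpow q) n)%C = (1 - Cpow q n)%C.
Proof.
  induction n as [|n IH]; simpl; [ring|]. rewrite Cmult_plus_distr_l, IH. ring.
Qed.

Lemma Cpow_Cexp (v : C) (n : nat) : Cpow (Cexp v) n = Cexp (RtoC (INR n) * v).
Proof.
  induction n as [|n IH].
  - simpl. rewrite Cmult_0_l. symmetry. apply Cexp_0.
  - change (Cpow (Cexp v) (S n)) with (Cexp v * Cpow (Cexp v) n)%C.
    rewrite IH, <- Cexp_plus, S_INR, RtoC_plus. f_equal. ring.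
Qed.

Lemma Cmod_pos_half (q : C) : Cmod q <= 1 / 2 -> 1 / 2 <= Cmod (1 - q)%C.
Proof.
  intros H. assert (T := Cmod_triangle (1 - q) q). replace (1 - q + q)%C with (RtoC 1) in T by ring.
  rewrite Cmod_1 in T. lra.
Qed.

(** In terms of mu = [Cexp Lmu], the argument of the series is w = mu^alpha; the limit is mu^(1 - beta) e^mu / alpha. *)
Lemma ML_tail (alpha B beta : R) (N : nat) : 0 < alpha <= 1 -> 0 < B -> 2 <= alpha * INR N + beta ->
  exists C0, 0 <= C0 /\ forall Lmu : C, Rabs (Im Lmu) < PI / 2 -> Cmod (Cexp Lmu) <= B * Re (Cexp Lmu) ->
  exists K, 0 <= K /\ forall M : nat,
   Cmod (Csum (fun m => Cpow (Cexp (RtoC alpha * Lmu)) (N + m) / RtoC (Gamma (alpha * INR (N + m) + beta)))%C M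
     - Cexp (Cexp Lmu) * Cexp (RtoC (1 - beta) * Lmu) / RtoC alpha)%C
   <= C0 * (exp (Re (Cexp Lmu) / 2) * exp ((1 - beta) * ln (Re (Cexp Lmu)))) + K * (1 / 2) ^ M.
Proof.
  intros Ha HB Hs. assert (HPI := PI_RGT_0). set (sg := alpha * INR N + beta) in *.
  (* With a = Re mu, the line Re z = a/2 satisfies |z - mu| / |mu| >= (a/2) / (B a) = 1 / (2 B). *)
  destruct (exp_scal_far alpha (1 / (2 * B)) Ha) as [delta [Hdelta Hfar]].
  { apply Rdiv_lt_0_compat; lra. }
  (* B^(alpha N) replaces |w|^N = |mu|^(alpha N) by a power of a, 2^(sg - 2) comes from evaluating
     at a/2, and [delta] bounds the denominator from below. *)
  set (C0 := exp (alpha * INR N * ln B) * exp ((sg - 2) * ln 2) / delta).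
  assert (HC0 : 0 < C0).
  { apply Rdiv_lt_0_compat; auto. apply Rmult_lt_0_compat; apply exp_pos. }
  exists C0. split; [lra|]. intros Lmu HL Hmu. apply Rabs_def2 in HL.
  set (mu := Cexp Lmu) in *. set (a := Re mu) in *.
  assert (Hmod : Cmod mu = exp (Re Lmu)) by apply Cmod_Cexp.
  assert (Pmod : 0 < Cmod mu) by (rewrite Hmod; apply exp_pos).
  assert (Pa : 0 < a).
  { unfold a, mu, Cexp, Re at 1; simpl. apply Rmult_lt_0_compat; [apply exp_pos|]. apply cos_gt_0; lra. }
  assert (Hamod : a <= Cmod mu) by (eapply Rle_trans; [apply Rle_abs|apply re_le_Cmod]).
  assert (HLg : Clog_rhp mu = Lmu) by (apply Clog_rhp_Cexp; apply Rabs_def1; lra).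
  assert (Hmu0 : mu <> 0%C) by now apply Cmod_gt_0.
  assert (Hal0 : RtoC alpha <> 0%C) by (intros E; apply RtoC_inj in E; lra).
  set (w := Cexp (RtoC alpha * Lmu)).
  assert (Hw : forall n, Cpow w n = Cexp (RtoC (alpha * INR n) * Lmu)).
  { intros n. unfold w. rewrite Cpow_Cexp, RtoC_mult. f_equal. ring. }
  assert (Hwmod : forall n, Cmod (Cpow w n) = exp (alpha * INR n * ln (Cmod mu))).
  { intros n. rewrite Hw, Cmod_Cexp, Re_RtoC_mult, Hmod, ln_exp. reflexivity. }
  (* The ratio of the geometric series under the integral; in the half-plane it takes the value 1
     only at z = mu. *)
  set (q := fun z => (w * Cpow_rhp z (- alpha))%C).
  set (D := fun z => (1 - q z)%C).
  assert (Hq : forall z, q z = Cexp (RtoC alpha * (Lmu - Clog_rhp z))).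
  { intros z. unfold q, w, Cpow_rhp. rewrite <- Cexp_plus, RtoC_opp. f_equal. ring. }
  (* Both logarithms have imaginary part in (-PI/2, PI/2), so the difference meets the condition of
     [exp_scal_far]. *)
  assert (Him : forall z, 0 < Re z -> Rabs (Im (Lmu - Clog_rhp z)%C) < PI).
  { intros z Hz. replace (Im (Lmu - Clog_rhp z)%C) with (Im Lmu - atan (Im z / Re z)) by reflexivity.
    assert (H := atan_bound (Im z / Re z)). apply Rabs_def1; lra. }
  assert (Hexpm : forall z, 0 < Re z -> (Cexp (- (Lmu - Clog_rhp z)) - 1)%C = ((z - mu) / mu)%C).
  { intros z Hz. replace (- (Lmu - Clog_rhp z))%C with (Clog_rhp z + - Lmu)%C by ring.
    rewrite Cexp_plus, Cexp_Clog_rhp, Cexp_opp by auto. fold mu. field. auto. }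
  (* A qualitative use of [exp_scal_far], with |z - mu| / |mu| itself as the distance. *)
  assert (HD0 : forall z, 0 < Re z -> z <> mu -> D z <> 0%C).
  { intros z Hz Hzm E.
    assert (P : 0 < Cmod ((z - mu) / mu)%C).
    { apply Cmod_gt_0. intros E2. apply Hzm. replace z with ((z - mu) / mu * mu + mu)%C by (field; auto). rewrite E2. ring. }
    destruct (exp_scal_far alpha _ Ha P) as [d [Hd Hf]].
    specialize (Hf (Lmu - Clog_rhp z)%C (Him z Hz)). rewrite Hexpm in Hf by auto. specialize (Hf (Rle_refl _)).
    rewrite <- Hq in Hf. replace (q z - 1)%C with (- D z)%C in Hf by (unfold D; ring).
    rewrite Cmod_opp, E, Cmod_0 in Hf. lra. }
  set (num := fun z => (Cexp (RtoC 1 * z) * Cpow_rhp z (- sg) * Cpow w N)%C).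
  set (G := fun z => (num z / D z)%C).
  assert (Hnum : hol half_plane num) by (apply hol_mult; [apply hol_bromwich|apply hol_const]).
  assert (HqH : hol half_plane q) by (apply hol_mult; [apply hol_const|apply hol_Cpow_rhp; auto]).
  assert (HDH : hol half_plane D) by (apply hol_minus; [apply hol_const|auto]).
  assert (HGU : forall U : C -> Prop, (forall z, U z -> 0 < Re z /\ z <> mu) -> hol U G).
  { intros U HU. apply hol_div.
    - intros z Hz. destruct (HU z Hz). now apply HD0.
    - apply (hol_sub half_plane); auto. intros z Hz. apply HU, Hz.
    - apply (hol_sub half_plane); auto. intros z Hz. apply HU, Hz. }
  set (A := (Cexp mu * Cexp (RtoC (1 - beta) * Lmu) / RtoC alpha)%C).
  (* c = 2^(1/alpha) |mu|, so |q(z)| = (|mu| / |z|)^alpha <= 1/2 as soon as |z| >= c. *)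
  set (c := exp (ln 2 / alpha) * Cmod mu).
  assert (Hc1 : 1 < exp (ln 2 / alpha)).
  { rewrite <- exp_0. apply exp_increasing. apply Rdiv_lt_0_compat; [|lra]. rewrite <- ln_1. apply ln_increasing; lra. }
  assert (Hca : a < c) by (unfold c; nra). assert (Pc : 0 < c) by lra.
  assert (Hqs : forall z, c <= Cmod z -> Cmod (q z) <= 1 / 2).
  { intros z Hz. unfold q. rewrite Cmod_mult, Cmod_Cpow_rhp.
    replace w with (Cpow w 1) by (simpl; ring). rewrite Hwmod, <- exp_plus. simpl INR.
    assert (Q : ln c <= ln (Cmod z)) by (apply ln_le; lra).
    unfold c in Q. rewrite ln_mult, ln_exp in Q by (auto; apply exp_pos).
    replace (1 / 2) with (exp (- ln 2)) by (rewrite exp_Ropp, exp_ln; lra).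
    apply exp_le.
    apply (Rmult_le_compat_l alpha) in Q; [|lra]. rewrite Rmult_plus_distr_l in Q.
    replace (alpha * (ln 2 / alpha)) with (ln 2) in Q by (field; lra). lra. }
  assert (Hnumb : forall x y, a / 2 <= x <= c ->
     Cmod (num (x, y)) <= exp x * exp (- (sg - 2) * ln x) * Cmod (Cpow w N) * / (x ^ 2 + y ^ 2)).
  { intros x y Hx. unfold num. rewrite Cmod_mult.
    assert (H := Cmod_bromwich sg 1 x y ltac:(lra) Hs). rewrite Rmult_1_l in H.
    apply (Rmult_le_compat_r (Cmod (Cpow w N))) in H; [|apply Cmod_ge_0].
    eapply Rle_trans; [exact H|]. apply Req_le. ring. }
  (* The pole at mu is the only singularity between the two lines. *)
  assert (Hshift := pole_shift G mu A (a / 4) (a / 2) c).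
  assert (SH : forall e, 0 < e -> exists Y0, forall Y, Y0 <= Y ->
     Cmod (CInt (fun y => G (c, y)) (- Y) Y - CInt (fun y => G ((a / 2)%R, y)) (- Y) Y - RtoC (2 * PI) * A)%C <= e).
  { apply Hshift; clear Hshift.
    - lra.
    - fold a; lra.
    - apply HGU. intros z [Hz1 Hz2]. split; auto. lra.
    - assert (HNc : Ccont num mu) by (apply (hol_Ccont half_plane); auto).
      assert (EqM : q mu = 1%C).
      { rewrite Hq, HLg. replace (RtoC alpha * (Lmu - Lmu))%C with (RtoC 0) by ring. apply Cexp_0. }
      assert (HDm : D mu = 0%C) by (unfold D; rewrite EqM; ring).
      assert (Cdq : Cdiff D mu (RtoC alpha / mu)%C).
      { assert (D1 := Cdiff_mult _ _ mu _ _ (Cdiff_const w mu) (Cdiff_Cpow_rhp mu (- alpha) Pa)).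
        assert (D2 := Cdiff_plus _ _ mu _ _ (Cdiff_const 1 mu) (Cdiff_mult _ _ mu _ _ (Cdiff_const (-1)%C mu) D1)).
        eapply Cdiff_ext; [|replace (RtoC alpha / mu)%C with
          (0 + (0 * (w * Cpow_rhp mu (- alpha)) + -1 * (0 * Cpow_rhp mu (- alpha) + w * (RtoC (- alpha) * / mu * Cpow_rhp mu (- alpha)))))%C; [exact D2|]].
        - intros z. simpl. unfold D, q. ring.
        - unfold q in EqM. transitivity (RtoC alpha * / mu * (w * Cpow_rhp mu (- alpha)))%C; [rewrite RtoC_opp; ring|].
          rewrite EqM. unfold Cdiv. ring. }
      (* w^N = mu^(alpha N) gives num(mu) = e^mu mu^(-beta), and D'(mu) = alpha / mu. *)
      assert (EA : A = (num mu / (RtoC alpha / mu))%C).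
      { unfold A, num. rewrite Hw. unfold Cpow_rhp. rewrite HLg, Cmult_1_l.
        replace (Cexp (RtoC (1 - beta) * Lmu)) with (Cexp (RtoC (- sg) * Lmu) * Cexp (RtoC (alpha * INR N) * Lmu) * mu)%C.
        - field. split; auto.
        - unfold mu. rewrite <- !Cexp_plus. f_equal. unfold sg.
          replace (1 - beta) with (- (alpha * INR N + beta) + alpha * INR N + 1) by ring. rewrite !RtoC_plus. ring. }
      rewrite EA. apply (simple_pole num D mu (RtoC alpha / mu)%C); auto.
      apply Cmod_gt_0. rewrite Cmod_div by auto. apply Rdiv_lt_0_compat; auto. now apply Cmod_gt_0.
    - intros e He.
      set (K := exp c * exp (- (sg - 2) * ln (a / 2)) * Cmod (Cpow w N) * 2).
      assert (HK : 0 <= K).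
      { unfold K. repeat apply Rmult_le_pos; try (left; apply exp_pos); [apply Cmod_ge_0|lra]. }
      destruct (inv_le_large K e HK He) as [Y0 [HY0 HYY]].
      exists (Y0 + 1 + c). intros z Hz Hi. rewrite (surj_C z).
      assert (Hzc : c <= Cmod z) by (generalize (Im_le_Cmod z); lra).
      assert (Q := Cmod_pos_half _ (Hqs z Hzc)).
      assert (Dn : D z <> 0%C) by (apply Cmod_gt_0; unfold D; lra).
      rewrite <- (surj_C z). unfold G. rewrite Cmod_div by auto.
      eapply Rle_trans; [|apply (HYY (Rabs (Im z))); lra].
      replace (K / Rabs (Im z)) with (exp c * exp (- (sg - 2) * ln (a / 2)) * Cmod (Cpow w N) * / Rabs (Im z) * / (1 / 2)) by
        (unfold K; field; lra).
      assert (HI2 : Rabs (Im z) <= Re z ^ 2 + Im z ^ 2) by (rewrite <- (pow2_abs (Im z)); nra).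
      apply Rmult_le_compat.
      + apply Cmod_ge_0.
      + left; apply Rinv_0_lt_compat; unfold D; lra.
      + rewrite (surj_C z) at 1. eapply Rle_trans; [now apply Hnumb|].
        apply Rmult_le_compat.
        * repeat apply Rmult_le_pos; try (left; apply exp_pos). apply Cmod_ge_0.
        * left; apply Rinv_0_lt_compat; lra.
        * apply Rmult_le_compat_r; [apply Cmod_ge_0|].
          apply Rmult_le_compat; try (left; apply exp_pos); apply exp_le; [lra|].
          assert (ln (a / 2) <= ln (Re z)) by (apply ln_le; lra). nra.
        * apply Rinv_le_contravar; lra.
      + apply Rinv_le_contravar; [lra|]. exact Q. }
  (* On the left line the denominator is bounded away from 0. *)
  assert (HLft : forall Y, 0 <= Y -> Cmod (CInt (fun y => G ((a / 2)%R, y)) (- Y) Y) <=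
     2 * PI * (C0 * (exp (a / 2) * exp ((1 - beta) * ln a)))).
  { intros Y HY.
    eapply Rle_trans; [apply (CInt_line_bound _ (exp (a / 2) * exp (- (sg - 2) * ln (a / 2)) * Cmod (Cpow w N) * / delta) (a / 2) Y); try lra|].
    - repeat apply Rmult_le_pos; try (left; apply exp_pos); [apply Cmod_ge_0|left; now apply Rinv_0_lt_compat].
    - apply (Ccont_on_vert (fun z => Re z = a / 2) G); auto. apply HGU. intros z Hz. split; [lra|].
      intros E. rewrite E in Hz. fold a in Hz. lra.
    - intros y _.
      assert (Hz : 0 < Re ((a / 2)%R, y)) by (simpl; lra).
      assert (Hd : delta <= Cmod (D ((a / 2)%R, y))).
      { unfold D. replace (1 - q ((a / 2)%R, y))%C with (- (q ((a / 2)%R, y) - 1))%C by ring.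
        rewrite Cmod_opp, Hq. apply Hfar; [now apply Him|]. rewrite Hexpm by auto. rewrite Cmod_div by auto.
        assert (R1 := re_le_Cmod (((a / 2)%R, y) - mu)%C).
        replace (Re (((a / 2)%R, y) - mu)%C) with (- (a / 2)) in R1 by (unfold a, Re; simpl; field).
        rewrite Rabs_Ropp, Rabs_right in R1 by lra.
        apply (Rmult_le_reg_r (Cmod mu)); auto. unfold Rdiv at 2. rewrite Rmult_assoc, Rinv_l, Rmult_1_r by lra.
        eapply Rle_trans; [|exact R1].
        apply Rle_trans with (1 / (2 * B) * (B * a)).
        - apply Rmult_le_compat_l; auto. left; apply Rdiv_lt_0_compat; lra.
        - apply Req_le. field. lra. }
      assert (Dn : D ((a / 2)%R, y) <> 0%C) by (apply Cmod_gt_0; lra).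
      unfold G. rewrite Cmod_div by auto.
      assert (H := Hnumb (a / 2) y ltac:(lra)).
      replace (exp (a / 2) * exp (- (sg - 2) * ln (a / 2)) * Cmod (Cpow w N) * / delta * / ((a / 2) ^ 2 + y ^ 2)) with
        (exp (a / 2) * exp (- (sg - 2) * ln (a / 2)) * Cmod (Cpow w N) * / ((a / 2) ^ 2 + y ^ 2) * / delta) by ring.
      apply Rmult_le_compat; auto; [apply Cmod_ge_0|left; apply Rinv_0_lt_compat; lra|].
      apply Rinv_le_contravar; lra.
    - rewrite Hwmod.
      assert (L1 : exp (alpha * INR N * ln (Cmod mu)) <= exp (alpha * INR N * ln B) * exp (alpha * INR N * ln a)).
      { rewrite <- exp_plus. apply exp_le. rewrite <- Rmult_plus_distr_l, <- ln_mult by lra.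
        apply Rmult_le_compat_l; [apply Rmult_le_pos; [lra|apply pos_INR]|]. now apply ln_le. }
      assert (La : ln (a / 2) = ln a - ln 2) by (apply ln_div; lra).
      assert (Ea : / a = exp (- ln a)) by (rewrite exp_Ropp, exp_ln; auto).
      apply Rle_trans with (exp (a / 2) * exp (- (sg - 2) * ln (a / 2)) *
         (exp (alpha * INR N * ln B) * exp (alpha * INR N * ln a)) * / delta * (PI / (a / 2))).
      + repeat apply Rmult_le_compat_r.
        * left; apply Rdiv_lt_0_compat; lra.
        * left; now apply Rinv_0_lt_compat.
        * apply Rmult_le_compat_l; auto. apply Rmult_le_pos; left; apply exp_pos.
      (* The exponents of a add up to -(sg - 2) + alpha N - 1 = 1 - beta. *)
      + apply Req_le. replace (PI / (a / 2)) with (2 * PI * / a) by (field; lra). rewrite Ea, La.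
        unfold C0.
        replace (exp ((1 - beta) * ln a)) with (exp (- (sg - 2) * (ln a)) * exp (alpha * INR N * ln a) * exp (- ln a)).
        * replace (exp (- (sg - 2) * (ln a - ln 2))) with (exp (- (sg - 2) * ln a) * exp ((sg - 2) * ln 2)).
          -- field. lra.
          -- rewrite <- exp_plus. f_equal. ring.
        * rewrite <- !exp_plus. f_equal. unfold sg. ring. }
  (* On the right line the geometric series converges. *)
  set (K0 := exp c * exp (- (sg - 2) * ln c) * Cmod (Cpow w N) * 2).
  assert (HK0 : 0 <= K0).
  { unfold K0. repeat apply Rmult_le_pos; try (left; apply exp_pos); [apply Cmod_ge_0|lra]. }
  exists (K0 * (PI / c) / (2 * PI)). split.
  { apply Rmult_le_pos; [apply Rmult_le_pos; auto; left; apply Rdiv_lt_0_compat; lra|left; apply Rinv_0_lt_compat; lra]. }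
  intros M.
  set (sm := fun m => alpha * INR (N + m) + beta).
  assert (Hsm : forall m, 2 <= sm m).
  { intros m. unfold sm. rewrite plus_INR. unfold sg in Hs. assert (0 <= alpha * INR m) by (apply Rmult_le_pos; [lra|apply pos_INR]). lra. }
  set (f := fun m z => (Cpow w (N + m) * (Cexp (RtoC 1 * z) * Cpow_rhp z (- sm m)))%C).
  assert (Hf : forall m, hol (fun z => Re z = c) (f m)).
  { intros m. apply hol_mult; [apply hol_const|]. apply (hol_sub half_plane); [|apply hol_bromwich].
    intros z Hz. unfold half_plane. lra. }
  assert (Hz0 : forall z, Re z = c -> 0 < Re z /\ z <> mu).
  { intros z Hz. split; [lra|]. intros E. rewrite E in Hz. fold a in Hz. lra. }
  assert (Hcz : forall y, c <= Cmod (c, y)).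
  { intros y. eapply Rle_trans; [apply Rle_abs|]. apply (re_le_Cmod (c, y)). }
  assert (Fsum : forall y, Csum (fun m => f m (c, y)) M = (G (c, y) - G (c, y) * Cpow (q (c, y)) M)%C).
  { intros y. set (z := (c, y)).
    assert (Dn : D z <> 0%C) by (apply HD0; apply Hz0; reflexivity).
    assert (E1 : Csum (fun m => f m z) M = (num z * Csum (Cpow (q z)) M)%C).
    { rewrite Csum_mult. apply Csum_ext. intros m. unfold f, num.
      rewrite Cpow_add_r. rewrite Hq, Cpow_Cexp.
      replace (Cpow_rhp z (- sm m)) with (Cpow_rhp z (- sg) * Cpow_rhp z (- (alpha * INR m)))%C.
      - replace (Cexp (RtoC (INR m) * (RtoC alpha * (Lmu - Clog_rhp z)))) with (Cpow w m * Cpow_rhp z (- (alpha * INR m)))%C.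
        + ring.
        + rewrite Hw. unfold Cpow_rhp. rewrite <- Cexp_plus. f_equal. rewrite RtoC_opp, !RtoC_mult. ring.
      - rewrite <- Cpow_rhp_plus. f_equal. unfold sm, sg. rewrite plus_INR. ring. }
    rewrite E1. assert (E2 := Csum_geom (q z) M). fold (D z) in E2.
    replace (Csum (Cpow (q z)) M) with (D z * Csum (Cpow (q z)) M / D z)%C by (field; auto).
    rewrite E2. unfold G. field. auto. }
  assert (HCG : forall Y, Ccont_on (fun y => G (c, y)) (- Y) Y).
  { intros Y. apply (Ccont_on_vert (fun z => Re z = c) G); auto. }
  assert (HCq : forall Y, Ccont_on (fun y => G (c, y) * Cpow (q (c, y)) M)%C (- Y) Y).
  { intros Y. apply (Ccont_on_vert (fun z => Re z = c) (fun z => G z * Cpow (q z) M)%C); auto.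
    apply hol_mult; auto. clear - HqH Pc. induction M as [|M IH]; simpl; [apply hol_const|].
    apply hol_mult; auto. apply (hol_sub half_plane); auto. intros z Hz. unfold half_plane. lra. }
  (* The integrated remainder of the geometric series after M terms, of size 2^(-M); it is unrelated
     to the Bessel factor defined later. *)
  assert (bessel_factor : forall Y, 0 <= Y -> Cmod (CInt (fun y => G (c, y) * Cpow (q (c, y)) M)%C (- Y) Y) <= K0 * (1 / 2) ^ M * (PI / c)).
  { intros Y HY. apply CInt_line_bound; auto.
    - apply Rmult_le_pos; auto. apply pow_le. lra.
    - intros y _. assert (Q := Cmod_pos_half _ (Hqs _ (Hcz y))).
      assert (Dn : D (c, y) <> 0%C) by (apply HD0; apply Hz0; reflexivity).
      rewrite Cmod_mult, Cmod_pow. unfold G. rewrite Cmod_div by auto.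
      replace (K0 * (1 / 2) ^ M * / (c ^ 2 + y ^ 2)) with
        ((exp c * exp (- (sg - 2) * ln c) * Cmod (Cpow w N) * / (c ^ 2 + y ^ 2) * / (1 / 2)) * (1 / 2) ^ M) by (unfold K0; field; nra).
      apply Rmult_le_compat.
      + apply Rmult_le_pos; [apply Cmod_ge_0|]. left; apply Rinv_0_lt_compat. unfold D; lra.
      + apply pow_le, Cmod_ge_0.
      + apply Rmult_le_compat; [apply Cmod_ge_0| |apply Hnumb; lra|].
        * left; apply Rinv_0_lt_compat. unfold D; lra.
        * apply Rinv_le_contravar; [lra|exact Q].
      + apply pow_incr. split; [apply Cmod_ge_0|]. now apply Hqs. }
  assert (T : tends (fun Y => Csum (fun m => Cpow w (N + m) * bromwich (sm m) c 1 Y)%C M)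
     (Csum (fun m => Cpow w (N + m) * RtoC (2 * PI / Gamma (sm m)))%C M)).
  { apply (tends_Csum (fun m Y => Cpow w (N + m) * bromwich (sm m) c 1 Y)%C). intros m. apply tends_scal.
    apply (proj2 (Gamma_line (sm m) (Hsm m))). exact Pc. }
  assert (E3 : Csum (fun m => Cpow w (N + m) * RtoC (2 * PI / Gamma (sm m)))%C M =
     (RtoC (2 * PI) * Csum (fun m => Cpow w (N + m) / RtoC (Gamma (sm m)))%C M)%C).
  { rewrite Csum_mult. apply Csum_ext. intros m. assert (HG := proj1 (Gamma_line (sm m) (Hsm m))).
    rewrite RtoC_div by auto. unfold Cdiv. ring. }
  rewrite E3 in T. fold sm in T.
  set (S0 := Csum (fun m => Cpow w (N + m) / RtoC (Gamma (sm m)))%C M) in *.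
  (* On the right line the partial sum is the integral of G minus that remainder; moving G to the
     left line releases 2 PI A. *)
  assert (Fin : Cmod (RtoC (2 * PI) * S0 - RtoC (2 * PI) * A)%C <=
      2 * PI * (C0 * (exp (a / 2) * exp ((1 - beta) * ln a))) + K0 * (1 / 2) ^ M * (PI / c)).
  { apply le_epsilon. intros e He. destruct (SH e He) as [Y0 HY0].
    apply (tends_bound _ _ _ (Rmax Y0 0) _ T). intros Y HY. generalize (Rmax_l Y0 0) (Rmax_r Y0 0); intros.
    specialize (HY0 Y ltac:(lra)). specialize (HLft Y ltac:(lra)). specialize (bessel_factor Y ltac:(lra)).
    assert (E4 : Csum (fun m => Cpow w (N + m) * bromwich (sm m) c 1 Y)%C M =
      (CInt (fun y => G (c, y)) (- Y) Y - CInt (fun y => G (c, y) * Cpow (q (c, y)) M)%C (- Y) Y)%C).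
    { rewrite <- CInt_minus by (auto; lra).
      rewrite (CInt_ext _ (fun y => Csum (fun m => f m (c, y)) M)) by (try lra; intros; now rewrite Fsum).
      rewrite (proj2 (CInt_Csum f c Y M ltac:(lra) Hf)). apply Csum_ext. intros m. unfold f, bromwich.
      rewrite CInt_scal by (try lra; apply Ccont_on_bromwich; lra). reflexivity. }
    rewrite E4.
    set (I1 := CInt (fun y => G (c, y)) (- Y) Y) in *. set (I2 := CInt (fun y => G ((a / 2)%R, y)) (- Y) Y) in *.
    set (I3 := CInt (fun y => G (c, y) * Cpow (q (c, y)) M)%C (- Y) Y) in *.
    replace (I1 - I3 - RtoC (2 * PI) * A)%C with ((I1 - I2 - RtoC (2 * PI) * A) + I2 + - I3)%C by ring.
    eapply Rle_trans; [apply Cmod_sum3|]. rewrite Cmod_opp. lra. }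
  replace (RtoC (2 * PI) * S0 - RtoC (2 * PI) * A)%C with (RtoC (2 * PI) * (S0 - A))%C in Fin by ring.
  rewrite Cmod_mult, Cmod_R, Rabs_right in Fin by lra.
  apply (Rmult_le_reg_l (2 * PI)); [lra|]. eapply Rle_trans; [exact Fin|]. apply Req_le. field. lra.
Qed.

(** * Absolutely convergent complex series *)

Definition abs_summable (a : nat -> C) : Prop := ex_series (fun m => Cmod (a m)).

Lemma ex_series_comp (a b : nat -> R) : (forall n, Rabs (a n) <= b n) -> ex_series b -> ex_series a.
Proof. exact (ex_series_le (V := R_CompleteNormedModule) a b). Qed.

Lemma abs_summable_le (a : nat -> C) (b : nat -> R) : (forall n, Cmod (a n) <= b n) -> ex_series b -> abs_summable a.
Proof.
  intros H. apply ex_series_comp. intros n. rewrite Rabs_right by (apply Rle_ge, Cmod_ge_0). auto.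
Qed.

Lemma abs_summable_Re (a : nat -> C) : abs_summable a -> ex_series (fun m => Re (a m)).
Proof. apply ex_series_comp. intros; apply re_le_Cmod. Qed.

Lemma abs_summable_Im (a : nat -> C) : abs_summable a -> ex_series (fun m => Im (a m)).
Proof. apply ex_series_comp. intros; apply Im_le_Cmod. Qed.

Lemma abs_summable_plus (a b : nat -> C) : abs_summable a -> abs_summable b -> abs_summable (fun m => a m + b m)%C.
Proof.
  intros Ha Hb. apply (abs_summable_le _ (fun m => Cmod (a m) + Cmod (b m))); [intros; apply Cmod_triangle|].
  exact (ex_series_plus (V := R_NormedModule) _ _ Ha Hb).
Qed.

Lemma abs_summable_scal (w : C) (a : nat -> C) : abs_summable a -> abs_summable (fun m => w * a m)%C.
Proof.
  intros Ha. apply (abs_summable_le _ (fun m => Cmod w * Cmod (a m))); [intros; rewrite Cmod_mult; lra|].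
  exact (ex_series_scal (V := R_NormedModule) (Cmod w) _ Ha).
Qed.

Lemma abs_summable_incr_n (a : nat -> C) (n : nat) : abs_summable a -> abs_summable (fun m => a (n + m)%nat).
Proof. intros H. exact (proj1 (ex_series_incr_n (V := R_NormedModule) _ n) H). Qed.

Lemma Series_nonneg (a : nat -> R) : (forall n, 0 <= a n) -> ex_series a -> 0 <= Series a.
Proof.
  intros H Ha. rewrite <- (Rmult_0_l (Series a)), <- Series_scal_l. apply Series_le; auto.
  intros n. specialize (H n). lra.
Qed.

Lemma sum_le_Series (a : nat -> R) (n : nat) : (forall n, 0 <= a n) -> ex_series a -> sum_n a n <= Series a.
Proof.
  intros H Ha. rewrite (Series_incr_n a (S n)), sum_n_Reals by (auto; lia). simpl Init.Nat.pred.
  assert (0 <= Series (fun k => a (S n + k)%nat)); [|lra].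
  apply Series_nonneg; [intros; apply H|]. exact (proj1 (ex_series_incr_n (V := R_NormedModule) a (S n)) Ha).
Qed.

Lemma Csum_proj (p : C -> R) (a : nat -> C) (n : nat) : (forall u v, p (u + v)%C = p u + p v) -> p 0%C = 0 ->
  p (Csum a (S n)) = sum_n (fun m => p (a m)) n.
Proof.
  intros Hp H0. induction n as [|n IH].
  - rewrite sum_O. simpl. now rewrite Hp, H0, Rplus_0_l.
  - rewrite sum_Sn, <- IH. change (Csum a (S (S n))) with (Csum a (S n) + a (S n))%C. now rewrite Hp.
Qed.

Lemma CSeries_lim (a : nat -> C) (eps : R) : abs_summable a -> 0 < eps ->
  exists N, forall n, (N <= n)%nat -> Cmod (Csum a n - CSeries a)%C <= eps.
Proof.
  intros Ha He.
  assert (H1 := Series_correct _ (abs_summable_Re a Ha)). assert (H2 := Series_correct _ (abs_summable_Im a Ha)).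
  destruct (proj1 (filterlim_locally _ _) H1 (mkposreal (eps / 2) ltac:(lra))) as [N1 HN1].
  destruct (proj1 (filterlim_locally _ _) H2 (mkposreal (eps / 2) ltac:(lra))) as [N2 HN2].
  exists (S (N1 + N2)). intros n Hn. destruct n as [|n]; [lia|].
  specialize (HN1 n ltac:(lia)). specialize (HN2 n ltac:(lia)).
  rewrite <- (Csum_proj Re) in HN1 by reflexivity. rewrite <- (Csum_proj Im) in HN2 by reflexivity.
  unfold ball in HN1, HN2; simpl in HN1, HN2. unfold AbsRing_ball, minus, plus, opp, abs in HN1, HN2; simpl in HN1, HN2.
  eapply Rle_trans; [apply Cmod_le_Re_Im|]. unfold CSeries, Re, Im in *. simpl. lra.
Qed.

Lemma Csum_Cmod (a : nat -> C) (n : nat) : Cmod (Csum a (S n)) <= sum_n (fun m => Cmod (a m)) n.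
Proof.
  induction n as [|n IH].
  - rewrite sum_O. simpl. rewrite Cplus_0_l. lra.
  - rewrite sum_Sn. change (Csum a (S (S n))) with (Csum a (S n) + a (S n))%C.
    eapply Rle_trans; [apply Cmod_triangle|]. apply Rplus_le_compat_r. exact IH.
Qed.

Lemma CSeries_near (a : nat -> C) (u : C) (B : R) : abs_summable a ->
  (forall N0 : nat, exists n, (N0 <= n)%nat /\ Cmod (Csum a n - u)%C <= B) -> Cmod (CSeries a - u)%C <= B.
Proof.
  intros Ha H. apply le_epsilon. intros e He. destruct (CSeries_lim a e Ha He) as [N HN].
  destruct (H N) as [n [Hn HB]]. specialize (HN n Hn).
  replace (CSeries a - u)%C with (- (Csum a n - CSeries a) + (Csum a n - u))%C by ring.
  eapply Rle_trans; [apply Cmod_triangle|]. rewrite Cmod_opp. lra.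
Qed.

Lemma CSeries_bound (a : nat -> C) : abs_summable a -> Cmod (CSeries a) <= Series (fun m => Cmod (a m)).
Proof.
  intros Ha. replace (CSeries a) with (CSeries a - 0)%C by ring. apply CSeries_near; auto.
  intros N. exists (S N). split; [lia|]. replace (Csum a (S N) - 0)%C with (Csum a (S N)) by ring.
  eapply Rle_trans; [apply Csum_Cmod|]. apply (sum_le_Series (fun m => Cmod (a m))); auto.
  intros; apply Cmod_ge_0.
Qed.

Lemma CSeries_bound_le (a : nat -> C) (b : nat -> R) : (forall n, Cmod (a n) <= b n) -> ex_series b ->
  Cmod (CSeries a) <= Series b.
Proof.
  intros H Hb. eapply Rle_trans; [apply CSeries_bound; eapply abs_summable_le; eauto|].
  apply Series_le; auto. intros n. split; [apply Cmod_ge_0|auto].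
Qed.

Lemma CSeries_ext (a b : nat -> C) : (forall m, a m = b m) -> CSeries a = CSeries b.
Proof. intros H. unfold CSeries. f_equal; apply Series_ext; intros; now rewrite H. Qed.

Lemma CSeries_plus (a b : nat -> C) : abs_summable a -> abs_summable b -> CSeries (fun m => a m + b m)%C = (CSeries a + CSeries b)%C.
Proof.
  intros Ha Hb. unfold CSeries, Cplus; simpl. f_equal.
  - apply Series_plus; now apply abs_summable_Re.
  - apply Series_plus; now apply abs_summable_Im.
Qed.

Lemma CSeries_scal (w : C) (a : nat -> C) : abs_summable a -> CSeries (fun m => w * a m)%C = (w * CSeries a)%C.
Proof.
  intros Ha. assert (H1 := abs_summable_Re a Ha). assert (H2 := abs_summable_Im a Ha).
  unfold CSeries, Cmult; simpl. f_equal.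
  - rewrite <- !Series_scal_l. rewrite <- Series_minus; auto;
      now apply (ex_series_scal (V := R_NormedModule)).
  - rewrite <- !Series_scal_l. rewrite <- Series_plus; auto;
      now apply (ex_series_scal (V := R_NormedModule)).
Qed.

Lemma CSeries_minus (a b : nat -> C) : abs_summable a -> abs_summable b -> CSeries (fun m => a m - b m)%C = (CSeries a - CSeries b)%C.
Proof.
  intros Ha Hb. rewrite (CSeries_ext _ (fun m => a m + (-1) * b m)%C) by (intros; ring).
  rewrite CSeries_plus, CSeries_scal by (auto; now apply abs_summable_scal). ring.
Qed.

Lemma CSeries_incr_n (a : nat -> C) (n : nat) : abs_summable a ->
  CSeries a = (Csum a n + CSeries (fun m => a (n + m)%nat))%C.
Proof.
  intros Ha. destruct n as [|n].
  - simpl. rewrite Cplus_0_l. reflexivity.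
  - rewrite (surj_C (Csum a (S n) + CSeries (fun m => a (S n + m)%nat))%C). unfold CSeries at 1. f_equal.
    + change (Re (Csum a (S n) + CSeries (fun m => a (S n + m)%nat))) with
       (Re (Csum a (S n)) + Series (fun m => Re (a (S n + m)%nat))).
      rewrite (Csum_proj Re), sum_n_Reals by reflexivity.
      apply (Series_incr_n (fun m => Re (a m)) (S n)); [lia|]. now apply abs_summable_Re.
    + change (Im (Csum a (S n) + CSeries (fun m => a (S n + m)%nat))) with
       (Im (Csum a (S n)) + Series (fun m => Im (a (S n + m)%nat))).
      rewrite (Csum_proj Im), sum_n_Reals by reflexivity.
      apply (Series_incr_n (fun m => Im (a m)) (S n)); [lia|]. now apply abs_summable_Im.
Qed.

Lemma Series_tail (b : nat -> R) (eps : R) : ex_series b -> 0 < eps ->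
  exists N, Series (fun m => b (N + m)%nat) <= eps.
Proof.
  intros Hb He. assert (H1 := Series_correct _ Hb).
  destruct (proj1 (filterlim_locally _ _) H1 (mkposreal eps He)) as [N HN].
  exists (S N). specialize (HN N (Nat.le_refl _)).
  unfold ball in HN; simpl in HN. unfold AbsRing_ball, minus, plus, opp, abs in HN; simpl in HN.
  rewrite sum_n_Reals in HN. rewrite (Series_incr_n b (S N)) in HN by (auto; lia). simpl Init.Nat.pred in HN.
  apply Rabs_def2 in HN. lra.
Qed.

Lemma is_derive_elim (f : R -> R) (t l eps : R) : is_derive f t l -> 0 < eps ->
  exists d, 0 < d /\ forall h, Rabs h < d -> Rabs (f (t + h) - f t - l * h) <= eps * Rabs h.
Proof.
  intros H He. apply is_derive_Reals in H. destruct (H eps He) as [d Hd]. exists d. split; [apply cond_pos|].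
  intros h Hh. destruct (Req_dec h 0) as [E|E].
  - rewrite E. replace (f (t + 0) - f t - l * 0) with 0 by (rewrite Rplus_0_r; ring). rewrite Rabs_R0. lra.
  - specialize (Hd h E Hh). assert (P := Rabs_pos_lt h E).
    replace (f (t + h) - f t - l * h) with (((f (t + h) - f t) / h - l) * h) by (field; auto).
    rewrite Rabs_mult. apply Rmult_le_compat_r; lra.
Qed.

Lemma Rdiff_elim (g : R -> C) (t : R) (v : C) (eps : R) : Rdiff g t v -> 0 < eps ->
  exists d, 0 < d /\ forall h : R, Rabs h < d ->
     Cmod (g (t + h)%R - g t - v * RtoC h)%C <= eps * Rabs h.
Proof.
  intros [H1 H2] He.
  destruct (is_derive_elim _ _ _ (eps / 2) H1 ltac:(lra)) as [d1 [Hd1 K1]].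
  destruct (is_derive_elim _ _ _ (eps / 2) H2 ltac:(lra)) as [d2 [Hd2 K2]].
  exists (Rmin d1 d2). split; [now apply Rmin_pos|]. intros h Hh.
  specialize (K1 h ltac:(eapply Rlt_le_trans; [exact Hh|apply Rmin_l])).
  specialize (K2 h ltac:(eapply Rlt_le_trans; [exact Hh|apply Rmin_r])).
  eapply Rle_trans; [apply Cmod_le_Re_Im|].
  replace (Re (g (t + h)%R - g t - v * RtoC h)%C) with (Re (g (t + h)) - Re (g t) - Re v * h)
    by (unfold Re, Cplus, Cminus, Cmult, Copp, RtoC; simpl; ring).
  replace (Im (g (t + h)%R - g t - v * RtoC h)%C) with (Im (g (t + h)) - Im (g t) - Im v * h)
    by (unfold Im, Cplus, Cminus, Cmult, Copp, RtoC; simpl; ring).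
  lra.
Qed.

Lemma Rdiff_const (w : C) (t : R) : Rdiff (fun _ => w) t 0.
Proof. split; apply (is_derive_const (V := R_NormedModule)). Qed.

Lemma Rdiff_plus (f g : R -> C) (t : R) (lf lg : C) : Rdiff f t lf -> Rdiff g t lg -> Rdiff (fun s => f s + g s)%C t (lf + lg)%C.
Proof.
  intros [F1 F2] [G1 G2]. split.
  - exact (is_derive_plus (V := R_NormedModule) _ _ _ _ _ F1 G1).
  - exact (is_derive_plus (V := R_NormedModule) _ _ _ _ _ F2 G2).
Qed.

Lemma Rdiff_Csum (f f' : nat -> R -> C) (t : R) (n : nat) : (forall m, Rdiff (f m) t (f' m t)) ->
  Rdiff (fun s => Csum (fun m => f m s) n) t (Csum (fun m => f' m t) n).
Proof.
  intros H. induction n as [|n IH]; simpl; [apply Rdiff_const|now apply Rdiff_plus].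
Qed.

Lemma Rdiff_lip (F F' : R -> C) (t r B h : R) : (forall s, Rabs (s - t) < r -> Rdiff F s (F' s)) ->
  (forall s, Rabs (s - t) < r -> Cmod (F' s) <= B) -> Rabs h < r -> Cmod (F (t + h)%R - F t)%C <= B * Rabs h.
Proof.
  intros HF HB Hh. destruct (Rle_dec 0 h) as [P|P].
  - rewrite Rabs_right in * by lra. replace (B * h) with (B * (t + h) - B * t) by ring.
    apply (Cmvt F F' (fun s => B * s) (fun _ => B)); [lra| | |].
    + intros s Hs. apply HF. apply Rabs_def1; lra.
    + intros s _. auto_derive; auto; ring.
    + intros s Hs. apply HB. apply Rabs_def1; lra.
  - rewrite Rabs_left in * by lra. replace (B * - h) with (B * t - B * (t + h)) by ring.
    rewrite <- Cmod_opp. replace (- (F (t + h)%R - F t))%C with (F t - F (t + h)%R)%C by ring.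
    apply (Cmvt F F' (fun s => B * s) (fun _ => B)); [lra| | |].
    + intros s Hs. apply HF. apply Rabs_def1; lra.
    + intros s _. auto_derive; auto; ring.
    + intros s Hs. apply HB. apply Rabs_def1; lra.
Qed.

(** The mean value inequality bounds the increments of the tail by M m |h|, uniformly in h; the
    finitely many other terms are differentiated directly. *)
Lemma CSeries_derive (f f' : nat -> R -> C) (M : nat -> R) (t r : R) : 0 < r ->
  (forall m s, Rabs (s - t) < r -> Rdiff (f m) s (f' m s)) ->
  (forall m s, Rabs (s - t) < r -> Cmod (f' m s) <= M m) -> ex_series M ->
  (forall s, Rabs (s - t) < r -> abs_summable (fun m => f m s)) ->
  Rdiff (fun s => CSeries (fun m => f m s)) t (CSeries (fun m => f' m t)).
Proof.
  intros Hr Hd HM HMs Hs.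
  assert (E0 : Rabs (t - t) < r) by (rewrite Rminus_diag, Rabs_R0; auto).
  assert (Hs' : abs_summable (fun m => f' m t)) by (apply (abs_summable_le _ M); auto).
  apply Rdiff_intro. intros eps Heps.
  (* The tail is charged twice, for the increment and for the linear term, hence 2 |h| eps / 4. *)
  destruct (Series_tail M (eps / 4) HMs ltac:(lra)) as [N HN].
  destruct (Rdiff_elim _ _ _ (eps / 2) (Rdiff_Csum f f' t N (fun m => Hd m t E0)) ltac:(lra)) as [d [Hdp K]].
  exists (Rmin d r). split; [now apply Rmin_pos|]. intros h Hh.
  assert (Hh1 : Rabs h < d) by (eapply Rlt_le_trans; [exact Hh|apply Rmin_l]).
  assert (Hh2 : Rabs h < r) by (eapply Rlt_le_trans; [exact Hh|apply Rmin_r]).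
  assert (Eh : Rabs (t + h - t) < r) by (replace (t + h - t) with h by ring; auto).
  rewrite (CSeries_incr_n (fun m => f m (t + h)) N), (CSeries_incr_n (fun m => f m t) N), (CSeries_incr_n (fun m => f' m t) N) by auto.
  assert (T1 := abs_summable_incr_n _ N (Hs _ Eh)). assert (T2 := abs_summable_incr_n _ N (Hs _ E0)). assert (T3 := abs_summable_incr_n _ N Hs').
  simpl in T1, T2, T3.
  match goal with |- Cmod ?X <= _ => replace X with
    ((Csum (fun m => f m (t + h)%R) N - Csum (fun m => f m t) N - Csum (fun m => f' m t) N * RtoC h) +
     CSeries (fun m => f (N + m)%nat (t + h)%R - f (N + m)%nat t - RtoC h * f' (N + m)%nat t))%C end.
  2:{ rewrite CSeries_minus, CSeries_minus, CSeries_scal; auto.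
      - ring.
      - apply (abs_summable_plus _ (fun m => - f (N + m)%nat t)%C); auto.
        eapply abs_summable_le; [|exact T2]. intros n; simpl. rewrite Cmod_opp. lra.
      - now apply abs_summable_scal. }
  specialize (K h Hh1).
  assert (B : Cmod (CSeries (fun m => f (N + m)%nat (t + h)%R - f (N + m)%nat t - RtoC h * f' (N + m)%nat t)%C) <= eps / 2 * Rabs h).
  { eapply Rle_trans; [apply (CSeries_bound_le _ (fun m => (2 * Rabs h) * M (N + m)%nat))|].
    - intros m. eapply Rle_trans; [apply Cmod_triangle|]. rewrite Cmod_opp, Cmod_mult, Cmod_R.
      assert (L := Rdiff_lip (f (N + m)%nat) (f' (N + m)%nat) t r (M (N + m)%nat) h (Hd _) (HM _) Hh2).
      assert (L2 := HM (N + m)%nat t E0). generalize (Rabs_pos h). nra.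
    - apply (ex_series_scal (V := R_NormedModule) (2 * Rabs h) (fun m => M (N + m)%nat)).
      exact (proj1 (ex_series_incr_n (V := R_NormedModule) M N) HMs).
    - rewrite Series_scal_l. generalize (Rabs_pos h). nra. }
  eapply Rle_trans; [apply Cmod_triangle|]. lra.
Qed.

(** * Factorial ratios and the sums S_n *)

Definition fact_ratio (m n : nat) : R := INR (fact m) / INR (fact (m + n)).

Lemma fact_ratio_pos (m n : nat) : 0 < fact_ratio m n.
Proof. apply Rdiv_lt_0_compat; apply INR_fact_lt_0. Qed.

Lemma fact_ratio_0 (m : nat) : fact_ratio m 0 = 1.
Proof. unfold fact_ratio. rewrite Nat.add_0_r. field. apply INR_fact_neq_0. Qed.

(** The cancellation by which differentiating s^(m+n+1) lowers the index n + 1 to n. *)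
Lemma fact_ratio_S (m n : nat) : fact_ratio m (S n) * INR (m + S n) = fact_ratio m n.
Proof.
  unfold fact_ratio. replace (m + S n)%nat with (S (m + n)) by lia. rewrite fact_simpl, mult_INR.
  field. split; [apply INR_fact_neq_0|]. apply not_0_INR. lia.
Qed.

Lemma fact_ratio_le_1 (m n : nat) : fact_ratio m n <= 1.
Proof.
  unfold fact_ratio. apply (Rmult_le_reg_r (INR (fact (m + n)))); [apply INR_fact_lt_0|].
  unfold Rdiv. rewrite Rmult_assoc, Rinv_l, Rmult_1_r, Rmult_1_l by apply INR_fact_neq_0.
  apply le_INR. apply fact_le. lia.
Qed.

Lemma fact_ratio_abs (m n : nat) : Rabs (fact_ratio m n) <= 1.
Proof. rewrite Rabs_right by (left; apply fact_ratio_pos). apply fact_ratio_le_1. Qed.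

Definition entire (b : nat -> R) : Prop := forall r, 0 <= r -> ex_series (fun m => Rabs (b m) * r ^ m).

Lemma entire_abs_summable (b c : nat -> R) (w : C) : entire b -> (forall m, Rabs (c m) <= 1) ->
  abs_summable (fun m => RtoC (b m * c m) * Cpow w m)%C.
Proof.
  intros Hb Hc. apply (abs_summable_le _ (fun m => Rabs (b m) * Cmod w ^ m)); [|apply Hb, Cmod_ge_0].
  intros m. rewrite Cmod_mult, Cmod_R, Cmod_pow, Rabs_mult.
  apply Rmult_le_compat_r; [apply pow_le, Cmod_ge_0|].
  rewrite <- (Rmult_1_r (Rabs (b m))) at 2. apply Rmult_le_compat_l; [apply Rabs_pos|apply Hc].
Qed.

(** S_n(w) for the coefficient sequence [b]. *)
Definition ratio_sum (b : nat -> R) (n : nat) (w : C) : C := CSeries (fun m => RtoC (b m * fact_ratio m n) * Cpow w m)%C.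

Lemma Rdiff_pow (w : C) (k : nat) (s : R) : Rdiff (fun s => w * RtoC (s ^ k))%C s (w * RtoC (INR k * s ^ pred k))%C.
Proof.
  apply (Rdiff_scal_real w (fun s => s ^ k)). auto_derive; auto. ring.
Qed.

Lemma pow_RtoC_mult (s : R) (w : C) (m : nat) : Cpow (RtoC s * w) m = (RtoC (s ^ m) * Cpow w m)%C.
Proof. now rewrite Cpow_mult_l, RtoC_pow. Qed.

Lemma ratio_sum_scaled (b : nat -> R) (n : nat) (w : C) (s : R) : entire b ->
  (RtoC (s ^ n) * ratio_sum b n (RtoC s * w))%C =
  CSeries (fun m => (RtoC (b m * fact_ratio m n) * Cpow w m) * RtoC (s ^ (m + n)))%C.
Proof.
  intros Hb. unfold ratio_sum. rewrite <- CSeries_scal by (apply entire_abs_summable; auto; intros; apply fact_ratio_abs).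
  apply CSeries_ext. intros m. rewrite pow_RtoC_mult, pow_add, !RtoC_mult. ring.
Qed.

Lemma ratio_sum_derive (b : nat -> R) (n : nat) (w : C) (s : R) : entire b -> 0 <= s <= 1 ->
  Rdiff (fun s => RtoC (s ^ S n) * ratio_sum b (S n) (RtoC s * w))%C s (RtoC (s ^ n) * ratio_sum b n (RtoC s * w))%C.
Proof.
  intros Hb Hs. rewrite ratio_sum_scaled by auto.
  eapply Rdiff_ext; [intros u; symmetry; apply (ratio_sum_scaled b (S n) w u Hb)|].
  rewrite (CSeries_ext _ (fun m => (RtoC (b m * fact_ratio m (S n)) * Cpow w m) * RtoC (INR (m + S n) * s ^ (m + n)))%C).
  (* The dominating sequence uses |u| <= 2, which holds for |u - s| < 1 and s in [0, 1]. *)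
  - apply (CSeries_derive (fun m s => (RtoC (b m * fact_ratio m (S n)) * Cpow w m) * RtoC (s ^ (m + S n)))%C
      (fun m s => (RtoC (b m * fact_ratio m (S n)) * Cpow w m) * RtoC (INR (m + S n) * s ^ (m + n)))%C
      (fun m => 2 ^ n * (Rabs (b m) * (2 * Cmod w) ^ m)) s 1); [lra| | | |].
    + intros m u _. replace (m + n)%nat with (pred (m + S n)) by lia. apply Rdiff_pow.
    + intros m u Hu. apply Rabs_def2 in Hu.
      replace (RtoC (b m * fact_ratio m (S n)) * Cpow w m * RtoC (INR (m + S n) * u ^ (m + n)))%C with
        (RtoC (b m * fact_ratio m n) * Cpow w m * RtoC (u ^ (m + n)))%C.
      * rewrite !Cmod_mult, !Cmod_R, Cmod_pow, Rabs_mult.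
        rewrite Rpow_mult_distr. replace (2 ^ n * (Rabs (b m) * (2 ^ m * Cmod w ^ m))) with
          (Rabs (b m) * 1 * Cmod w ^ m * (2 ^ (m + n))) by (rewrite pow_add; ring).
        apply Rmult_le_compat; try apply Rabs_pos.
        -- apply Rmult_le_pos; [apply Rmult_le_pos; apply Rabs_pos|apply pow_le, Cmod_ge_0].
        -- apply Rmult_le_compat_r; [apply pow_le, Cmod_ge_0|].
           apply Rmult_le_compat_l; [apply Rabs_pos|apply fact_ratio_abs].
        -- rewrite <- RPow_abs. apply pow_incr. split; [apply Rabs_pos|]. apply Rabs_le; lra.
      * rewrite <- (fact_ratio_S m n). rewrite !RtoC_mult. ring.
    + apply (ex_series_scal (V := R_NormedModule)). apply Hb. generalize (Cmod_ge_0 w); lra.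
    + intros u Hu. eapply abs_summable_le; [|apply (abs_summable_scal (RtoC (u ^ S n)) _ (entire_abs_summable b (fun m => fact_ratio m (S n)) (RtoC u * w) Hb (fun m => fact_ratio_abs m (S n))))].
      intros m. apply Req_le. f_equal. rewrite pow_RtoC_mult, pow_add, !RtoC_mult. ring.
  - intros m. rewrite <- (fact_ratio_S m n), !RtoC_mult. ring.
Qed.

(** The bound L e^(s a) reproduces itself under integration: u^n <= s^n on [0, s], and (e^(s a) - 1)
    / (s a) <= e^(s a). It must be carried for all s in [0, 1], while the gain 1/a is read off at s
    = 1 only and is the same for every n >= 1. *)
Lemma ratio_sum_bound (b : nat -> R) (w : C) (a L : R) : entire b -> 0 < a -> 0 <= L ->
  (forall s, 0 <= s <= 1 -> Cmod (ratio_sum b 0 (RtoC s * w)) <= L * exp (s * a)) ->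
  forall n, (forall s, 0 <= s <= 1 -> Cmod (ratio_sum b n (RtoC s * w)) <= L * exp (s * a)) /\
    ((0 < n)%nat -> Cmod (ratio_sum b n w) <= L * exp a / a).
Proof.
  intros Hb Ha HL H0. induction n as [|n [IH _]]; [split; auto; lia|].
  (* S_n(0) = b_0 / n!; this covers s = 0, where the estimate obtained by dividing by s says
     nothing. *)
  assert (Hb0 : Rabs (b O) <= L).
  { specialize (H0 0 ltac:(lra)). rewrite Rmult_0_l, exp_0, Rmult_1_r in H0.
    eapply Rle_trans; [|exact H0]. rewrite <- Cmod_R. apply Req_le. f_equal.
    unfold ratio_sum. rewrite (CSeries_incr_n _ 1) by (apply entire_abs_summable; auto; intros; apply fact_ratio_abs).
    rewrite (CSeries_ext _ (fun _ => 0 * 0)%C).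
    - rewrite CSeries_scal.
      + simpl. rewrite fact_ratio_0, Rmult_1_r. ring.
      + apply (abs_summable_le _ (fun m => Rabs (b m) * 0 ^ m)); [|apply Hb; lra].
        intros m. rewrite Cmod_0. apply Rmult_le_pos; [apply Rabs_pos|apply pow_le; lra].
    - intros m. rewrite Cmult_0_l. simpl. ring. }
  assert (M : forall s, 0 <= s <= 1 -> Cmod (RtoC (s ^ S n) * ratio_sum b (S n) (RtoC s * w))%C <= s ^ n * (L / a) * (exp (s * a) - 1)).
  { intros s Hs.
    assert (C := Cmvt (fun u => RtoC (u ^ S n) * ratio_sum b (S n) (RtoC u * w))%C (fun u => RtoC (u ^ n) * ratio_sum b n (RtoC u * w))%C
      (fun u => s ^ n * (L / a) * exp (u * a)) (fun u => s ^ n * (L * exp (u * a))) 0 s (proj1 Hs)). cbv beta in C.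
    replace (RtoC (0 ^ S n) * ratio_sum b (S n) (RtoC 0 * w))%C with (RtoC 0) in C.
    - replace (RtoC (s ^ S n) * ratio_sum b (S n) (RtoC s * w) - 0)%C with (RtoC (s ^ S n) * ratio_sum b (S n) (RtoC s * w))%C in C by ring.
      rewrite Rmult_0_l, exp_0 in C. rewrite Rmult_minus_distr_l. apply C.
      + intros u Hu. apply ratio_sum_derive; auto; lra.
      + intros u Hu. auto_derive; auto. field. lra.
      + intros u Hu. rewrite Cmod_mult, Cmod_R, Rabs_right by (apply Rle_ge, pow_le; lra).
        apply Rmult_le_compat; [apply pow_le; lra|apply Cmod_ge_0|apply pow_incr; lra|apply IH; lra].
    - rewrite pow_ne_zero by lia. ring. }
  assert (M2 : forall s, 0 < s <= 1 -> Cmod (ratio_sum b (S n) (RtoC s * w)) <= L / (s * a) * (exp (s * a) - 1)).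
  { intros s Hs. specialize (M s ltac:(lra)). assert (P : 0 < s ^ n) by (apply pow_lt; lra).
    rewrite Cmod_mult, Cmod_R, Rabs_right in M by (apply Rle_ge, pow_le; lra).
    apply (Rmult_le_reg_l (s ^ S n)); [apply pow_lt; lra|]. eapply Rle_trans; [exact M|].
    apply Req_le. simpl. field. lra. }
  split.
  - intros s Hs. destruct (Req_dec s 0) as [E|E].
    + rewrite E, Rmult_0_l, exp_0, Rmult_1_r.
      eapply Rle_trans; [|exact Hb0].
      unfold ratio_sum. rewrite (CSeries_incr_n _ 1) by (apply entire_abs_summable; auto; intros; apply fact_ratio_abs).
      rewrite (CSeries_ext _ (fun _ => 0 * 0)%C).
      * rewrite CSeries_scal.
        -- simpl. replace (0 + RtoC (b O * fact_ratio 0 (S n)) * 1 + 0 * CSeries (fun _ => 0))%C with (RtoC (b O * fact_ratio 0 (S n))) by ring.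
           rewrite Cmod_R, Rabs_mult. generalize (fact_ratio_abs 0 (S n)) (Rabs_pos (b O)). nra.
        -- apply (abs_summable_le _ (fun m => Rabs (b m) * 0 ^ m)); [|apply Hb; lra].
           intros m. rewrite Cmod_0. apply Rmult_le_pos; [apply Rabs_pos|apply pow_le; lra].
      * intros m. rewrite Cmult_0_l. simpl. ring.
    + eapply Rle_trans; [apply M2; lra|].
      assert (Psa : 0 < s * a) by nra.
      assert (X : exp (s * a) - 1 <= s * a * exp (s * a)).
      { generalize (exp_ineq1_le (- (s * a))) (exp_pos (s * a)); intros.
        assert (EE : exp (s * a) * exp (- (s * a)) = 1) by (rewrite <- exp_plus, Rplus_opp_r; apply exp_0). nra. }
      apply Rle_trans with (L / (s * a) * (s * a * exp (s * a))).
      * apply Rmult_le_compat_l; auto. apply Rmult_le_pos; auto. left; now apply Rinv_0_lt_compat.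
      * apply Req_le. field. lra.
  - intros _. specialize (M2 1 ltac:(lra)). rewrite !Rmult_1_l, Cmult_1_l in M2.
    eapply Rle_trans; [exact M2|]. unfold Rdiv. rewrite !Rmult_assoc. apply Rmult_le_compat_l; auto.
    rewrite Rmult_comm. apply Rmult_le_compat_r; [left; now apply Rinv_0_lt_compat|lra].
Qed.

(** * The Bessel factor as an alternating exponential series *)

Lemma exp_series (q : R) : is_series (fun n => / INR (fact n) * q ^ n) (exp q).
Proof. apply is_pseries_R, is_exp_Reals. Qed.

Lemma exp_series_ex (q : R) : ex_series (fun n => / INR (fact n) * q ^ n).
Proof. eexists; apply exp_series. Qed.

(** [alt_series q c] is sum_n (-q)^n / n! * c_n; with q = t^2/4 and c_n = m!/(m+n)! it is the Bessel factor. *)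
Definition alt_coef (q : R) (n : nat) : R := (- q) ^ n / INR (fact n).

Lemma Rabs_alt_coef (q : R) (n : nat) : 0 <= q -> Rabs (alt_coef q n) = / INR (fact n) * q ^ n.
Proof.
  intros Hq. unfold alt_coef, Rdiv. rewrite Rabs_mult, <- RPow_abs, Rabs_Ropp, (Rabs_right q) by lra.
  rewrite Rabs_right; [ring|]. left; apply Rinv_0_lt_compat, INR_fact_lt_0.
Qed.

Lemma ex_alt_series (q : R) (c : nat -> R) : 0 <= q -> (forall n, Rabs (c n) <= 1) -> ex_series (fun n => alt_coef q n * c n).
Proof.
  intros Hq Hc. apply (ex_series_comp _ (fun n => / INR (fact n) * q ^ n)); [|apply exp_series_ex].
  intros n. rewrite Rabs_mult, <- Rabs_alt_coef by auto. rewrite <- (Rmult_1_r (Rabs (alt_coef q n))) at 2.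
  apply Rmult_le_compat_l; [apply Rabs_pos|auto].
Qed.

Definition alt_series (q : R) (c : nat -> R) : R := Series (fun n => alt_coef q n * c n).

Lemma alt_series_bound (q : R) (c : nat -> R) : 0 <= q -> (forall n, Rabs (c n) <= 1) ->
  Rabs (alt_series q c) <= exp q.
Proof.
  intros Hq Hc.
  assert (Hle : forall n, Rabs (alt_coef q n * c n) <= / INR (fact n) * q ^ n).
  { intros n. rewrite Rabs_mult, <- Rabs_alt_coef by auto. rewrite <- (Rmult_1_r (Rabs (alt_coef q n))) at 2.
    apply Rmult_le_compat_l; [apply Rabs_pos|auto]. }
  eapply Rle_trans; [apply Series_Rabs|].
  - apply (ex_series_comp _ (fun n => / INR (fact n) * q ^ n)); [|apply exp_series_ex].
    intros n. rewrite Rabs_Rabsolu. auto.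
  - rewrite <- (is_series_unique _ _ (exp_series q)). apply Series_le; [|apply exp_series_ex].
    intros n. split; [apply Rabs_pos|auto].
Qed.

Lemma RtoC_Csum (f : nat -> R) (n : nat) : Csum (fun m => RtoC (f m)) (S n) = RtoC (sum_n f n).
Proof.
  rewrite (surj_C (Csum _ _)), (Csum_proj Re), (Csum_proj Im) by reflexivity. unfold RtoC. f_equal.
  - transitivity (sum_n (fun _ => 0) n); [apply sum_n_ext; reflexivity|rewrite sum_n_const; apply Rmult_0_r].
Qed.

(** Interchange of summations: the coefficients [c m n] are bounded, so truncating the inner series costs little, uniformly in [m]. *)
Lemma double_series_bound (b : nat -> R) (c : nat -> nat -> R) (w : C) (q X : R) : entire b -> 0 <= q ->
  (forall m n, Rabs (c m n) <= 1) ->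
  (forall n, Cmod (CSeries (fun m => RtoC (b m * c m n) * Cpow w m)%C) <= X) ->
  Cmod (CSeries (fun m => RtoC (b m * alt_series q (c m)) * Cpow w m)%C) <= exp q * X.
Proof.
  intros Hb Hq Hc HX.
  assert (HX0 : 0 <= X) by (eapply Rle_trans; [apply Cmod_ge_0|apply (HX O)]).
  set (W := Series (fun m => Rabs (b m) * Cmod w ^ m)).
  assert (HWe := Hb (Cmod w) (Cmod_ge_0 w)).
  assert (HW : 0 <= W).
  { apply Series_nonneg; auto. intros m. apply Rmult_le_pos; [apply Rabs_pos|apply pow_le, Cmod_ge_0]. }
  apply le_epsilon. intros e He.
  (* The truncation error is multiplied by W, the sum of |b_m| |w|^m; W + 1 avoids a division by
     0. *)
  destruct (Series_tail _ (e / (W + 1)) (exp_series_ex q)) as [P HP]; [apply Rdiv_lt_0_compat; lra|].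
  assert (Tail : forall m, Rabs (Series (fun n => alt_coef q (P + n) * c m (P + n)%nat)) <= e / (W + 1)).
  { intros m. assert (Hle : forall n, Rabs (alt_coef q (P + n) * c m (P + n)%nat) <= / INR (fact (P + n)) * q ^ (P + n)).
    { intros n. rewrite Rabs_mult, <- Rabs_alt_coef by auto. rewrite <- (Rmult_1_r (Rabs (alt_coef q (P + n)))) at 2.
      apply Rmult_le_compat_l; [apply Rabs_pos|auto]. }
    assert (HT : ex_series (fun n => / INR (fact (P + n)) * q ^ (P + n))).
    { exact (proj1 (ex_series_incr_n (V := R_NormedModule) _ P) (exp_series_ex q)). }
    eapply Rle_trans; [apply Series_Rabs|].
    - apply (ex_series_comp _ (fun n => / INR (fact (P + n)) * q ^ (P + n))); [|exact HT].
      intros n. rewrite Rabs_Rabsolu. apply Hle.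
    - eapply Rle_trans; [|exact HP]. apply Series_le; auto. intros n. split; [apply Rabs_pos|auto]. }
  set (F := fun m => (Csum (fun n => RtoC (alt_coef q n) * (RtoC (b m * c m n) * Cpow w m)) P)%C).
  assert (HF : forall Q, abs_summable (fun m => Csum (fun n => RtoC (alt_coef q n) * (RtoC (b m * c m n) * Cpow w m)) Q)%C /\
    CSeries (fun m => Csum (fun n => RtoC (alt_coef q n) * (RtoC (b m * c m n) * Cpow w m)) Q)%C =
    Csum (fun n => RtoC (alt_coef q n) * CSeries (fun m => RtoC (b m * c m n) * Cpow w m))%C Q).
  { induction Q as [|Q [IH1 IH2]]; simpl.
    - split.
      + apply (abs_summable_le _ (fun m => Rabs (b m) * Cmod w ^ m)); [|exact HWe].
        intros m. rewrite Cmod_0. apply Rmult_le_pos; [apply Rabs_pos|apply pow_le, Cmod_ge_0].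
      + unfold CSeries. simpl. rewrite (Series_ext _ (fun m => 0 * 0)) by (intros; ring).
        rewrite Series_scal_l, Rmult_0_l. reflexivity.
    - assert (A : abs_summable (fun m => RtoC (alt_coef q Q) * (RtoC (b m * c m Q) * Cpow w m))%C) by (apply abs_summable_scal, entire_abs_summable; auto).
      split; [now apply abs_summable_plus|]. rewrite CSeries_plus, IH2, CSeries_scal; auto. apply entire_abs_summable; auto. }
  destruct (HF P) as [HF1 HF2]. fold F in HF1, HF2.
  set (Rm := fun m => (RtoC (b m * Series (fun n => (alt_coef q (P + n) * c m (P + n)%nat)%R)) * Cpow w m)%C).
  assert (HR : forall m, Cmod (Rm m) <= e / (W + 1) * (Rabs (b m) * Cmod w ^ m)).
  { intros m. unfold Rm. rewrite Cmod_mult, Cmod_R, Cmod_pow, Rabs_mult.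
    rewrite <- Rmult_assoc. apply Rmult_le_compat_r; [apply pow_le, Cmod_ge_0|].
    rewrite Rmult_comm. apply Rmult_le_compat_r; [apply Rabs_pos|auto]. }
  assert (HRs : ex_series (fun m => e / (W + 1) * (Rabs (b m) * Cmod w ^ m))) by (now apply (ex_series_scal (V := R_NormedModule))).
  rewrite (CSeries_ext _ (fun m => F m + Rm m)%C).
  - rewrite CSeries_plus by (auto; exact (abs_summable_le _ _ HR HRs)). eapply Rle_trans; [apply Cmod_triangle|].
    apply Rplus_le_compat.
    + rewrite HF2. clear HF2 HF1 F Rm HR HRs Tail HP.
      destruct P as [|P].
      * simpl. rewrite Cmod_0. apply Rmult_le_pos; auto. left; apply exp_pos.
      * eapply Rle_trans; [apply Csum_Cmod|].
        apply Rle_trans with (sum_n (fun n => / INR (fact n) * q ^ n * X) P).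
        -- rewrite !sum_n_Reals. apply sum_Rle. intros n _. rewrite Cmod_mult, Cmod_R, Rabs_alt_coef by auto.
           apply Rmult_le_compat_l; auto. apply Rmult_le_pos; [left; apply Rinv_0_lt_compat, INR_fact_lt_0|now apply pow_le].
        -- rewrite (sum_n_mult_r (K := R_Ring)). unfold mult; simpl. apply Rmult_le_compat_r; auto.
           rewrite <- (is_series_unique _ _ (exp_series q)). apply sum_le_Series; [|apply exp_series_ex].
           intros n. apply Rmult_le_pos; [left; apply Rinv_0_lt_compat, INR_fact_lt_0|now apply pow_le].
    + eapply Rle_trans; [apply (CSeries_bound_le _ _ HR HRs)|]. rewrite Series_scal_l. fold W.
      apply (Rmult_le_reg_r (W + 1)); [lra|].
      replace (e / (W + 1) * W * (W + 1)) with (e * W) by (field; lra). nra.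
  - intros m. unfold F, Rm.
    assert (E : alt_series q (c m) = Re (Csum (fun n => RtoC (alt_coef q n * c m n)) P) + Series (fun n => alt_coef q (P + n) * c m (P + n)%nat)).
    { destruct P as [|P].
      - simpl. rewrite Rplus_0_l. reflexivity.
      - rewrite RtoC_Csum. unfold alt_series. rewrite (Series_incr_n _ (S P)) by (try lia; apply ex_alt_series; auto).
        rewrite sum_n_Reals. reflexivity. }
    assert (E2 : RtoC (Re (Csum (fun n => RtoC (alt_coef q n * c m n)) P)) = Csum (fun n => RtoC (alt_coef q n * c m n)) P).
    { destruct P as [|P]; [reflexivity|]. rewrite RtoC_Csum. reflexivity. }
    rewrite E, Rmult_plus_distr_l, RtoC_plus, Cmult_plus_distr_r. f_equal.
    rewrite RtoC_mult, E2.
    replace (RtoC (b m) * Csum (fun n => RtoC (alt_coef q n * c m n)) P * Cpow w m)%C with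
      ((RtoC (b m) * Cpow w m) * Csum (fun n => RtoC (alt_coef q n * c m n)) P)%C by ring.
    rewrite Csum_mult. apply Csum_ext. intros n. rewrite !RtoC_mult. ring.
Qed.

(** For j = 0 and q = t^2/4 this is the normalised Bessel function [BesselJ_hat m t]; j = 1 is minus
    its derivative in q. *)
Definition bessel_factor (m j : nat) (q : R) : R := alt_series q (fun n => fact_ratio m (n + j)).

Lemma bessel_factor_bound (m j : nat) (q : R) : 0 <= q -> Rabs (bessel_factor m j q) <= exp q.
Proof. intros Hq. apply alt_series_bound; auto. intros; apply fact_ratio_abs. Qed.

(** The powers (2/t)^m and (t/2)^m cancel for t <> 0. At t = 0 only the term n = 0 of the series
    survives, and it equals the prescribed value 1. *)
Lemma BesselJ_hat_bessel_factor (m : nat) (t : R) : BesselJ_hat m t = bessel_factor m 0 (t ^ 2 / 4).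
Proof.
  unfold BesselJ_hat, bessel_factor, alt_series. destruct (Req_EM_T t 0) as [E|E].
  - rewrite E. symmetry. rewrite (Series_incr_n _ 1).
    + simpl. rewrite (Series_ext _ (fun _ => 0 * 0)).
      * rewrite Series_scal_l, fact_ratio_0. unfold alt_coef. simpl. field.
      * intros n. unfold alt_coef. simpl. unfold Rdiv. ring.
    + lia.
    + apply ex_alt_series; [lra|]. intros; apply fact_ratio_abs.
  - unfold BesselJ. rewrite <- Series_scal_l. apply Series_ext. intros n.
    unfold alt_coef, fact_ratio. rewrite Nat.add_0_r, (Nat.add_comm n m).
    replace (2 / t) with (/ (t / 2)) by (field; auto).
    assert (Ht2 : t / 2 <> 0) by (intros H; apply E; lra).
    rewrite pow_add, pow_mult, pow_inv.
    replace (- (t ^ 2 / 4)) with ((-1) * (t / 2) ^ 2) by field. rewrite Rpow_mult_distr.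
    assert (Hp := pow_nonzero _ m Ht2).
    field. repeat split; auto; apply INR_fact_neq_0.
Qed.

(** Lets a factor m produced by differentiation be absorbed by doubling the radius. *)
Lemma INR_le_pow2 (m : nat) : INR m <= 2 ^ m.
Proof.
  induction m as [|m IH]; [simpl; lra|]. rewrite S_INR. simpl.
  assert (1 <= 2 ^ m) by (apply pow_R1_Rle; lra). lra.
Qed.

Lemma Rdiff_RtoC (g : R -> R) (t l : R) : is_derive g t l -> Rdiff (fun s => RtoC (g s)) t (RtoC l).
Proof. intros H. split; [exact H|exact (is_derive_const (V := R_NormedModule) 0 t)]. Qed.

Lemma Rdiff_mult (f g : R -> C) (t : R) (lf lg : C) : Rdiff f t lf -> Rdiff g t lg ->
  Rdiff (fun s => f s * g s)%C t (lf * g t + f t * lg)%C.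
Proof.
  intros [F1 F2] [G1 G2].
  assert (C := Rmult_comm).
  assert (M : forall p q : R -> R, forall lp lq, is_derive p t lp -> is_derive q t lq -> is_derive (fun s => p s * q s) t (lp * q t + p t * lq)).
  { intros p q lp lq Hp Hq. exact (is_derive_mult (K := R_AbsRing) p q t lp lq Hp Hq C). }
  split.
  - replace (Re (lf * g t + f t * lg)) with
      ((Re lf * Re (g t) + Re (f t) * Re lg) - (Im lf * Im (g t) + Im (f t) * Im lg)) by (unfold Re, Im; simpl; ring).
    exact (is_derive_minus (V := R_NormedModule) _ _ _ _ _ (M _ _ _ _ F1 G1) (M _ _ _ _ F2 G2)).
  - replace (Im (lf * g t + f t * lg)) with
      ((Re lf * Im (g t) + Re (f t) * Im lg) + (Im lf * Re (g t) + Im (f t) * Re lg)) by (unfold Re, Im; simpl; ring).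
    exact (is_derive_plus (V := R_NormedModule) _ _ _ _ _ (M _ _ _ _ F1 G2) (M _ _ _ _ F2 G1)).
Qed.

(** Termwise differentiation kills the term n = 0; the shift of n that follows cancels n against n!
    and turns j = 0 into j = 1. *)
Lemma bessel_factor_derive (m : nat) (q : R) : is_derive (bessel_factor m 0) q (- bessel_factor m 1 q).
Proof.
  set (R0 := Rabs q + 1). assert (HR0 : 1 <= R0) by (unfold R0; generalize (Rabs_pos q); lra).
  assert (Hab : forall s n, Rabs (s - q) < 1 -> Rabs (alt_coef s n * fact_ratio m n) <= / INR (fact n) * R0 ^ n).
  { intros s n Hs. rewrite Rabs_mult. apply Rle_trans with (Rabs (alt_coef s n) * 1).
    - apply Rmult_le_compat_l; [apply Rabs_pos|apply fact_ratio_abs].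
    - unfold alt_coef, Rdiv. rewrite Rmult_1_r, Rabs_mult, <- RPow_abs, Rabs_Ropp, Rmult_comm.
      rewrite Rabs_right by (left; apply Rinv_0_lt_compat, INR_fact_lt_0).
      apply Rmult_le_compat_l; [left; apply Rinv_0_lt_compat, INR_fact_lt_0|].
      apply pow_incr. split; [apply Rabs_pos|]. unfold R0.
      generalize (Rabs_triang (s - q) q). replace (s - q + q) with s by ring. lra. }
  assert (Hb : forall s n, Rabs (s - q) < 1 ->
    Rabs (- (INR n * (- s) ^ pred n / INR (fact n)) * fact_ratio m n) <= / INR (fact n) * (2 * R0) ^ n).
  { intros s n Hs. rewrite Rabs_mult, Rabs_Ropp.
    apply Rle_trans with (Rabs (INR n * (- s) ^ pred n / INR (fact n)) * 1).
    - apply Rmult_le_compat_l; [apply Rabs_pos|apply fact_ratio_abs].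
    - unfold Rdiv. rewrite Rmult_1_r, !Rabs_mult, <- RPow_abs, Rabs_Ropp, Rmult_comm.
      rewrite (Rabs_right (/ _)) by (left; apply Rinv_0_lt_compat, INR_fact_lt_0).
      apply Rmult_le_compat_l; [left; apply Rinv_0_lt_compat, INR_fact_lt_0|].
      rewrite (Rabs_right (INR n)) by (apply Rle_ge, pos_INR). rewrite Rpow_mult_distr.
      apply Rmult_le_compat; [apply pos_INR|apply pow_le, Rabs_pos|apply INR_le_pow2|].
      apply Rle_trans with (R0 ^ pred n); [|apply Rle_pow; [auto|lia]].
      apply pow_incr. split; [apply Rabs_pos|]. unfold R0.
      generalize (Rabs_triang (s - q) q). replace (s - q + q) with s by ring. lra. }
  assert (D : Rdiff (fun s => CSeries (fun n => RtoC (alt_coef s n * fact_ratio m n))) q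
     (CSeries (fun n => RtoC (- (INR n * (- q) ^ pred n / INR (fact n)) * fact_ratio m n)))).
  { apply (CSeries_derive (fun n s => RtoC (alt_coef s n * fact_ratio m n))
      (fun n s => RtoC (- (INR n * (- s) ^ pred n / INR (fact n)) * fact_ratio m n))
      (fun n => / INR (fact n) * (2 * R0) ^ n) q 1); [lra| | | |].
    - intros n s _. apply (Rdiff_RtoC (fun s => alt_coef s n * fact_ratio m n)). unfold alt_coef. auto_derive; auto.
      field. apply INR_fact_neq_0.
    - intros n s Hs. rewrite Cmod_R. now apply Hb.
    - apply exp_series_ex.
    - intros s Hs. apply (abs_summable_le _ (fun n => / INR (fact n) * R0 ^ n)); [|apply exp_series_ex].
      intros n. rewrite Cmod_R. now apply Hab. }
  destruct D as [D1 _].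
  replace (- bessel_factor m 1 q) with (Re (CSeries (fun n => RtoC (- (INR n * (- q) ^ pred n / INR (fact n)) * fact_ratio m n)))).
  - eapply is_derive_ext; [|exact D1]. intros s. unfold CSeries, bessel_factor, alt_series. simpl.
    apply Series_ext. intros n. rewrite Nat.add_0_r. reflexivity.
  - unfold CSeries; simpl. unfold bessel_factor, alt_series.
    rewrite <- Series_opp.
    rewrite (Series_incr_n _ 1).
    + simpl. unfold Rdiv at 1. rewrite !Rmult_0_l, Ropp_0, Rmult_0_l, Rplus_0_l.
      apply Series_ext. intros n. unfold alt_coef. rewrite Nat.add_1_r.
      change (match n with O => 1 | S _ => INR n + 1 end) with (INR (S n)).
      change (fact n + n * fact n)%nat with (fact (S n)).
      rewrite fact_simpl, mult_INR. field. split; [apply INR_fact_neq_0|]. apply not_0_INR. lia.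
    + lia.
    + apply (ex_series_comp _ (fun n => / INR (fact n) * (2 * R0) ^ n)); [|apply exp_series_ex].
      intros n. apply Hb. rewrite Rminus_diag, Rabs_R0. lra.
Qed.

(** [E] is the case b = [ml_coef alpha], j = 0. Its derivatives bring in j = 1, from the Bessel
    factor, and the coefficients m b_m, from the powers. *)
Definition bessel_sum (b : nat -> R) (j : nat) (w : C) (q : R) : C := CSeries (fun m => RtoC (b m * bessel_factor m j q) * Cpow w m)%C.

Lemma entire_scal (b : nat -> R) (K : R) : entire b -> entire (fun m => K * b m).
Proof.
  intros H r Hr. apply (ex_series_ext (fun m => Rabs K * (Rabs (b m) * r ^ m))).
  - intros m. rewrite Rabs_mult. symmetry; apply Rmult_assoc.
  - apply (ex_series_scal (V := R_NormedModule)). now apply H.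
Qed.

Lemma entire_INR (b : nat -> R) : entire b -> entire (fun m => INR m * b m).
Proof.
  intros H r Hr. apply (ex_series_comp _ (fun m => Rabs (b m) * (2 * r) ^ m)); [|apply H; lra].
  intros m. rewrite !Rabs_mult, !Rabs_Rabsolu, (Rabs_right (INR m)) by (apply Rle_ge, pos_INR).
  rewrite <- RPow_abs, (Rabs_right r) by lra. rewrite Rpow_mult_distr.
  rewrite (Rmult_comm (INR m)), Rmult_assoc. apply Rmult_le_compat_l; [apply Rabs_pos|].
  apply Rmult_le_compat_r; [now apply pow_le|apply INR_le_pow2].
Qed.

Lemma bessel_sum_abs_summable (b : nat -> R) (j : nat) (w : C) (q : R) : entire b -> 0 <= q -> abs_summable (fun m => RtoC (b m * bessel_factor m j q) * Cpow w m)%C.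
Proof.
  intros Hb Hq. apply (abs_summable_le _ (fun m => Rabs (exp q * b m) * Cmod w ^ m)); [|apply entire_scal; auto; apply Cmod_ge_0].
  intros m. rewrite Cmod_mult, Cmod_R, Cmod_pow, !Rabs_mult, Rmult_comm, (Rmult_comm (Rabs (exp q) * _)).
  apply Rmult_le_compat_l; [apply pow_le, Cmod_ge_0|].
  rewrite Rmult_comm. apply Rmult_le_compat_r; [apply Rabs_pos|].
  eapply Rle_trans; [now apply bessel_factor_bound|apply Rle_abs].
Qed.

(** With j = 1 only the sums S_(n+1) occur, so every term has the gain 1/a and nothing of leading
    order remains. *)
Lemma bessel_sum_1_bound (b : nat -> R) (w : C) (q a L : R) : entire b -> 0 < a -> 0 <= L -> 0 <= q ->
  (forall s, 0 <= s <= 1 -> Cmod (ratio_sum b 0 (RtoC s * w)) <= L * exp (s * a)) ->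
  Cmod (bessel_sum b 1 w q) <= exp q * (L * exp a / a).
Proof.
  intros Hb Ha HL Hq H0. unfold bessel_sum, bessel_factor.
  apply (double_series_bound b (fun m n => fact_ratio m (n + 1))); auto.
  - intros; apply fact_ratio_abs.
  - intros n. apply (proj2 (ratio_sum_bound b w a L Hb Ha HL H0 (n + 1))). lia.
Qed.

(** Subtracting S_0 amounts to putting 0 for the coefficient n = 0 of the Bessel factor;
    [double_series_bound] then sees only sums with the gain 1/a. *)
Lemma bessel_sum_0_bound (b : nat -> R) (w : C) (q a L : R) : entire b -> 0 < a -> 0 <= L -> 0 <= q ->
  (forall s, 0 <= s <= 1 -> Cmod (ratio_sum b 0 (RtoC s * w)) <= L * exp (s * a)) ->
  Cmod (bessel_sum b 0 w q - ratio_sum b 0 w)%C <= exp q * (L * exp a / a).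
Proof.
  intros Hb Ha HL Hq H0. unfold bessel_sum, ratio_sum.
  set (c := fun m n => match n with O => 0 | S _ => fact_ratio m n end).
  assert (Hc : forall m n, Rabs (c m n) <= 1).
  { intros m [|n]; [simpl; rewrite Rabs_R0; lra|apply fact_ratio_abs]. }
  rewrite <- CSeries_minus; [|now apply bessel_sum_abs_summable|apply entire_abs_summable; auto; intros; apply fact_ratio_abs].
  rewrite (CSeries_ext _ (fun m => RtoC (b m * alt_series q (c m)) * Cpow w m)%C).
  - apply double_series_bound; auto. intros [|n].
    + simpl. rewrite (CSeries_ext _ (fun m => 0 * (RtoC (b m * fact_ratio m 0) * Cpow w m))%C).
      * rewrite CSeries_scal by (apply entire_abs_summable; auto; intros; apply fact_ratio_abs).
        rewrite Cmult_0_l, Cmod_0. apply Rmult_le_pos; [apply Rmult_le_pos; [auto|left; apply exp_pos]|].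
        left; now apply Rinv_0_lt_compat.
      * intros m. rewrite Rmult_0_r. ring.
    + apply (proj2 (ratio_sum_bound b w a L Hb Ha HL H0 (S n))). lia.
  - intros m. assert (E : bessel_factor m 0 q = fact_ratio m 0 + alt_series q (c m)).
    { unfold bessel_factor, alt_series. rewrite (Series_incr_n (fun n => alt_coef q n * fact_ratio m (n + 0)) 1) by
        (try lia; apply ex_alt_series; auto; intros; apply fact_ratio_abs).
      rewrite (Series_incr_n (fun n => alt_coef q n * c m n) 1) by (try lia; apply ex_alt_series; auto).
      simpl. unfold alt_coef at 1. simpl. rewrite Rmult_0_r, Rplus_0_l. unfold Rdiv at 1. rewrite Rinv_1, !Rmult_1_l.
      f_equal. apply Series_ext. intros n. rewrite Nat.add_0_r. reflexivity. }
    rewrite E, Rmult_plus_distr_l, RtoC_plus. ring.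
Qed.

Lemma Cdiff_pow (z : C) (m : nat) : Cdiff (fun u => Cpow u m) z (RtoC (INR m) * Cpow z (pred m))%C.
Proof.
  induction m as [|m IH].
  - simpl. rewrite Cmult_0_l. apply Cdiff_const.
  - assert (D := Cdiff_mult _ _ z _ _ (Cdiff_id z) IH).
    replace (RtoC (INR (S m)) * Cpow z (pred (S m)))%C with (1 * Cpow z m + z * (RtoC (INR m) * Cpow z (pred m)))%C.
    + exact D.
    + rewrite S_INR, RtoC_plus. simpl pred. destruct m as [|m]; [simpl; ring|]. simpl pred. rewrite (Cpow_S z m). ring.
Qed.

(** The product rule in each term. The power contributes m v / x, which is where x <> 0 enters; the
    Bessel factor contributes the derivative (k^2/2) (x . v) of q = k^2 |x|^2 / 4 along v. *)
Lemma Rdiff_bessel_sum (b : nat -> R) (tau k : R) (z0 v : C) (t : R) : entire b -> 0 < tau -> Cmod v <= 1 -> (z0 + RtoC t * v)%C <> 0%C ->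
  Rdiff (fun s => bessel_sum b 0 (RtoC tau * (z0 + RtoC s * v)) ((k * Cmod (z0 + RtoC s * v)) ^ 2 / 4)) t
   (v / (z0 + RtoC t * v) * bessel_sum (fun m => (INR m * b m)%R) 0 (RtoC tau * (z0 + RtoC t * v)) ((k * Cmod (z0 + RtoC t * v)) ^ 2 / 4)
    - RtoC (k ^ 2 / 2 * (Re (z0 + RtoC t * v) * Re v + Im (z0 + RtoC t * v) * Im v)%R)
       * bessel_sum b 1 (RtoC tau * (z0 + RtoC t * v)) ((k * Cmod (z0 + RtoC t * v)) ^ 2 / 4))%C.
Proof.
  intros Hb Htau Hv Hx.
  set (X := fun s => (z0 + RtoC s * v)%C). set (Q := fun s => (k * Cmod (X s)) ^ 2 / 4).
  set (d := fun s => k ^ 2 / 2 * (Re (X s) * Re v + Im (X s) * Im v)).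
  assert (HQ0 : forall s, 0 <= Q s) by (intros s; unfold Q; generalize (pow2_ge_0 (k * Cmod (X s))); lra).
  assert (HQd : forall s, is_derive Q s (d s)).
  { intros s. apply (is_derive_ext (fun s => k ^ 2 / 4 * ((Re z0 + s * Re v) ^ 2 + (Im z0 + s * Im v) ^ 2))).
    - intros u. unfold Q. replace ((k * Cmod (X u)) ^ 2) with (k ^ 2 * Cmod (X u) ^ 2) by ring.
      rewrite Cmod2_alt. unfold X, Re, Im, Cplus, Cmult, RtoC; simpl. field.
    - unfold d, X. replace (Re (z0 + RtoC s * v)) with (Re z0 + s * Re v) by (unfold Re, Cplus, Cmult, RtoC; simpl; ring).
      replace (Im (z0 + RtoC s * v)) with (Im z0 + s * Im v) by (unfold Im, Cplus, Cmult, RtoC; simpl; ring).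
      auto_derive; auto. field. }
  set (f := fun m s => (RtoC (b m * bessel_factor m 0 (Q s)) * Cpow (RtoC tau * X s) m)%C).
  set (f' := fun m s => (RtoC (b m * (d s * - bessel_factor m 1 (Q s))) * Cpow (RtoC tau * X s) m +
     RtoC (b m * bessel_factor m 0 (Q s)) * (RtoC tau * v * (RtoC (INR m) * Cpow (RtoC tau * X s) (pred m))))%C).
  assert (Hder : forall m s, Rdiff (f m) s (f' m s)).
  { intros m s. apply (Rdiff_mult (fun s => RtoC (b m * bessel_factor m 0 (Q s))) (fun s => Cpow (RtoC tau * X s) m)).
    - apply (Rdiff_RtoC (fun s => b m * bessel_factor m 0 (Q s))). apply is_derive_scal.
      apply (is_derive_comp (bessel_factor m 0) Q s _ _ (bessel_factor_derive m (Q s)) (HQd s)).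
    - assert (D1 := Cdiff_mult _ _ (z0 + RtoC s * v)%C _ _ (Cdiff_const (RtoC tau) (z0 + RtoC s * v)%C) (Cdiff_id (z0 + RtoC s * v)%C)).
      assert (D2 := Cdiff_comp (fun u => Cpow u m) _ _ _ _ (Cdiff_pow _ m) D1).
      assert (D3 := Cdiff_line _ _ _ _ _ D2). fold (X s) in D3.
      replace (RtoC tau * v * (RtoC (INR m) * Cpow (RtoC tau * X s) (pred m)))%C with
        ((0 * X s + RtoC tau * 1) * (RtoC (INR m) * Cpow (RtoC tau * X s) (pred m)) * v)%C by ring.
      exact D3. }
  set (R0 := Cmod (X t) + 2).
  assert (HR : forall s, Rabs (s - t) < 1 -> Cmod (X s) <= R0).
  { intros s Hs. replace (X s) with (X t + RtoC (s - t) * v)%C by (unfold X; rewrite RtoC_minus; ring).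
    eapply Rle_trans; [apply Cmod_triangle|]. rewrite Cmod_mult, Cmod_R. unfold R0.
    generalize (Rabs_pos (s - t)) (Cmod_ge_0 v). nra. }
  assert (HR1 : 1 <= R0) by (unfold R0; generalize (Cmod_ge_0 (X t)); lra).
  assert (HQb : forall s, Rabs (s - t) < 1 -> Q s <= (k * R0) ^ 2 / 4).
  { intros s Hs. specialize (HR s Hs). unfold Q.
    replace ((k * Cmod (X s)) ^ 2) with (k ^ 2 * Cmod (X s) ^ 2) by ring.
    replace ((k * R0) ^ 2) with (k ^ 2 * R0 ^ 2) by ring.
    assert (Cmod (X s) ^ 2 <= R0 ^ 2) by (apply pow_incr; split; [apply Cmod_ge_0|auto]).
    generalize (pow2_ge_0 k). nra. }
  assert (Hdb : forall s, Rabs (s - t) < 1 -> Rabs (d s) <= k ^ 2 * R0).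
  { intros s Hs. specialize (HR s Hs). unfold d. rewrite Rabs_mult.
    rewrite (Rabs_right (k ^ 2 / 2)) by (generalize (pow2_ge_0 k); lra).
    assert (Rabs (Re (X s) * Re v + Im (X s) * Im v) <= 2 * R0).
    { eapply Rle_trans; [apply Rabs_triang|]. rewrite !Rabs_mult.
      assert (A1 := re_le_Cmod (X s)). assert (A2 := Im_le_Cmod (X s)).
      assert (A3 := re_le_Cmod v). assert (A4 := Im_le_Cmod v).
      assert (Rabs (Re (X s)) * Rabs (Re v) <= R0 * 1) by (apply Rmult_le_compat; try apply Rabs_pos; lra).
      assert (Rabs (Im (X s)) * Rabs (Im v) <= R0 * 1) by (apply Rmult_le_compat; try apply Rabs_pos; lra). lra. }
    generalize (pow2_ge_0 k). nra. }
  set (Kq := exp ((k * R0) ^ 2 / 4)). assert (HKq : 0 < Kq) by apply exp_pos.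
  assert (HBb : forall m j s, Rabs (s - t) < 1 -> Rabs (bessel_factor m j (Q s)) <= Kq).
  { intros m j s Hs. eapply Rle_trans; [apply bessel_factor_bound; auto|]. apply exp_le; auto. }
  (* 2^m absorbs the factor m of the differentiated power, and |v| <= 1 <= [R0] supplies the missing
     power of [R0]. *)
  assert (Hmb : forall m s, Rabs (s - t) < 1 -> Cmod (f' m s) <= Kq * (k ^ 2 * R0 + 1) * (Rabs (b m) * (2 * (tau * R0)) ^ m)).
  { intros m s Hs. unfold f'. eapply Rle_trans; [apply Cmod_triangle|].
    rewrite !Cmod_mult, !Cmod_pow, !Cmod_mult, !Cmod_R, !Rabs_mult, Rabs_Ropp, (Rabs_right tau), (Rabs_right (INR m)) by
      (lra || (apply Rle_ge, pos_INR)).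
    assert (Pb := Rabs_pos (b m)). assert (PX := Cmod_ge_0 (X s)).
    assert (HX : (tau * Cmod (X s)) ^ m <= (tau * R0) ^ m).
    { apply pow_incr. split; [nra|]. apply Rmult_le_compat_l; [lra|auto]. }
    assert (H2m : 1 <= 2 ^ m) by (apply pow_R1_Rle; lra).
    assert (HP : 0 <= (tau * R0) ^ m) by (apply pow_le; nra).
    assert (HX0 : 0 <= (tau * Cmod (X s)) ^ m) by (apply pow_le; nra).
    rewrite (Rpow_mult_distr 2).
    assert (U1 : Rabs (b m) * (Rabs (d s) * Rabs (bessel_factor m 1 (Q s))) * (tau * Cmod (X s)) ^ m <=
       Rabs (b m) * (k ^ 2 * R0 * Kq) * (2 ^ m * (tau * R0) ^ m)).
    { apply Rmult_le_compat; auto.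
      - apply Rmult_le_pos; auto. apply Rmult_le_pos; apply Rabs_pos.
      - apply Rmult_le_compat_l; auto. apply Rmult_le_compat; try apply Rabs_pos; auto.
      - nra. }
    assert (U2 : Rabs (b m) * Rabs (bessel_factor m 0 (Q s)) * (tau * Cmod v * (INR m * (tau * Cmod (X s)) ^ pred m)) <=
       Rabs (b m) * Kq * (2 ^ m * (tau * R0) ^ m)).
    { assert (Hin : tau * Cmod v * (INR m * (tau * Cmod (X s)) ^ pred m) <= 2 ^ m * (tau * R0) ^ m).
      { destruct m as [|m]; [simpl; lra|]. simpl pred.
        assert (Hy : (tau * Cmod (X s)) ^ m <= (tau * R0) ^ m).
        { apply pow_incr. split; [nra|]. apply Rmult_le_compat_l; [lra|auto]. }
        assert (Hy0 : 0 <= (tau * Cmod (X s)) ^ m) by (apply pow_le; nra).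
        replace (tau * Cmod v * (INR (S m) * (tau * Cmod (X s)) ^ m)) with (INR (S m) * ((tau * Cmod v) * (tau * Cmod (X s)) ^ m)) by ring.
        apply Rmult_le_compat; [apply pos_INR| |apply INR_le_pow2|].
        - generalize (Cmod_ge_0 v). intros. apply Rmult_le_pos; [nra|auto].
        - rewrite <- tech_pow_Rmult. apply Rmult_le_compat; auto; generalize (Cmod_ge_0 v); nra. }
      apply Rmult_le_compat.
      - apply Rmult_le_pos; auto. apply Rabs_pos.
      - apply Rmult_le_pos; [generalize (Cmod_ge_0 v); nra|]. apply Rmult_le_pos; [apply pos_INR|]. apply pow_le; nra.
      - apply Rmult_le_compat_l; auto.
      - exact Hin. }
    lra. }
  assert (HMs : ex_series (fun m => Kq * (k ^ 2 * R0 + 1) * (Rabs (b m) * (2 * (tau * R0)) ^ m))).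
  { apply (ex_series_scal (V := R_NormedModule)). apply Hb. nra. }
  assert (Main := CSeries_derive f f' _ t 1 ltac:(lra) (fun m s _ => Hder m s) Hmb HMs
     (fun s _ => bessel_sum_abs_summable b 0 (RtoC tau * X s)%C (Q s) Hb (HQ0 s))).
  match goal with |- Rdiff _ _ ?Y => replace Y with (CSeries (fun m => f' m t)) end; [exact Main|].
  fold (X t). fold (Q t). fold (d t).
  rewrite (CSeries_ext _ (fun m => (v / X t) * (RtoC (INR m * b m * bessel_factor m 0 (Q t)) * Cpow (RtoC tau * X t) m) -
     RtoC (d t) * (RtoC (b m * bessel_factor m 1 (Q t)) * Cpow (RtoC tau * X t) m))%C).
  - rewrite CSeries_minus.
    + rewrite !CSeries_scal; [reflexivity| |].
      * now apply bessel_sum_abs_summable.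
      * apply (bessel_sum_abs_summable (fun m => INR m * b m)); auto. now apply entire_INR.
    + apply abs_summable_scal. apply (bessel_sum_abs_summable (fun m => INR m * b m)); auto. now apply entire_INR.
    + apply abs_summable_scal. now apply bessel_sum_abs_summable.
  - intros m. unfold f'.
    assert (Hpow : (RtoC tau * v * (RtoC (INR m) * Cpow (RtoC tau * X t) (pred m)))%C = (v / X t * (RtoC (INR m) * Cpow (RtoC tau * X t) m))%C).
    { destruct m as [|m]; [simpl; ring|]. simpl pred. rewrite (Cpow_S _ m). field. exact Hx. }
    rewrite Hpow. rewrite !RtoC_mult, RtoC_opp. ring.
Qed.

(** * Mittag-Leffler coefficients and the asymptotics of E_alpha and w E_alpha' *)

Definition ml_coef (alpha : R) (m : nat) : R := / Gamma (alpha * INR m + 1).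

Lemma exp_INR (x : R) (n : nat) : exp x ^ n = exp (INR n * x).
Proof.
  induction n as [|n IH]; [simpl; rewrite Rmult_0_l, exp_0; reflexivity|].
  rewrite <- tech_pow_Rmult, IH, <- exp_plus, S_INR. f_equal. ring.
Qed.

(** From this index on, the Gamma arguments alpha m and alpha m + 1 are both at least 2, within
    reach of [Gamma_line]. *)
Lemma large_index (alpha : R) : 0 < alpha -> exists N : nat, (0 < N)%nat /\ 2 <= alpha * INR N.
Proof.
  intros Ha. destruct (nfloor_ex (2 / alpha)) as [n [_ Hn]]; [left; apply Rdiv_lt_0_compat; lra|].
  exists (S n). split; [lia|]. rewrite S_INR. apply (Rmult_lt_compat_l alpha) in Hn; auto.
  replace (alpha * (2 / alpha)) with 2 in Hn by (field; lra). lra.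
Qed.

(** [Gamma_inv_bound] with c^alpha = 2 (r + 1): the m-th term at radius r is then at most a constant
    times (r / (2 (r + 1)))^m <= 2^(-m). *)
Lemma entire_ml_coef (alpha : R) : 0 < alpha -> entire (ml_coef alpha).
Proof.
  intros Ha r Hr. destruct (large_index alpha Ha) as [N [HN HaN]].
  apply (ex_series_incr_n (V := R_NormedModule) _ N).
  set (c := exp (ln (2 * (r + 1)) / alpha)). assert (Pc : 0 < c) by apply exp_pos.
  assert (Hlc : ln c = ln (2 * (r + 1)) / alpha) by apply ln_exp.
  set (K := exp c * exp (ln c) / (2 * c) * (1 / 2) ^ N).
  apply (ex_series_comp _ (fun m => K * (1 / 2) ^ m)).
  - intros m. rewrite Rabs_mult, Rabs_Rabsolu, <- RPow_abs, (Rabs_right r) by lra.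
    assert (HB := Gamma_inv_bound (alpha * INR (N + m) + 1) c).
    assert (Hs : 2 <= alpha * INR (N + m) + 1).
    { rewrite plus_INR. assert (0 <= alpha * INR m) by (apply Rmult_le_pos; [lra|apply pos_INR]). lra. }
    specialize (HB Hs Pc). unfold ml_coef. apply (Rmult_le_compat_r (r ^ (N + m))) in HB; [|now apply pow_le].
    eapply Rle_trans; [exact HB|].
    replace (- (alpha * INR (N + m) + 1 - 2) * ln c) with (INR (N + m) * - ln (2 * (r + 1)) + ln c) by (rewrite Hlc; field; lra).
    rewrite exp_plus, <- exp_INR, exp_Ropp, exp_ln by lra.
    replace (exp c * ((/ (2 * (r + 1))) ^ (N + m) * exp (ln c)) / (2 * c) * r ^ (N + m)) with
      (exp c * exp (ln c) / (2 * c) * ((/ (2 * (r + 1))) * r) ^ (N + m)) by (rewrite Rpow_mult_distr; field; lra).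
    unfold K. rewrite Rmult_assoc, <- pow_add. apply Rmult_le_compat_l.
    + apply Rmult_le_pos; [apply Rmult_le_pos; left; apply exp_pos|left; apply Rinv_0_lt_compat; lra].
    + apply pow_incr. split; [apply Rmult_le_pos; auto; left; apply Rinv_0_lt_compat; lra|].
      apply (Rmult_le_reg_l (2 * (r + 1))); [lra|]. rewrite <- Rmult_assoc, Rinv_r by lra. lra.
  - apply (ex_series_scal (V := R_NormedModule)). apply ex_series_geom. rewrite Rabs_right; lra.
Qed.

Lemma head_bound (b : nat -> R) (N : nat) : exists S, 0 <= S /\ forall w r, 1 <= r -> Cmod w <= r ->
  Cmod (Csum (fun m => RtoC (b m * fact_ratio m 0) * Cpow w m)%C N) <= S * r ^ N.
Proof.
  induction N as [|N [S [HS IH]]].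
  - exists 0. split; [lra|]. intros. simpl. rewrite Cmod_0. lra.
  - exists (S + Rabs (b N)). split; [generalize (Rabs_pos (b N)); lra|]. intros w r Hr Hw. simpl.
    eapply Rle_trans; [apply Cmod_triangle|]. specialize (IH w r Hr Hw).
    assert (P : 0 < r ^ N) by (apply pow_lt; lra).
    assert (HN : Cmod (RtoC (b N * fact_ratio N 0) * Cpow w N)%C <= Rabs (b N) * r ^ N).
    { rewrite fact_ratio_0, Rmult_1_r, Cmod_mult, Cmod_R, Cmod_pow. apply Rmult_le_compat_l; [apply Rabs_pos|].
      apply pow_incr. split; [apply Cmod_ge_0|auto]. }
    generalize (Rabs_pos (b N)). intros.
    assert (S * r ^ N <= S * (r * r ^ N)) by (apply Rmult_le_compat_l; nra).
    assert (Rabs (b N) * r ^ N <= Rabs (b N) * (r * r ^ N)) by (apply Rmult_le_compat_l; nra). lra.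
Qed.

(** 1 + a <= 2 N (1 + a / (2 N)) <= 2 N e^(a / (2 N)), raised to the power N. *)
Lemma poly_le_exp (a : R) (N : nat) : (0 < N)%nat -> 0 <= a -> (1 + a) ^ N <= (2 * INR N) ^ N * exp (a / 2).
Proof.
  intros HN Ha. assert (HN1 : 1 <= INR N) by (apply (le_INR 1); lia).
  replace (a / 2) with (INR N * (a / (2 * INR N))) by (field; lra).
  rewrite <- exp_INR, <- Rpow_mult_distr. apply pow_incr. split; [lra|].
  assert (H := exp_ineq1_le (a / (2 * INR N))).
  apply Rle_trans with (2 * INR N * (1 + a / (2 * INR N))).
  - rewrite Rmult_plus_distr_l. replace (2 * INR N * (a / (2 * INR N))) with a by (field; lra). lra.
  - apply Rmult_le_compat_l; lra.
Qed.

(** K may be large and depend on the point, as it does in [ML_tail]: it is multiplied by 2^(-M) and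
    drops out of the limit. *)
Lemma CSeries_of_partial (f : nat -> C) (A : C) (D K : R) : 0 <= K -> abs_summable f ->
  (forall M, Cmod (Csum f M - A)%C <= D + K * (1 / 2) ^ M) -> Cmod (CSeries f - A)%C <= D.
Proof.
  intros HK Hf H. apply le_epsilon. intros e He. apply CSeries_near; auto. intros N0.
  destruct (pow_lt_1_zero (1 / 2)) with (y := e / (K + 1)) as [N HN].
  - rewrite Rabs_right; lra.
  - apply Rdiv_lt_0_compat; lra.
  - exists (N0 + N)%nat. split; [lia|]. eapply Rle_trans; [apply H|].
    specialize (HN (N0 + N)%nat ltac:(lia)). assert (P : 0 < (1 / 2) ^ (N0 + N)) by (apply pow_lt; lra).
    rewrite Rabs_right in HN by lra. apply (Rmult_lt_compat_l (K + 1)) in HN; [|lra].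
    replace ((K + 1) * (e / (K + 1))) with e in HN by (field; lra). nra.
Qed.

(** The finitely many terms [m < N] are absorbed in the error. *)
Lemma ML_full (alpha B beta kappa : R) (b : nat -> R) (N : nat) : 0 < alpha <= 1 -> 0 < B -> (0 < N)%nat -> 0 <= beta <= 1 ->
  2 <= alpha * INR N + beta -> entire b ->
  (forall m, (N <= m)%nat -> b m = kappa * / Gamma (alpha * INR m + beta)) ->
  exists C1, 0 <= C1 /\ forall Lmu : C, Rabs (Im Lmu) < PI / 2 -> Cmod (Cexp Lmu) <= B * Re (Cexp Lmu) ->
   Cmod (ratio_sum b 0 (Cexp (RtoC alpha * Lmu)) - RtoC (kappa / alpha) * (Cexp (Cexp Lmu) * Cexp (RtoC (1 - beta) * Lmu)))%C
    <= C1 * exp (Re (Cexp Lmu) / 2) * (1 + exp ((1 - beta) * ln (Re (Cexp Lmu)))).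
Proof.
  intros Ha HB HN Hbeta Hs Hb Hbk.
  destruct (ML_tail alpha B beta N Ha HB Hs) as [C0 [HC0 Htail]].
  destruct (head_bound b N) as [S [HS Hhead]].
  (* [head_bound] at radius (1 + B)(1 + a), followed by [poly_le_exp] for (1 + a)^N; the radius
     comes from |w| = |mu|^alpha <= 1 + |mu|. *)
  set (H := S * ((1 + B) ^ N * (2 * INR N) ^ N)).
  assert (HH : 0 <= H).
  { apply Rmult_le_pos; auto. apply Rmult_le_pos; apply pow_le; [lra|]. generalize (pos_INR N); lra. }
  exists (H + Rabs kappa * C0). split; [generalize (Rabs_pos kappa); nra|]. intros Lmu HL Hmu.
  destruct (Htail Lmu HL Hmu) as [K [HK HT]]. clear Htail.
  set (w := Cexp (RtoC alpha * Lmu)) in *. set (mu := Cexp Lmu) in *. set (a := Re mu) in *.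
  assert (Hmod : Cmod mu = exp (Re Lmu)) by apply Cmod_Cexp.
  assert (Pmod : 0 < Cmod mu) by (rewrite Hmod; apply exp_pos).
  assert (Pa : 0 < a) by nra.
  assert (Hw : Cmod w <= (1 + B) * (1 + a)).
  { unfold w. rewrite Cmod_Cexp, Re_RtoC_mult. apply Rle_trans with (1 + Cmod mu); [|nra].
    rewrite Hmod. destruct (Rle_dec (Re Lmu) 0) as [L|L].
    - assert (exp (alpha * Re Lmu) <= 1) by (rewrite <- exp_0; apply exp_le; nra). generalize (exp_pos (Re Lmu)); lra.
    - assert (exp (alpha * Re Lmu) <= exp (Re Lmu)) by (apply exp_le; nra). lra. }
  assert (B1 : Cmod (Csum (fun m => RtoC (b m * fact_ratio m 0) * Cpow w m)%C N) <= H * exp (a / 2)).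
  { eapply Rle_trans; [apply (Hhead w ((1 + B) * (1 + a))); auto; nra|].
    rewrite Rpow_mult_distr. unfold H. rewrite !Rmult_assoc. apply Rmult_le_compat_l; auto.
    apply Rmult_le_compat_l; [apply pow_le; lra|]. apply poly_le_exp; auto; lra. }
  assert (As : abs_summable (fun m => RtoC (b m * fact_ratio m 0) * Cpow w m)%C) by (apply entire_abs_summable; auto; intros; apply fact_ratio_abs).
  assert (Hterm : forall m, (RtoC (b (N + m)%nat * fact_ratio (N + m) 0) * Cpow w (N + m))%C =
     (RtoC kappa * (Cpow w (N + m) / RtoC (Gamma (alpha * INR (N + m) + beta))))%C).
  { intros m. rewrite fact_ratio_0, Rmult_1_r, Hbk by lia.
    assert (HG : Gamma (alpha * INR (N + m) + beta) <> 0).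
    { apply Gamma_line. rewrite plus_INR. assert (0 <= alpha * INR m) by (apply Rmult_le_pos; [lra|apply pos_INR]). lra. }
    rewrite RtoC_mult, RtoC_inv by auto. unfold Cdiv. ring. }
  assert (B2 : Cmod (CSeries (fun m => RtoC (b (N + m)%nat * fact_ratio (N + m) 0) * Cpow w (N + m)) -
       RtoC (kappa / alpha) * (Cexp mu * Cexp (RtoC (1 - beta) * Lmu)))%C <=
       Rabs kappa * (C0 * (exp (a / 2) * exp ((1 - beta) * ln a)))).
  { apply (CSeries_of_partial _ _ _ (Rabs kappa * K)).
    - apply Rmult_le_pos; auto. apply Rabs_pos.
    - exact (abs_summable_incr_n _ N As).
    - intros M. rewrite (Csum_ext _ _ M Hterm), <- Csum_mult.
      replace (RtoC (kappa / alpha) * (Cexp mu * Cexp (RtoC (1 - beta) * Lmu)))%C with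
        (RtoC kappa * (Cexp mu * Cexp (RtoC (1 - beta) * Lmu) / RtoC alpha))%C
        by (rewrite RtoC_div by lra; unfold Cdiv; ring).
      match goal with |- Cmod (?k * ?u - ?k * ?v)%C <= _ => replace (k * u - k * v)%C with (k * (u - v))%C by ring end.
      rewrite Cmod_mult, Cmod_R. rewrite (Rmult_assoc (Rabs kappa) K), <- Rmult_plus_distr_l.
      apply Rmult_le_compat_l; [apply Rabs_pos|apply HT]. }
  unfold ratio_sum. rewrite (CSeries_incr_n _ N As).
  match goal with |- Cmod (?u + ?v - ?z)%C <= _ => replace (u + v - z)%C with (u + (v - z))%C by ring end.
  eapply Rle_trans; [apply Cmod_triangle|].
  assert (E1 := exp_pos (a / 2)). assert (E2 := exp_pos ((1 - beta) * ln a)). assert (Pk := Rabs_pos kappa).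
  assert (0 <= H * exp (a / 2) * exp ((1 - beta) * ln a)) by (apply Rmult_le_pos; [apply Rmult_le_pos|]; lra).
  assert (0 <= Rabs kappa * C0 * exp (a / 2)) by (repeat apply Rmult_le_pos; lra).
  nra.
Qed.

(** [ML_full] with beta = 1 gives E_alpha. For w E_alpha' the coefficient m / Gamma(alpha m + 1)
    equals (1/alpha) / Gamma(alpha m), which is beta = 0, kappa = 1/alpha and produces the extra
    factor mu / alpha. *)
Lemma ML_both (alpha B : R) : 0 < alpha <= 1 -> 0 < B -> exists C1, 0 <= C1 /\ forall Lmu : C,
  Rabs (Im Lmu) < PI / 2 -> Cmod (Cexp Lmu) <= B * Re (Cexp Lmu) ->
  Cmod (ratio_sum (ml_coef alpha) 0 (Cexp (RtoC alpha * Lmu)) - RtoC (1 / alpha) * Cexp (Cexp Lmu))%C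
    <= C1 * (1 + Re (Cexp Lmu)) * exp (Re (Cexp Lmu) / 2) /\
  Cmod (ratio_sum (fun m => (INR m * ml_coef alpha m)%R) 0 (Cexp (RtoC alpha * Lmu)) - RtoC (1 / alpha ^ 2) * (Cexp Lmu * Cexp (Cexp Lmu)))%C
    <= C1 * (1 + Re (Cexp Lmu)) * exp (Re (Cexp Lmu) / 2).
Proof.
  intros Ha HB. destruct (large_index alpha (proj1 Ha)) as [N [HN HaN]].
  assert (Hb := entire_ml_coef alpha (proj1 Ha)).
  destruct (ML_full alpha B 1 1 (ml_coef alpha) N) as [C1 [HC1 H1]]; auto; try lra.
  { intros m _. unfold ml_coef. ring. }
  destruct (ML_full alpha B 0 (1 / alpha) (fun m => INR m * ml_coef alpha m) N) as [C2 [HC2 H2]]; auto; try lra.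
  { now apply entire_INR. }
  { intros m Hm. assert (Hs : 2 <= alpha * INR m).
    { apply le_INR in Hm. assert (alpha * INR N <= alpha * INR m) by (apply Rmult_le_compat_l; lra). lra. }
    unfold ml_coef. rewrite Gamma_succ, Rplus_0_r by auto.
    assert (HG := proj1 (Gamma_line _ Hs)).
    assert (INR m <> 0) by (intros E; rewrite E in Hs; lra). field. repeat split; auto; lra. }
  exists (2 * C1 + C2). split; [lra|]. intros Lmu HL Hmu. specialize (H1 Lmu HL Hmu). specialize (H2 Lmu HL Hmu).
  set (a := Re (Cexp Lmu)) in *.
  assert (Pm : 0 < Cmod (Cexp Lmu)) by (rewrite Cmod_Cexp; apply exp_pos).
  assert (Pa : 0 < a) by nra. assert (E := exp_pos (a / 2)).
  replace (1 - 1) with 0 in H1 by ring. rewrite Cmult_0_l, Cexp_0, Rmult_0_l, exp_0, Cmult_1_r in H1.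
  replace (1 - 0) with 1 in H2 by ring. rewrite Cmult_1_l, Rmult_1_l, exp_ln in H2 by auto.
  assert (0 <= C1 * exp (a / 2)) by nra. assert (0 <= C2 * exp (a / 2)) by nra.
  split.
  - eapply Rle_trans; [exact H1|]. nra.
  - replace (RtoC (1 / alpha ^ 2) * (Cexp Lmu * Cexp (Cexp Lmu)))%C with
      (RtoC (1 / alpha / alpha) * (Cexp (Cexp Lmu) * Cexp Lmu))%C.
    + eapply Rle_trans; [exact H2|]. nra.
    + replace (1 / alpha / alpha) with (1 / alpha ^ 2) by (field; lra). ring.
Qed.

Lemma ratio_sum_zero (b : nat -> R) : entire b -> ratio_sum b 0 0 = RtoC (b O).
Proof.
  intros Hb. unfold ratio_sum. rewrite (CSeries_incr_n _ 1) by (apply entire_abs_summable; auto; intros; apply fact_ratio_abs).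
  rewrite (CSeries_ext _ (fun m => 0 * (RtoC (b m * fact_ratio m 0) * Cpow 0 m))%C).
  - rewrite CSeries_scal by (apply entire_abs_summable; auto; intros; apply fact_ratio_abs).
    simpl. rewrite fact_ratio_0, Rmult_1_r. ring.
  - intros m. simpl. ring.
Qed.

(** * The principal logarithm on the cone, and derivatives of plane-valued curves *)

Lemma Clog_Clog_rhp (x : C) : 0 < Re x -> Clog x = Clog_rhp x.
Proof.
  intros Hx. unfold Clog, Clog_rhp, Arg. f_equal.
  assert (E := Cexp_Clog_rhp x Hx). set (th := atan (Im x / Re x)) in *.
  assert (Hm : 0 < Cmod x) by (apply Cmod_gt_0, Re_pos_neq_0, Hx).
  assert (Hb := atan_bound (Im x / Re x)). fold th in Hb.
  assert (Hc : Re x / Cmod x = cos th).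
  { assert (E1 := f_equal Re E). unfold Cexp, Clog_rhp in E1. simpl in E1. fold th in E1. rewrite exp_ln in E1 by auto.
    rewrite <- E1. field. lra. }
  assert (Hs : Im x = Cmod x * sin th).
  { assert (E1 := f_equal Im E). unfold Cexp, Clog_rhp in E1. simpl in E1. fold th in E1. rewrite exp_ln in E1 by auto.
    symmetry. exact E1. }
  (* [acos] of cos th returns |th|; the sign of Im x = |x| sin th is that of th, in accordance with
     the two branches of [Arg]. *)
  rewrite Hc. destruct (Rle_dec 0 (Im x)) as [L|L].
  - apply acos_cos. split; [|lra]. destruct (Rle_dec 0 th) as [Q|Q]; auto.
    exfalso. assert (sin th < 0) by (apply sin_lt_0_var; lra). nra.
  - rewrite <- (cos_neg th), acos_cos; [ring|]. split; [|lra]. destruct (Rle_dec 0 (- th)) as [Q|Q]; auto.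
    exfalso. assert (0 < sin th) by (apply sin_gt_0; lra). nra.
Qed.

Lemma cone_Re_pos (alpha : R) (x : C) : 0 < alpha <= 1 -> 0 < Cmod x -> cone (PI * alpha / 2) x -> 0 < Re x.
Proof.
  intros Ha Hm Hc. unfold cone in Hc. assert (HPI := PI_RGT_0).
  assert (0 <= cos (PI * alpha / 2)) by (apply cos_ge_0; nra). nra.
Qed.

(** The cone condition reads cos th > cos(PI alpha / 2), and cosine decreases on [0, PI]. After
    multiplication by 1/alpha the argument stays below PI/2, as [ML_both] demands of [Lmu]. *)
Lemma cone_arg (alpha : R) (x : C) : 0 < alpha <= 1 -> 0 < Cmod x -> cone (PI * alpha / 2) x ->
  Rabs (Im (Clog_rhp x)) < PI * alpha / 2.
Proof.
  intros Ha Hm Hc. assert (Hx := cone_Re_pos alpha x Ha Hm Hc). unfold cone in Hc. assert (HPI := PI_RGT_0).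
  assert (E := Cexp_Clog_rhp x Hx). assert (Hb := atan_bound (Im x / Re x)).
  assert (E1 := f_equal Re E). unfold Cexp, Clog_rhp in E1. simpl in E1. rewrite exp_ln in E1 by auto.
  unfold Clog_rhp; simpl. set (th := atan (Im x / Re x)) in *.
  fold (Re x) in E1. rewrite <- E1 in Hc at 1.
  apply Rgt_lt in Hc. apply Rmult_lt_reg_l in Hc; auto.
  destruct (Rlt_dec (Rabs th) (PI * alpha / 2)) as [L|L]; auto. exfalso. apply Rnot_lt_le in L.
  assert (Ec : cos th = cos (Rabs th)) by (unfold Rabs; destruct (Rcase_abs th); [symmetry; apply cos_neg|reflexivity]).
  rewrite Ec in Hc.
  assert (cos (Rabs th) <= cos (PI * alpha / 2)); [|lra].
  assert (Rabs th <= PI) by (apply Rabs_le; lra).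
  apply cos_decr_1; nra.
Qed.

(** Writes f as Re f (1, 0) + Im f (0, 1) in the real normed module C; this settles the existence of
    the partial derivatives. *)
Lemma Rdiff_ex_derive (f : R -> C) (t : R) (l : C) : Rdiff f t l -> ex_derive f t.
Proof.
  intros [H1 H2]. exists l.
  assert (D1 := is_derive_scal_l (V := C_R_NormedModule) _ _ _ ((1, 0) : C) H1).
  assert (D2 := is_derive_scal_l (V := C_R_NormedModule) _ _ _ ((0, 1) : C) H2).
  assert (D := is_derive_plus (V := C_R_NormedModule) _ _ _ _ _ D1 D2).
  assert (E : forall z : C, (@plus C_R_NormedModule (@scal R_AbsRing C_R_NormedModule (Re z) ((1, 0) : C))
    (@scal R_AbsRing C_R_NormedModule (Im z) ((0, 1) : C))) = z).
  { intros z. rewrite (surj_C z) at 3. unfold plus, scal; simpl. unfold prod_plus, prod_scal, plus, scal, mult; simpl.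
    unfold mult; simpl. f_equal; ring. }
  rewrite E in D. eapply is_derive_ext; [|exact D]. intros s. apply E.
Qed.

Lemma Rdiff_CDerive (f : R -> C) (t : R) (l : C) : Rdiff f t l -> CDerive f t = l.
Proof.
  intros [H1 H2]. transitivity (Re l, Im l); [|symmetry; apply surj_C].
  unfold CDerive. f_equal; apply is_derive_unique; assumption.
Qed.

Lemma Rdiff_ext_loc (f g : R -> C) (t r : R) (l : C) : 0 < r -> (forall s, Rabs (s - t) < r -> f s = g s) -> Rdiff f t l -> Rdiff g t l.
Proof.
  intros Hr H [H1 H2]. split.
  - eapply is_derive_ext_loc; [|exact H1]. exists (mkposreal r Hr). intros s Hs. simpl. now rewrite H.
  - eapply is_derive_ext_loc; [|exact H2]. exists (mkposreal r Hr). intros s Hs. simpl. now rewrite H.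
Qed.

(** Real and complex inverse both send 0 to 0. This allows [E] to be rewritten although Gamma has
    been shown to be nonzero only for arguments at least 2. *)
Lemma RtoC_inv_total (r : R) : RtoC (/ r) = (/ RtoC r)%C.
Proof.
  destruct (Req_dec r 0) as [E|E]; [|now apply RtoC_inv].
  rewrite E, Rinv_0. unfold Cinv, RtoC; simpl. f_equal; unfold Rdiv; ring.
Qed.

(** * Uniform estimates and the partial derivatives *)

Lemma E_bessel_sum (k alpha tau : R) (x : C) : E k alpha tau x = bessel_sum (ml_coef alpha) 0 (RtoC tau * x) ((k * Cmod x) ^ 2 / 4).
Proof.
  unfold E, bessel_sum. apply CSeries_ext. intros m. rewrite BesselJ_hat_bessel_factor. unfold ml_coef.
  rewrite RtoC_mult, RtoC_inv_total. unfold Cdiv. ring.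
Qed.

Definition mu_of (alpha tau : R) (x : C) : C := (RtoC (Rpower tau (1 / alpha)) * Cpower x (1 / alpha))%C.

Lemma leading_mu (alpha tau : R) (x : C) : leading alpha tau x = (RtoC (1 / alpha) * Cexp (mu_of alpha tau x))%C.
Proof. reflexivity. Qed.

(** Derivatives of [E] and [leading] at [x] in the direction [v]. *)
Definition E_deriv (k alpha tau : R) (x v : C) : C :=
  (v / x * bessel_sum (fun m => (INR m * ml_coef alpha m)%R) 0 (RtoC tau * x) ((k * Cmod x) ^ 2 / 4)
    - RtoC (k ^ 2 / 2 * (Re x * Re v + Im x * Im v)%R) * bessel_sum (ml_coef alpha) 1 (RtoC tau * x) ((k * Cmod x) ^ 2 / 4))%C.

Definition leading_deriv (alpha tau : R) (x v : C) : C :=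
  (v / x * (RtoC (1 / alpha ^ 2) * (mu_of alpha tau x * Cexp (mu_of alpha tau x))))%C.

Lemma region_props (alpha rad eps : R) (x : C) : 0 < alpha <= 1 -> 0 < rad -> region alpha rad eps x ->
  0 < Cmod x <= rad /\ 0 < Re x /\ Rabs (Im (Clog_rhp x)) < PI * alpha / 2 /\
  Cpower x (1 / alpha) = Cexp (RtoC (1 / alpha) * Clog_rhp x) /\ eps <= Re (Cpower x (1 / alpha)).
Proof.
  intros Ha Hr [Hc [[H1 H2] H3]].
  assert (Hm : 0 < Cmod x) by (assert (0 < / rad) by (now apply Rinv_0_lt_compat); lra).
  assert (Hx := cone_Re_pos alpha x Ha Hm Hc). repeat split; auto.
  - now apply cone_arg.
  - unfold Cpower. now rewrite Clog_Clog_rhp.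
  - lra.
Qed.

Lemma exp_sq_bound (a : R) : 0 <= a -> (1 + a) * exp (a / 2) <= 2 * exp a.
Proof.
  intros Ha. assert (H := exp_ineq1_le (a / 2)). assert (P := exp_pos (a / 2)).
  replace (exp a) with (exp (a / 2) * exp (a / 2)) by (rewrite <- exp_plus; f_equal; field). nra.
Qed.

(** The room between e^(a/2) and e^a turns the remainder of the contour shift into a gain of 1/a.
    [poly_le_exp] with N = 2 gives the constant 16; 36 is generous. *)
Lemma exp_cube_bound (a : R) : 0 < a -> (1 + a) * exp (a / 2) <= 36 * exp a / a.
Proof.
  intros Ha. assert (H := poly_le_exp a 2 ltac:(lia) ltac:(lra)). simpl INR in H.
  assert (P := exp_pos (a / 2)). apply (Rmult_le_reg_r a); auto.
  replace (36 * exp a / a * a) with (36 * exp a) by (field; lra).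
  replace (exp a) with (exp (a / 2) * exp (a / 2)) by (rewrite <- exp_plus; f_equal; field). nra.
Qed.

(** Write a = Re mu. The leading terms have modulus e^a / alpha and |mu| e^a / (alpha^2 |x|); the
    errors are smaller by a factor 1/a, up to constants, and a >= eps tau^(1/alpha). *)
Lemma estimates (k alpha rad eps : R) : 0 < alpha <= 1 -> 0 < rad -> 0 < eps ->
  exists M T, 0 <= M /\ 0 < T /\ forall tau x, T <= tau -> region alpha rad eps x ->
   Cmod (E k alpha tau x - leading alpha tau x)%C <= M * (1 / Rpower tau (1 / alpha)) * Cmod (leading alpha tau x) /\
   forall v, Cmod v = 1 ->
   Cmod (E_deriv k alpha tau x v - leading_deriv alpha tau x v)%C <= M * (1 / Rpower tau (1 / alpha)) * Cmod (leading_deriv alpha tau x v).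
Proof.
  intros Ha Hrad Heps. set (p := 1 / alpha) in *.
  assert (Hp : 1 <= p) by (unfold p; rewrite <- Rinv_1 at 1; unfold Rdiv; rewrite Rmult_1_l; apply Rinv_le_contravar; lra).
  (* On the region |x^(1/alpha)| <= rad^(1/alpha) and Re x^(1/alpha) >= eps, so |mu| <= B Re mu. *)
  set (B := exp (p * ln rad) / eps). assert (HB : 0 < B) by (apply Rdiv_lt_0_compat; auto; apply exp_pos).
  destruct (ML_both alpha B Ha HB) as [C1 [HC1 HML]].
  set (b := ml_coef alpha) in *. assert (Hb : entire b) by (apply entire_ml_coef; lra).
  set (bm := fun m => INR m * b m) in *. assert (Hbm : entire bm) by (now apply entire_INR).
  (* p is the size of the main term, 2 C1 that of its error by [exp_sq_bound], and |b_0| takes care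
     of s = 0. *)
  set (L := p + 2 * C1 + Rabs (b O)). assert (HL : 0 <= L) by (unfold L; generalize (Rabs_pos (b O)); lra).
  set (Qm := exp ((k * rad) ^ 2 / 4)). assert (HQm : 0 < Qm) by apply exp_pos.
  (* The terms with [Qm] come from the Bessel series, those with 36 C1 from the Mittag-Leffler
     remainder; the prefactors alpha and alpha^2 compensate the 1/alpha and 1/alpha^2 of the leading
     terms. *)
  set (M1 := alpha * (Qm * L + 36 * C1)).
  set (M2 := alpha ^ 2 * (Qm * (B / alpha ^ 2 + 2 * C1) + 36 * C1 + k ^ 2 * rad ^ 2 * (Qm * L))).
  assert (Ha2 : 0 < alpha ^ 2) by nra.
  assert (HM1 : 0 <= M1).
  { unfold M1. apply Rmult_le_pos; [lra|]. assert (0 <= Qm * L) by nra. lra. }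
  assert (HBa : 0 < B / alpha ^ 2) by (apply Rdiv_lt_0_compat; auto).
  assert (HM2 : 0 <= M2).
  { unfold M2. apply Rmult_le_pos; [lra|]. assert (0 <= Qm * L) by nra.
    assert (0 <= k ^ 2 * rad ^ 2) by (apply Rmult_le_pos; apply pow2_ge_0).
    assert (0 <= Qm * (B / alpha ^ 2 + 2 * C1)) by nra.
    assert (0 <= k ^ 2 * rad ^ 2 * (Qm * L)) by (apply Rmult_le_pos; auto). lra. }
  (* For tau >= eps^(-alpha) one has eps tau^(1/alpha) >= 1, hence Re mu >= 1; the division by eps
     converts 1 / Re mu into tau^(-1/alpha). *)
  exists ((M1 + M2) / eps), (exp (alpha * ln (/ eps))).
  split; [apply Rmult_le_pos; [lra|left; now apply Rinv_0_lt_compat]|]. split; [apply exp_pos|].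
  intros tau x Htau Hreg.
  destruct (region_props alpha rad eps x Ha Hrad Hreg) as [Hm [Hx [Harg [Hpow Hre]]]]. fold p in Hpow, Hre.
  assert (Hx0 : x <> 0%C) by (apply Cmod_gt_0; lra).
  assert (Ptau : 0 < tau) by (eapply Rlt_le_trans; [apply exp_pos|exact Htau]).
  set (P := Rpower tau p) in *. assert (HP : 0 < P) by apply exp_pos.
  assert (HP1 : / eps <= P).
  { unfold P, Rpower. apply ln_le in Htau; [|apply exp_pos]. rewrite ln_exp in Htau.
    rewrite <- (exp_ln (/ eps)) by (now apply Rinv_0_lt_compat). apply exp_le.
    apply (Rmult_le_compat_l p) in Htau; [|lra]. rewrite <- Rmult_assoc in Htau.
    replace (p * alpha) with 1 in Htau by (unfold p; field; lra). lra. }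
  set (mu := mu_of alpha tau x). set (a := Re mu).
  assert (Emu : mu = (RtoC P * Cpower x p)%C) by reflexivity.
  assert (Hae : P * eps <= a).
  { unfold a. rewrite Emu, Re_RtoC_mult. apply Rmult_le_compat_l; lra. }
  assert (Ha1 : 1 <= a).
  { apply Rle_trans with (P * eps); auto. apply (Rmult_le_compat_r eps) in HP1; [|lra]. rewrite Rinv_l in HP1; lra. }
  assert (Hamu : a <= Cmod mu) by (eapply Rle_trans; [apply Rle_abs|apply re_le_Cmod]).
  assert (HmuB : Cmod mu <= B * a).
  { rewrite Emu, Cmod_mult, Cmod_R, Rabs_right by lra. rewrite Hpow, Cmod_Cexp, Re_RtoC_mult.
    change (Re (Clog_rhp x)) with (ln (Cmod x)).
    apply Rle_trans with (P * exp (p * ln rad)).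
    - apply Rmult_le_compat_l; [lra|]. apply exp_le. apply Rmult_le_compat_l; [lra|]. apply ln_le; lra.
    - unfold B. replace (P * exp (p * ln rad)) with (exp (p * ln rad) / eps * (P * eps)) by (field; lra).
      apply Rmult_le_compat_l; auto. left; exact HB. }
  set (w := (RtoC tau * x)%C).
  (* Replacing w by s w replaces mu by sg mu with sg = s^(1/alpha) <= s, because 1/alpha >= 1. So
     e^(sg a) <= e^(s a), which is the form required by [ratio_sum_bound]. *)
  assert (HS : forall s, 0 < s <= 1 -> exists sg, 0 < sg <= s /\
     Cmod (ratio_sum b 0 (RtoC s * w) - RtoC p * Cexp (RtoC sg * mu))%C <= C1 * (1 + sg * a) * exp (sg * a / 2) /\
     Cmod (ratio_sum bm 0 (RtoC s * w) - RtoC (1 / alpha ^ 2) * ((RtoC sg * mu) * Cexp (RtoC sg * mu)))%C <= C1 * (1 + sg * a) * exp (sg * a / 2) /\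
     (s = 1 -> sg = 1)).
  { intros s Hs. set (sg := exp (p * ln s)). exists sg.
    assert (Hls : ln s <= 0) by (rewrite <- ln_1; apply ln_le; lra).
    assert (Hsg : 0 < sg <= s).
    { split; [apply exp_pos|]. rewrite <- (exp_ln s) by lra. apply exp_le. nra. }
    split; auto.
    set (Lmu := (RtoC p * (RtoC (ln s + ln tau) + Clog_rhp x))%C).
    assert (EL : Cexp Lmu = (RtoC sg * mu)%C).
    { rewrite Emu, Hpow. unfold Lmu, sg, P, Rpower. rewrite <- !Cexp_RtoC, <- !Cexp_plus. f_equal.
      rewrite RtoC_plus, !RtoC_mult. ring. }
    assert (Ew : Cexp (RtoC alpha * Lmu) = (RtoC s * w)%C).
    { unfold Lmu, w. rewrite Cmult_assoc, <- RtoC_mult. replace (alpha * p) with 1 by (unfold p; field; lra).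
      rewrite Cmult_1_l, Cexp_plus, Cexp_RtoC, exp_plus, !exp_ln, Cexp_Clog_rhp, RtoC_mult by lra. ring. }
    assert (Hre' : Re (Cexp Lmu) = sg * a) by (rewrite EL; apply Re_RtoC_mult).
    destruct (HML Lmu) as [X1 X2].
    - unfold Lmu. rewrite Im_RtoC_mult.
      replace (Im (RtoC (ln s + ln tau) + Clog_rhp x)) with (Im (Clog_rhp x)) by (unfold Im, RtoC, Cplus; simpl; ring).
      rewrite Rabs_mult, Rabs_right by lra. apply (Rmult_lt_compat_l p) in Harg; [|lra].
      replace (p * (PI * alpha / 2)) with (PI / 2) in Harg by (unfold p; field; lra). exact Harg.
    - rewrite Hre', EL, Cmod_mult, Cmod_R, Rabs_right by lra. nra.
    - rewrite Ew, Hre', EL in X1, X2. split; [exact X1|split; [exact X2|]].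
      intros E1. unfold sg. rewrite E1, ln_1, Rmult_0_r. apply exp_0. }
  assert (Hsmall : forall s sg, 0 < sg <= s -> s <= 1 -> C1 * (1 + sg * a) * exp (sg * a / 2) <= 2 * C1 * exp (s * a) /\ exp (sg * a) <= exp (s * a)).
  { intros s sg Hsg Hs1. assert (Q := exp_sq_bound (sg * a) ltac:(nra)).
    assert (Q2 : exp (sg * a) <= exp (s * a)) by (apply exp_le; nra). split; auto.
    rewrite Rmult_assoc. apply (Rmult_le_compat_l C1) in Q; auto. nra. }
  assert (H0 : forall s, 0 <= s <= 1 -> Cmod (ratio_sum b 0 (RtoC s * w)) <= L * exp (s * a)).
  { intros s Hs. destruct (Req_dec s 0) as [E0|E0].
    - rewrite E0, Cmult_0_l, ratio_sum_zero, Cmod_R, Rmult_0_l, exp_0 by auto. unfold L. generalize (Rabs_pos (b O)); lra.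
    - destruct (HS s ltac:(lra)) as [sg [Hsg [X1 _]]]. destruct (Hsmall s sg Hsg ltac:(lra)) as [Y1 Y2].
      replace (ratio_sum b 0 (RtoC s * w)) with ((ratio_sum b 0 (RtoC s * w) - RtoC p * Cexp (RtoC sg * mu)) + RtoC p * Cexp (RtoC sg * mu))%C by ring.
      eapply Rle_trans; [apply Cmod_triangle|]. rewrite Cmod_mult, Cmod_R, Rabs_right, Cmod_Cexp, Re_RtoC_mult by lra.
      fold a. assert (P0 := exp_pos (s * a)). unfold L. generalize (Rabs_pos (b O)); intros.
      assert (p * exp (sg * a) <= p * exp (s * a)) by (apply Rmult_le_compat_l; lra). nra. }
  (* For the coefficients m b_m the main term has size |mu| e^a, so the constant grows like a. The
     gain 1/a then leaves O(e^a), still smaller than |mu| e^a by a factor of order 1/a. *)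
  set (L' := B / alpha ^ 2 * a + 2 * C1). assert (HL' : 0 <= L') by (unfold L'; nra).
  assert (H0m : forall s, 0 <= s <= 1 -> Cmod (ratio_sum bm 0 (RtoC s * w)) <= L' * exp (s * a)).
  { intros s Hs. destruct (Req_dec s 0) as [E0|E0].
    - rewrite E0, Cmult_0_l, ratio_sum_zero, Cmod_R, Rmult_0_l, exp_0 by auto. unfold bm. simpl.
      rewrite Rmult_0_l, Rabs_R0. lra.
    - destruct (HS s ltac:(lra)) as [sg [Hsg [_ [X2 _]]]]. destruct (Hsmall s sg Hsg ltac:(lra)) as [Y1 Y2].
      match type of X2 with Cmod (?u - ?z)%C <= _ => replace u with ((u - z) + z)%C by ring end.
      eapply Rle_trans; [apply Cmod_triangle|]. rewrite (Cmod_mult (RtoC (1 / alpha ^ 2))), !Cmod_mult, !Cmod_R, Cmod_Cexp, Re_RtoC_mult.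
      fold a. rewrite (Rabs_right sg) by lra. rewrite (Rabs_right (1 / alpha ^ 2)) by (left; apply Rdiv_lt_0_compat; lra).
      assert (P0 := exp_pos (s * a)). assert (P1 := exp_pos (sg * a)).
      assert (Z : 1 / alpha ^ 2 * (sg * Cmod mu * exp (sg * a)) <= B / alpha ^ 2 * a * exp (s * a)).
      { replace (B / alpha ^ 2 * a * exp (s * a)) with (1 / alpha ^ 2 * ((B * a) * exp (s * a))) by (field; lra).
        apply Rmult_le_compat_l; [left; apply Rdiv_lt_0_compat; lra|].
        apply Rmult_le_compat; [nra|lra|nra|lra]. }
      unfold L'. rewrite Rmult_plus_distr_r. lra. }
  set (q := (k * Cmod x) ^ 2 / 4).
  assert (Hq : 0 <= q) by (unfold q; generalize (pow2_ge_0 (k * Cmod x)); lra).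
  assert (Hqm : exp q <= Qm).
  { apply exp_le. unfold q. replace ((k * Cmod x) ^ 2) with (k ^ 2 * Cmod x ^ 2) by ring.
    replace ((k * rad) ^ 2) with (k ^ 2 * rad ^ 2) by ring.
    assert (Cmod x ^ 2 <= rad ^ 2) by (apply pow_incr; lra). generalize (pow2_ge_0 k). nra. }
  assert (Pa : 0 < a) by lra. assert (Pe := exp_pos a).
  assert (T0 := bessel_sum_0_bound b w q a L Hb Pa HL Hq H0). assert (T1 := bessel_sum_1_bound b w q a L Hb Pa HL Hq H0).
  assert (T0m := bessel_sum_0_bound bm w q a L' Hbm Pa HL' Hq H0m).
  destruct (HS 1 ltac:(lra)) as [sg [_ [X1 [X2 Hsg]]]]. rewrite (Hsg eq_refl) in X1, X2. clear Hsg.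
  rewrite !Cmult_1_l, !Rmult_1_l in X1, X2.
  assert (X0 := exp_cube_bound a Pa).
  assert (X1' : Cmod (ratio_sum b 0 w - RtoC p * Cexp mu)%C <= 36 * C1 * (exp a / a)).
  { eapply Rle_trans; [exact X1|]. rewrite Rmult_assoc. apply (Rmult_le_compat_l C1) in X0; auto. unfold Rdiv in *. lra. }
  assert (X2' : Cmod (ratio_sum bm 0 w - RtoC (1 / alpha ^ 2) * (mu * Cexp mu))%C <= 36 * C1 * (exp a / a)).
  { eapply Rle_trans; [exact X2|]. rewrite Rmult_assoc. apply (Rmult_le_compat_l C1) in X0; auto. unfold Rdiv in *. lra. }
  assert (Hea : 0 < exp a / a) by (now apply Rdiv_lt_0_compat).
  assert (HLe : forall l, 0 <= l -> exp q * (l * exp a / a) <= Qm * l * (exp a / a)).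
  { intros l Hl. replace (exp q * (l * exp a / a)) with (exp q * (l * (exp a / a))) by (unfold Rdiv; ring).
    rewrite Rmult_assoc. apply Rmult_le_compat_r; auto. apply Rmult_le_pos; lra. }
  assert (Hinv : 1 / a <= / eps * (1 / P)).
  { unfold Rdiv. rewrite !Rmult_1_l. rewrite <- Rinv_mult. apply Rinv_le_contravar; [nra|lra]. }
  assert (H1P : 0 < 1 / P) by (apply Rdiv_lt_0_compat; lra).
  assert (Hconv : forall M0 A, 0 <= M0 -> M0 <= M1 + M2 -> 0 <= A -> M0 * (1 / a) * A <= (M1 + M2) / eps * (1 / P) * A).
  { intros M0 A HM0 HM0' HA. apply Rmult_le_compat_r; auto.
    apply Rle_trans with (M0 * (/ eps * (1 / P))); [now apply Rmult_le_compat_l|].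
    unfold Rdiv at 2. rewrite (Rmult_assoc (M1 + M2)). apply Rmult_le_compat_r; auto.
    apply Rmult_le_pos; [left; now apply Rinv_0_lt_compat|lra]. }
  split.
  - rewrite E_bessel_sum, leading_mu. fold b w q mu p.
    assert (Hlead : Cmod (RtoC p * Cexp mu)%C = p * exp a) by (rewrite Cmod_mult, Cmod_R, Cmod_Cexp, Rabs_right; auto; lra).
    eapply Rle_trans; [|apply (Hconv M1); auto; [lra|apply Cmod_ge_0]].
    rewrite Hlead.
    replace (bessel_sum b 0 w q - RtoC p * Cexp mu)%C with ((bessel_sum b 0 w q - ratio_sum b 0 w) + (ratio_sum b 0 w - RtoC p * Cexp mu))%C by ring.
    eapply Rle_trans; [apply Cmod_triangle|]. specialize (HLe L HL).
    replace (M1 * (1 / a) * (p * exp a)) with (Qm * L * (exp a / a) + 36 * C1 * (exp a / a)) by (unfold M1, p; field; lra).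
    lra.
  - intros v Hv.
    assert (Hvx : Cmod (v / x)%C = / Cmod x) by (rewrite Cmod_div, Hv by auto; unfold Rdiv; ring).
    assert (Hix : 0 < / Cmod x) by (apply Rinv_0_lt_compat; lra).
    assert (Hdl : Cmod (leading_deriv alpha tau x v) = / Cmod x * (1 / alpha ^ 2 * (Cmod mu * exp a))).
    { unfold leading_deriv. fold mu. rewrite (Cmod_mult (v / x)), !Cmod_mult, Cmod_R, Cmod_Cexp, Hvx.
      rewrite Rabs_right; auto. left; apply Rdiv_lt_0_compat; lra. }
    eapply Rle_trans; [|apply (Hconv M2); auto; [lra|apply Cmod_ge_0]].
    unfold E_deriv. fold b w q. fold bm.
    (* Three errors: the Bessel terms n >= 1, the Mittag-Leffler remainder of w E_alpha', and the
       derivative of the Bessel factor. *)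
    match goal with |- Cmod (?u1 - ?u2 - _)%C <= _ => replace (u1 - u2 - leading_deriv alpha tau x v)%C with
      (v / x * (bessel_sum bm 0 w q - ratio_sum bm 0 w) + v / x * (ratio_sum bm 0 w - RtoC (1 / alpha ^ 2) * (mu * Cexp mu)) + - u2)%C
      by (unfold leading_deriv; fold mu; ring) end.
    eapply Rle_trans; [apply Cmod_sum3|]. rewrite Cmod_opp, (Cmod_mult (v / x)), (Cmod_mult (v / x)), (Cmod_mult (RtoC _)), Hvx, Cmod_R.
    assert (Z1 : / Cmod x * Cmod (bessel_sum bm 0 w q - ratio_sum bm 0 w)%C <= / Cmod x * (Qm * L' * (exp a / a))).
    { apply Rmult_le_compat_l; [lra|]. eapply Rle_trans; [exact T0m|]. now apply HLe. }
    assert (Z2 : / Cmod x * Cmod (ratio_sum bm 0 w - RtoC (1 / alpha ^ 2) * (mu * Cexp mu))%C <= / Cmod x * (36 * C1 * (exp a / a))).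
    { apply Rmult_le_compat_l; [lra|]. exact X2'. }
    (* |x| <= rad^2 / |x| brings out the common factor 1/|x| of the leading derivative. *)
    assert (Z3 : Rabs (k ^ 2 / 2 * (Re x * Re v + Im x * Im v)) * Cmod (bessel_sum b 1 w q) <= / Cmod x * (k ^ 2 * rad ^ 2 * (Qm * L) * (exp a / a))).
    { assert (Hk2 : 0 <= k ^ 2) by apply pow2_ge_0.
      assert (K1 : Rabs (k ^ 2 / 2 * (Re x * Re v + Im x * Im v)) <= / Cmod x * (k ^ 2 * rad ^ 2)).
      { rewrite Rabs_mult, (Rabs_right (k ^ 2 / 2)) by lra.
        assert (Rabs (Re x * Re v + Im x * Im v) <= 2 * Cmod x).
        { eapply Rle_trans; [apply Rabs_triang|]. rewrite !Rabs_mult.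
          assert (A1 := re_le_Cmod x). assert (A2 := Im_le_Cmod x).
          assert (A3 := re_le_Cmod v). assert (A4 := Im_le_Cmod v). rewrite Hv in A3, A4.
          assert (Rabs (Re x) * Rabs (Re v) <= Cmod x * 1) by (apply Rmult_le_compat; try apply Rabs_pos; lra).
          assert (Rabs (Im x) * Rabs (Im v) <= Cmod x * 1) by (apply Rmult_le_compat; try apply Rabs_pos; lra). lra. }
        apply Rle_trans with (k ^ 2 * Cmod x); [nra|].
        apply (Rmult_le_reg_l (Cmod x)); [lra|].
        replace (Cmod x * (/ Cmod x * (k ^ 2 * rad ^ 2))) with (k ^ 2 * rad ^ 2) by (field; lra).
        replace (Cmod x * (k ^ 2 * Cmod x)) with (k ^ 2 * (Cmod x * Cmod x)) by ring.
        apply Rmult_le_compat_l; auto. nra. }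
      rewrite (Rmult_assoc (k ^ 2 * rad ^ 2)), <- Rmult_assoc. apply Rmult_le_compat; auto.
      - apply Rabs_pos.
      - apply Cmod_ge_0.
      - eapply Rle_trans; [exact T1|]. now apply HLe. }
    eapply Rle_trans; [apply Rplus_le_compat; [apply Rplus_le_compat; [exact Z1|exact Z2]|exact Z3]|].
    rewrite Hdl. rewrite <- !Rmult_plus_distr_l.
    replace (M2 * (1 / a) * (/ Cmod x * (1 / alpha ^ 2 * (Cmod mu * exp a)))) with
      (/ Cmod x * ((Qm * (B / alpha ^ 2 + 2 * C1) + 36 * C1 + k ^ 2 * rad ^ 2 * (Qm * L)) * Cmod mu * (exp a / a)))
      by (unfold M2; field; lra).
    apply Rmult_le_compat_l; [lra|]. rewrite <- !Rmult_plus_distr_r.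
    apply Rmult_le_compat_r; [lra|].
    (* Each constant is weakened by a factor |mu|, using 1 <= a <= |mu|, to match the modulus of the
       leading derivative. *)
    assert (W1 : Qm * L' <= Qm * (B / alpha ^ 2 + 2 * C1) * Cmod mu).
    { rewrite Rmult_assoc. apply Rmult_le_compat_l; [lra|]. unfold L'. nra. }
    assert (W2 : 36 * C1 <= 36 * C1 * Cmod mu) by nra.
    assert (W3 : k ^ 2 * rad ^ 2 * (Qm * L) <= k ^ 2 * rad ^ 2 * (Qm * L) * Cmod mu).
    { assert (0 <= k ^ 2 * rad ^ 2 * (Qm * L)).
      { apply Rmult_le_pos; [apply Rmult_le_pos; apply pow2_ge_0|apply Rmult_le_pos; lra]. }
      nra. }
    rewrite !Rmult_plus_distr_r. lra.
Qed.

Lemma Rdiff_E (k alpha tau : R) (z0 v : C) (t : R) : 0 < alpha -> 0 < tau -> Cmod v = 1 -> (z0 + RtoC t * v)%C <> 0%C ->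
  Rdiff (fun s => E k alpha tau (z0 + RtoC s * v)%C) t (E_deriv k alpha tau (z0 + RtoC t * v) v).
Proof.
  intros Ha Htau Hv Hx. eapply Rdiff_ext; [intros s; symmetry; apply E_bessel_sum|].
  apply Rdiff_bessel_sum; auto; [now apply entire_ml_coef|lra].
Qed.

Lemma Rdiff_leading (alpha tau : R) (z0 v : C) (t : R) : 0 < alpha -> 0 < Re (z0 + RtoC t * v)%C -> Cmod v = 1 ->
  Rdiff (fun s => leading alpha tau (z0 + RtoC s * v)%C) t (leading_deriv alpha tau (z0 + RtoC t * v) v).
Proof.
  intros Ha Hx Hv. set (x := (z0 + RtoC t * v)%C) in *. set (p := 1 / alpha). set (P := Rpower tau p).
  set (F := fun z => (RtoC p * Cexp (RtoC P * Cexp (RtoC p * Clog_rhp z)))%C).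
  assert (Hxn := Re_pos_neq_0 x Hx).
  assert (EF : forall z, 0 < Re z -> leading alpha tau z = F z).
  { intros z Hz. unfold leading, Cpower, F. rewrite Clog_Clog_rhp by auto. reflexivity. }
  (* [Clog] and [Clog_rhp] are identified for Re z > 0; as |v| = 1, the line stays there for |s - t|
     < Re x. *)
  apply (Rdiff_ext_loc (fun s => F (z0 + RtoC s * v)%C) _ t (Re x)); auto.
  - intros s Hs. symmetry. apply EF.
    replace (z0 + RtoC s * v)%C with (x + RtoC (s - t) * v)%C by (unfold x; rewrite RtoC_minus; ring).
    assert (Hr := re_le_Cmod (RtoC (s - t) * v)%C). rewrite Cmod_mult, Cmod_R, Hv, Rmult_1_r in Hr.
    assert (Hr2 : - Re x < Re (RtoC (s - t) * v)%C).
    { assert (Q : Rabs (Re (RtoC (s - t) * v)%C) < Re x) by lra. apply Rabs_def2 in Q. lra. }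
    change (Re (x + RtoC (s - t) * v)%C) with (Re x + Re (RtoC (s - t) * v)%C). lra.
  - assert (D1 := Cdiff_mult _ _ x _ _ (Cdiff_const (RtoC p) x) (Cdiff_Clog_rhp x Hx)).
    assert (D2 := Cdiff_comp Cexp _ _ _ _ (Cdiff_exp _) D1).
    assert (D3 := Cdiff_mult _ _ x _ _ (Cdiff_const (RtoC P) x) D2).
    assert (D4 := Cdiff_comp Cexp _ _ _ _ (Cdiff_exp _) D3).
    assert (D5 := Cdiff_mult _ _ x _ _ (Cdiff_const (RtoC p) x) D4).
    assert (D6 := Cdiff_line F z0 v _ t D5). fold x in D6.
    match type of D6 with Rdiff _ _ ?Y => replace (leading_deriv alpha tau x v) with Y; [exact D6|] end.
    unfold leading_deriv, mu_of, Cpower. rewrite Clog_Clog_rhp by auto. fold p P.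
    replace (1 / alpha ^ 2) with (p * p) by (unfold p; field; lra). rewrite RtoC_mult. field. auto.
Qed.

Lemma uniform_asymp_intro (D : C -> Prop) (g : R -> R) (F A : R -> C -> C) (M T : R) :
  (forall tau x, T <= tau -> D x -> A tau x <> 0%C) ->
  (forall tau x, T <= tau -> D x -> Cmod (F tau x - A tau x)%C <= M * g tau * Cmod (A tau x)) ->
  uniform_asymp D g F A.
Proof.
  intros H0 H. exists M, T. intros tau x Ht Hx. specialize (H0 tau x Ht Hx). specialize (H tau x Ht Hx).
  assert (P : 0 < Cmod (A tau x)) by now apply Cmod_gt_0.
  exists ((F tau x - A tau x) / A tau x)%C. split; [field; auto|].
  rewrite Cmod_div by auto. apply (Rmult_le_reg_r (Cmod (A tau x))); auto.
  unfold Rdiv. rewrite Rmult_assoc, Rinv_l, Rmult_1_r; lra.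
Qed.

Lemma line1 (x : C) (t : R) : (t, Im x) = ((0, Im x) + RtoC t * 1)%C.
Proof. unfold Cplus, Cmult, RtoC; simpl. f_equal; ring. Qed.

Lemma line2 (x : C) (t : R) : (Re x, t) = (RtoC (Re x) + RtoC t * Ci)%C.
Proof. unfold Cplus, Cmult, RtoC, Ci; simpl. f_equal; ring. Qed.

Lemma Rdiff_partials (k alpha tau : R) (x : C) : 0 < alpha -> 0 < tau -> 0 < Re x ->
  (Rdiff (fun t => E k alpha tau (t, Im x)) (Re x) (E_deriv k alpha tau x 1) /\
   Rdiff (fun t => leading alpha tau (t, Im x)) (Re x) (leading_deriv alpha tau x 1)) /\
  (Rdiff (fun t => E k alpha tau (Re x, t)) (Im x) (E_deriv k alpha tau x Ci) /\
   Rdiff (fun t => leading alpha tau (Re x, t)) (Im x) (leading_deriv alpha tau x Ci)).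
Proof.
  intros Ha Ht Hx.
  assert (E1 : ((0, Im x) + RtoC (Re x) * 1)%C = x) by (rewrite <- line1; symmetry; apply surj_C).
  assert (E2 : (RtoC (Re x) + RtoC (Im x) * Ci)%C = x) by (rewrite <- line2; symmetry; apply surj_C).
  assert (Hn := Re_pos_neq_0 x Hx).
  assert (F1 := Rdiff_E k alpha tau (0, Im x) 1 (Re x) Ha Ht Cmod_1). rewrite E1 in F1.
  assert (F2 := Rdiff_leading alpha tau (0, Im x) 1 (Re x) Ha). rewrite E1 in F2.
  assert (F3 := Rdiff_E k alpha tau (RtoC (Re x)) Ci (Im x) Ha Ht Cmod_Ci). rewrite E2 in F3.
  assert (F4 := Rdiff_leading alpha tau (RtoC (Re x)) Ci (Im x) Ha). rewrite E2 in F4.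
  assert (L1 : forall F : C -> C, forall s, F ((0, Im x) + RtoC s * 1)%C = F (s, Im x)) by (intros F s; now rewrite (line1 x s)).
  assert (L2 : forall F : C -> C, forall s, F (RtoC (Re x) + RtoC s * Ci)%C = F (Re x, s)) by (intros F s; now rewrite (line2 x s)).
  split; split.
  - exact (Rdiff_ext _ _ _ _ (L1 _) (F1 Hn)).
  - exact (Rdiff_ext _ _ _ _ (L1 _) (F2 Hx Cmod_1)).
  - exact (Rdiff_ext _ _ _ _ (L2 _) (F3 Hn)).
  - exact (Rdiff_ext _ _ _ _ (L2 _) (F4 Hx Cmod_Ci)).
Qed.

Theorem proposition2p2 (k alpha rad eps : R)
  (hk : 0 <= k) (halpha : 0 < alpha <= 1) (hrad : 0 < rad) (heps : 0 < eps) :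
  uniform_asymp (region alpha rad eps) (fun tau => 1 / Rpower tau (1 / alpha))
    (fun tau => E k alpha tau) (fun tau => leading alpha tau)
  /\
  ((forall (tau : R) (x : C), 0 < tau -> region alpha rad eps x ->
      ex_partial1 (E k alpha tau) x /\ ex_partial1 (leading alpha tau) x)
   /\
   uniform_asymp (region alpha rad eps) (fun tau => 1 / Rpower tau (1 / alpha))
     (fun tau => partial1 (E k alpha tau))
     (fun tau => partial1 (leading alpha tau)))
  /\
  ((forall (tau : R) (x : C), 0 < tau -> region alpha rad eps x ->
      ex_partial2 (E k alpha tau) x /\ ex_partial2 (leading alpha tau) x)
   /\
   uniform_asymp (region alpha rad eps) (fun tau => 1 / Rpower tau (1 / alpha))
     (fun tau => partial2 (E k alpha tau))
     (fun tau => partial2 (leading alpha tau))).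
Proof.
  assert (Ha := proj1 halpha).
  destruct (estimates k alpha rad eps halpha hrad heps) as [M [T [_ [HT Hest]]]].
  assert (Hre : forall x, region alpha rad eps x -> 0 < Re x).
  { intros x Hx. apply (region_props alpha rad eps x halpha hrad Hx). }
  assert (Hmu : forall tau x, region alpha rad eps x -> mu_of alpha tau x <> 0%C).
  { intros tau x Hx. destruct (region_props alpha rad eps x halpha hrad Hx) as [_ [_ [_ [_ H]]]].
    unfold mu_of. apply Cmult_neq_0.
    - intros Q. apply RtoC_inj in Q. generalize (exp_pos (1 / alpha * ln tau)). unfold Rpower in Q. lra.
    - intros Q. rewrite Q in H. simpl in H. lra. }
  (* A relative error presupposes a nonzero leading derivative; it is a product of v/x, mu, an
     exponential and a constant, and mu <> 0 because Re x^(1/alpha) >= eps > 0. *)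
  assert (Hld : forall tau x (v : C), region alpha rad eps x -> v <> 0%C -> leading_deriv alpha tau x v <> 0%C).
  { intros tau x v Hx Hv. assert (Hn := Re_pos_neq_0 x (Hre x Hx)). unfold leading_deriv.
    apply Cmult_neq_0; [apply Cmod_gt_0; rewrite Cmod_div by auto; apply Rdiv_lt_0_compat; [exact (proj1 (Cmod_gt_0 v) Hv)|exact (proj1 (Cmod_gt_0 x) Hn)]|]. apply Cmult_neq_0.
    - intros Q. apply RtoC_inj in Q. assert (0 < 1 / alpha ^ 2) by (apply Rdiv_lt_0_compat; nra). lra.
    - apply Cmult_neq_0; [now apply Hmu|apply Cexp_neq_0]. }
  assert (N1 : (1 : C) <> 0%C) by (intros Q; apply RtoC_inj in Q; lra).
  assert (Ni : Ci <> 0%C) by (intros Q; injection Q; lra).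
  split; [|split; split].
  - apply (uniform_asymp_intro _ _ _ _ M T).
    + intros tau x _ _. rewrite leading_mu. apply Cmult_neq_0; [|apply Cexp_neq_0].
      intros Q. apply RtoC_inj in Q. assert (0 < 1 / alpha) by (apply Rdiv_lt_0_compat; lra). lra.
    + intros tau x Ht Hx. apply (Hest tau x Ht Hx).
  - intros tau x Ht Hx. destruct (Rdiff_partials k alpha tau x Ha Ht (Hre x Hx)) as [[P1 P2] _].
    split; eapply Rdiff_ex_derive; eassumption.
  - apply (uniform_asymp_intro _ _ _ _ M T); intros tau x Ht Hx;
      destruct (Rdiff_partials k alpha tau x Ha ltac:(lra) (Hre x Hx)) as [[P1 P2] _];
      unfold partial1; rewrite ?(Rdiff_CDerive _ _ _ P1), (Rdiff_CDerive _ _ _ P2).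
    + now apply Hld.
    + apply (Hest tau x Ht Hx), Cmod_1.
  - intros tau x Ht Hx. destruct (Rdiff_partials k alpha tau x Ha Ht (Hre x Hx)) as [_ [P1 P2]].
    split; eapply Rdiff_ex_derive; eassumption.
  - apply (uniform_asymp_intro _ _ _ _ M T); intros tau x Ht Hx;
      destruct (Rdiff_partials k alpha tau x Ha ltac:(lra) (Hre x Hx)) as [_ [P1 P2]];
      unfold partial2; rewrite ?(Rdiff_CDerive _ _ _ P1), (Rdiff_CDerive _ _ _ P2).
    + now apply Hld.
    + apply (Hest tau x Ht Hx), Cmod_Ci.
Qed.
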